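(* Let $\Bbbk$ be an algebraically closed field of arbitrary characteristic, let $M$ be a free abelian group of rank $n$, let $A=\{u_0,\ldots,u_N\}\subset M$ be a finite subset with $\operatorname{Aff}(A)=M$, and let $\gamma: X_A\dashrightarrow\mathbb{G}(n,\mathbb{P}^N)$ be the Gauss map of $X_A\subset\mathbb{P}^N$. Set $$B:=\{u_{i_0}+\cdots+u_{i_n}\in M\mid u_{i_0},\ldots,u_{i_n}\in A\text{ span the }\Bbbk\text{-affine space }M_{\Bbbk}\}.$$ Let $\gamma|_{T_M}=g_2\circ g_1$ be the decomposition $$T_M\xrightarrow{\ g_1\ }T_{\langle B-B\rangle_{\mathbb{R}}\cap M}\xrightarrow{\ g_2\ }T_{\langle B-B\rangle}$$ induced by the inclusions $\langle B-B\rangle\subset\langle B-B\rangle_{\mathbb{R}}\cap M\subset M$, where $g_1$ has reduced and irreducible fibers and $g_2$ is finite. Then the following hold. (1) The rank of $\gamma$ is equal to $\dim(\operatorname{Aff}_{\Bbbk}(B))$. In particular, $\gamma$ is separable if and only if $\dim(\operatorname{Aff}_{\Bbbk}(B))=\operatorname{rk}(\operatorname{Aff}(B))$. (2) Assume $p=\operatorname{char}\Bbbk>0$. Then $$\deg(g_2)=[\langle B-B\rangle_{\mathbb{R}}\cap M:\langle B-B\rangle].$$ For the maximum integer $s\ge0$ such that $p^s\mid\deg(g_2)$, the separable degree and the inseparable degree of $g_2$ are $\deg(g_2)/p^s$ and $p^s$ respectively. Hence the number of the irreducible components of a general fiber of $\gamma$ is equal to $\deg(g_2)/p^s$, which is coprime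 to $p$.
   Context: For a free abelian group $M$ of finite rank, $T_M=\operatorname{Spec}\Bbbk[M]$, where $\Bbbk[M]=\bigoplus_{u\in M}\Bbbk z^u$, and $M_{\Bbbk}=M\otimes_{\mathbb{Z}}\Bbbk$. For a finite subset $A=\{u_0,\ldots,u_N\}\subset M$ (distinct elements), $X_A\subset\mathbb{P}^N$ is the closure of the image of $\varphi_A: T_M\to\mathbb{P}^N$, $t\mapsto[z^{u_0}(t):\cdots:z^{u_N}(t)]$; if $\operatorname{Aff}(A)=M$, then $\varphi_A$ identifies $T_M$ with an open subset of $X_A$. For a finite $S\subset M$: $\operatorname{Aff}(S)\subset M$ is the affine sublattice of all $\sum_i a_iu_i$ with $u_i\in S$, $a_i\in\mathbb{Z}$, $\sum_i a_i=1$; $\operatorname{Aff}_{\Bbbk}(S)\subset M_{\Bbbk}$ is the $\Bbbk$-affine subspace of all $\sum_i a_iu_i$ (in $M_{\Bbbk}$) with $u_i\in S$, $a_i\in\Bbbk$, $\sum_i a_i=1$; $S$ spans the $\Bbbk$-affine space $M_{\Bbbk}$ if $\operatorname{Aff}_{\Bbbk}(S)=M_{\Bbbk}$. $\langle S-S\rangle\subset M$ is the subgroup generated by $\{u-u'\mid u,u'\in S\}$, $\langle S-S\rangle_{\mathbb{R}}\subset M\otimes\mathbb{R}$ its real span, and $\operatorname{rk}\operatorname{Aff}(S)=\operatorname{rk}\langle S-S\rangle$. The Gauss map of an $n$-dimensional projective variety $X\subset\mathbb{P}^N$ is the rational map $\gamma: X\dashrightarrow\mathbb{G}(n,\mathbb{P}^N)$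 sending each smooth point $x$ to the embedded tangent space $\mathbb{T}_xX$. Its rank is the rank of the tangent map $d_x\gamma$ between Zariski tangent spaces at a general $x\in X$; it is separable if the field extension $K(X)/K(\gamma(X))$ is separable. The closure $\overline{\gamma(X_A)}$ (via the Plücker embedding) is projectively equivalent to $X_B$, which contains $T_{\langle B-B\rangle}$ as an open dense orbit, and under this identification $\gamma|_{T_M}$ is the morphism $T_M\to T_{\langle B-B\rangle}$ induced by $\langle B-B\rangle\subset M$. *)

(* Defs.v *)
From HB Require Import structures.
From mathcomp Require Import all_boot all_order all_algebra all_field.
From mathcomp Require Import mpoly.
From mathcomp Require Import reals.

Set Implicit Arguments.
Unset Strict Implicit.
Unset Printing Implicit Defensive.

Import GRing.Theory.
Local Open Scope ring_scope.

(** * Lattices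

    Subsets are predicates.  A free abelian group of rank [n] is a zmodType [M]
    with an additive bijection [co : M -> 'rV[int]_n]; it identifies
    [M (x) F] with ['rV[F]_n], the vector [u (x) 1] being [base F co u]. *)

Definition family_set (I T : Type) (f : I -> T) : T -> Prop :=
  fun x => exists i, x = f i.

Definition differences (M : zmodType) (S : M -> Prop) : M -> Prop :=
  fun x => exists a b, [/\ S a, S b & x = a - b].

Definition subgroup_gen (M : zmodType) (S : M -> Prop) : M -> Prop :=
  fun x => exists (l : nat) (w : 'I_l -> M) (a : 'I_l -> int),
    (forall i, S (w i)) /\ x = \sum_i w i *~ a i.

(* the subgroup written <S - S> *)
Definition diff_group (M : zmodType) (S : M -> Prop) : M -> Prop :=
  subgroup_gen (differences S).

Definition Aff (M : zmodType) (S : M -> Prop) : M -> Prop :=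
  fun x => exists (l : nat) (w : 'I_l -> M) (a : 'I_l -> int),
    [/\ forall i, S (w i), \sum_i a i = 1 & x = \sum_i w i *~ a i].

Definition lattice_rank (M : zmodType) (L : M -> Prop) (r : nat) : Prop :=
  exists b : 'I_r -> M,
    (forall c : 'I_r -> int, \sum_i b i *~ c i = 0 -> forall i, c i = 0) /\
    (forall x, L x <-> exists c : 'I_r -> int, x = \sum_i b i *~ c i).

Definition rk_Aff (M : zmodType) (S : M -> Prop) (r : nat) : Prop :=
  lattice_rank (diff_group S) r.

(* [H : L] = d *)
Definition group_index (M : zmodType) (H L : M -> Prop) (d : nat) : Prop :=
  exists c : 'I_d -> M,
    (forall i, H (c i)) /\ (forall x, H x -> exists! i, L (x - c i)).

Definition base (F : pzRingType) (n : nat) (M : zmodType)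
    (co : M -> 'rV[int]_n) (x : M) : 'rV[F]_n :=
  map_mx intr (co x).

(* Aff_F(S), a subset of M (x) F *)
Definition Aff_over (F : fieldType) (n : nat) (M : zmodType)
    (co : M -> 'rV[int]_n) (S : M -> Prop) : 'rV[F]_n -> Prop :=
  fun v => exists (l : nat) (w : 'I_l -> M) (a : 'I_l -> F),
    [/\ forall i, S (w i), \sum_i a i = 1
      & v = \sum_i a i *: base F co (w i)].

Definition spans_over (F : fieldType) (n : nat) (M : zmodType)
    (co : M -> 'rV[int]_n) (S : M -> Prop) : Prop :=
  forall v : 'rV[F]_n, Aff_over co S v.

(* E is an affine subspace of dimension r *)
Definition aff_dim (F : fieldType) (n : nat) (E : 'rV[F]_n -> Prop) (r : nat)
    : Prop :=
  exists (x0 : 'rV[F]_n) (W : 'M[F]_(r, n)),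
    row_free W /\ (forall v, E v <-> (v - x0 <= W)%MS).

(* L_R \cap M, where L_R is the real span of L *)
Definition real_span_cap (R : realType) (n : nat) (M : zmodType)
    (co : M -> 'rV[int]_n) (L : M -> Prop) : M -> Prop :=
  fun x => exists (l : nat) (w : 'I_l -> M) (a : 'I_l -> R),
    (forall i, L (w i)) /\ base R co x = \sum_i a i *: base R co (w i).

Definition vertex_sum (n N : nat) (M : zmodType) (u : 'I_N.+1 -> M)
    (f : {ffun 'I_n.+1 -> 'I_N.+1}) : M := \sum_j u (f j).

Definition spanning (F : fieldType) (n N : nat) (M : zmodType)
    (co : M -> 'rV[int]_n) (u : 'I_N.+1 -> M)
    (f : {ffun 'I_n.+1 -> 'I_N.+1}) : Prop :=
  spans_over F co (family_set (fun j => u (f j))).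

Definition Bset (F : fieldType) (n N : nat) (M : zmodType)
    (co : M -> 'rV[int]_n) (u : 'I_N.+1 -> M) : M -> Prop :=
  fun b => exists f, spanning F co u f /\ b = vertex_sum u f.

(** * Projective sets over an algebraically closed field

    A set of points of P^(m-1) is given by a set of nonzero vectors of
    ['rV[k]_m] (homogeneous coordinates). *)

Section Projective.
Variable k : closedFieldType.

Definition ev (F : comNzRingType) (m : nat) (P : {mpoly F[m]}) (x : 'rV[F]_m)
    : F := P.@[x ord0].

Definition vanishes (m : nat) (X : 'rV[k]_m -> Prop) (P : {mpoly k[m]}) : Prop :=
  forall x, X x -> ev P x = 0.

Definition zclosed (m : nat) (C : 'rV[k]_m -> Prop) : Prop :=
  exists S : {mpoly k[m]} -> Prop,
    (forall P, S P -> exists d, P \is d.-homog) /\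
    (forall x, C x <-> x != 0 /\ forall P, S P -> ev P x = 0).

Definition zclosure (m : nat) (X : 'rV[k]_m -> Prop) : 'rV[k]_m -> Prop :=
  fun x => x != 0 /\
    forall (d : nat) (P : {mpoly k[m]}), P \is d.-homog -> vanishes X P -> ev P x = 0.

(* "[Pr x] for a general point x of X": for all x in a nonempty basic open
   subset of X (X is meant to be irreducible) *)
Definition generically (m : nat) (X Pr : 'rV[k]_m -> Prop) : Prop :=
  exists (d : nat) (Q : {mpoly k[m]}),
    [/\ Q \is d.-homog,
        exists x, X x /\ ev Q x != 0
      & forall x, X x -> ev Q x != 0 -> Pr x].

Definition zirreducible (m : nat) (Z : 'rV[k]_m -> Prop) : Prop :=
  (exists x, Z x) /\
  forall C1 C2, zclosed C1 -> zclosed C2 -> (forall x, Z x -> C1 x \/ C2 x) ->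
    (forall x, Z x -> C1 x) \/ (forall x, Z x -> C2 x).

Definition irr_component (m : nat) (Z Y : 'rV[k]_m -> Prop) : Prop :=
  [/\ forall x, Y x -> Z x, zirreducible Y
    & forall Y' : 'rV[k]_m -> Prop, (forall x, Y' x -> Z x) -> zirreducible Y' ->
        (forall x, Y x -> Y' x) -> forall x, Y' x -> Y x].

Definition irr_component_count (m : nat) (Z : 'rV[k]_m -> Prop) (c : nat) : Prop :=
  exists Y : 'I_c -> 'rV[k]_m -> Prop,
    [/\ forall i, irr_component Z (Y i),
        forall i j, (forall x, Y i x <-> Y j x) -> i = j
      & forall Y', irr_component Z Y' -> exists i, forall x, Y i x <-> Y' x].

(* the affine cone over the embedded tangent space of X at x *)
Definition tangent (m : nat) (X : 'rV[k]_m -> Prop) (x : 'rV[k]_m)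
    : 'rV[k]_m -> Prop :=
  fun v => forall (d : nat) (P : {mpoly k[m]}), P \is d.-homog -> vanishes X P ->
    \sum_i ev (P^`M(i)) x * v ord0 i = 0.

(** ** Rational maps

    A rational map from X to a projective space is given by its graph
    [G : 'rV_m -> 'rV_l -> Prop] on its domain of definition; it is represented
    by tuples of forms of the same degree agreeing with it generically on X. *)

Definition ev_tuple (F : comNzRingType) (m l : nat) (f : 'I_l -> {mpoly F[m]})
    (x : 'rV[F]_m) : 'rV[F]_l := \row_j ev (f j) x.

Definition represents (m l : nat) (X : 'rV[k]_m -> Prop)
    (G : 'rV[k]_m -> 'rV[k]_l -> Prop) (f : 'I_l -> {mpoly k[m]}) : Prop :=
  (exists d, forall j, f j \is d.-homog) /\
  generically X (fun x => G x (ev_tuple f x)).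

(* The Zariski tangent space of X at x is the quotient by <x> of the tangent
   cone W (twisted by the line <x>), and similarly <y> \ k^l is the tangent
   space of the target at y = f(x); df_x maps <x> into <f(x)> by Euler's
   formula.  So the rank of the tangent map is dim (df_x(W) + <f(x)>) - 1. *)
Definition differential_rank (m l : nat) (X : 'rV[k]_m -> Prop)
    (f : 'I_l -> {mpoly k[m]}) (x : 'rV[k]_m) (r : nat) : Prop :=
  exists W : 'M[k]_m,
    (forall v : 'rV[k]_m, (v <= W)%MS <-> tangent X x v) /\
    \rank (col_mx (W *m \matrix_(i, j) ev ((f j)^`M(i)) x) (ev_tuple f x))
      = r.+1.

Definition rational_map_rank (m l : nat) (X : 'rV[k]_m -> Prop)
    (G : 'rV[k]_m -> 'rV[k]_l -> Prop) (r : nat) : Prop :=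
  exists f, represents X G f /\ generically X (fun x => differential_rank X f x r).

(* the closure of the image *)
Definition image_closure (m l : nat) (G : 'rV[k]_m -> 'rV[k]_l -> Prop)
    : 'rV[k]_l -> Prop :=
  zclosure (fun y => exists x, G x y).

Definition general_fiber_component_count (m l : nat)
    (G : 'rV[k]_m -> 'rV[k]_l -> Prop) (c : nat) : Prop :=
  generically (image_closure G) (fun y => irr_component_count (fun x => G x y) c).

(** ** The Gauss map

    Plücker coordinates are indexed by all maps from 'I_n.+1 to 'I_N.+1, not
    only the increasing ones, so the Grassmannian is embedded in the subspace of
    alternating tensors. *)

Definition plucker_index (n N : nat) : finType := {ffun 'I_n.+1 -> 'I_N.+1}.

Definition plucker (n N : nat) (W : 'M[k]_(n.+1, N.+1))
    : 'rV[k]_#|plucker_index n N| :=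
  \row_j \det (colsub (enum_val j : plucker_index n N) W).

(* For X of dimension n: x is a smooth point of X, i.e. its embedded tangent
   space has dimension n, and y is a vector of Plücker coordinates of the latter.
   All nonzero multiples of y are obtained by changing the basis W. *)
Definition gauss (n N : nat) (X : 'rV[k]_N.+1 -> Prop)
    (x : 'rV[k]_N.+1) (y : 'rV[k]_#|plucker_index n N|) : Prop :=
  X x /\
  exists W : 'M[k]_(n.+1, N.+1),
    [/\ row_free W,
        forall v : 'rV[k]_N.+1, (v <= W)%MS <-> tangent X x v
      & y = plucker W].

(** ** Tori and toric varieties

    Closed points of [Spec k[L]], for a subgroup L of M, are characters of L;
    they are represented by functions on M whose values outside L are
    irrelevant.  The morphism [T_H -> T_L] induced by an inclusion of L in H is
    restriction, hence it is the identity on representatives. *)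

Definition torus_point (M : zmodType) (L : M -> Prop) (t : M -> k) : Prop :=
  t 0 = 1 /\ (forall a b, L a -> L b -> t (a + b) = t a * t b).

Definition full (M : zmodType) : M -> Prop := fun=> True.

Definition phi (N : nat) (M : zmodType) (u : 'I_N.+1 -> M) (t : M -> k)
    : 'rV[k]_N.+1 := \row_i t (u i).

Definition toric_variety (N : nat) (M : zmodType) (u : 'I_N.+1 -> M)
    : 'rV[k]_N.+1 -> Prop :=
  zclosure (fun x => exists t, torus_point (@full M) t /\ x = phi u t).

(* On T_M the Gauss map is [c_f z^(b_f)]_f, where b_f is the sum of the u_i
   selected by f, and c_f is nonzero exactly when b_f is one of the sums defining
   B: it is t |-> [z^b(t)]_(b in B) followed by a linear embedding, and so it
   factors through T_M -> T_<B - B>. *)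
Definition gauss_on_torus (n N : nat) (M : zmodType) (co : M -> 'rV[int]_n)
    (u : 'I_N.+1 -> M) : Prop :=
  exists c : plucker_index n N -> k,
    (forall f, c f != 0 <-> spanning k co u f) /\
    (forall t, torus_point (@full M) t ->
       gauss (toric_variety u) (phi u t)
         (\row_j (c (enum_val j) * t (vertex_sum u (enum_val j))))).

End Projective.

Arguments gauss {k} n {N} X x y.

(** * Field extensions

    Subfields of a field K are predicates on K. *)

Section Extensions.
Variable K : fieldType.
Implicit Types F E : K -> Prop.

Definition is_subfield F : Prop :=
  [/\ F 1, forall x y, F x -> F y -> F (x - y)
    & forall x y, F x -> F y -> F (x / y)].

Definition field_gen (S : K -> Prop) : K -> Prop :=
  fun x => forall F, is_subfield F -> (forall y, S y -> F y) -> F x.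

(* [E : F] = d *)
Definition ext_degree F E (d : nat) : Prop :=
  exists e : 'I_d -> K,
    (forall i, E (e i)) /\
    (forall x, E x -> exists! c : {ffun 'I_d -> K},
       (forall i, F (c i)) /\ x = \sum_i c i * e i).

Definition poly_over F (q : {poly K}) : Prop := forall i, F q`_i.

Definition is_min_poly F (x : K) (q : {poly K}) : Prop :=
  [/\ poly_over F q, q \is monic, root q x
    & forall q', poly_over F q' -> root q' x -> q' != 0 -> (size q <= size q')%N].

Definition separable_over F (x : K) : Prop :=
  exists q, is_min_poly F x q /\ separable_poly q.

Definition sep_closure F E : K -> Prop := fun x => E x /\ separable_over F x.

Definition sep_degree F E (d : nat) : Prop := ext_degree F (sep_closure F E) d.

Definition insep_degree F E (d : nat) : Prop := ext_degree (sep_closure F E) E d.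

Definition alg_independent F (m : nat) (b : 'I_m -> K) : Prop :=
  forall P : {mpoly K[m]}, (forall a, F P@_a) -> P.@[b] = 0 -> P = 0.

(* Separability of the finitely generated extension K / F, possibly of positive
   transcendence degree: K / F has a separating transcendence basis. *)
Definition separable_ext F : Prop :=
  exists (m : nat) (b : 'I_m -> K),
    alg_independent F b /\
    (forall x, separable_over (field_gen (fun y => F y \/ family_set b y)) x).

End Extensions.

Section FunctionFields.
Variables (k : closedFieldType) (K : fieldType) (iota : {rmorphism k -> K}).

(* K is the function field of X, and xi is the generic point of X in P^(m-1)(K):
   K consists of the fractions P / Q of forms of the same degree modulo I(X). *)
Record is_function_field (m : nat) (X : 'rV[k]_m -> Prop) (xi : 'rV[K]_m)
    : Prop := IsFunctionField {
  generic_nonzero : xi != 0;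
  generic_ideal : forall (d : nat) (P : {mpoly k[m]}), P \is d.-homog ->
    (vanishes X P <-> ev (map_mpoly iota P) xi = 0);
  generic_fractions : forall x : K, exists (d : nat) (P Q : {mpoly k[m]}),
    [/\ P \is d.-homog, Q \is d.-homog, ev (map_mpoly iota Q) xi != 0
      & x = ev (map_mpoly iota P) xi / ev (map_mpoly iota Q) xi] }.

(* The subfield K(Y) of K = K(X), for the rational map from X onto Y represented
   by f; f(xi) is the generic point of Y. *)
Definition image_field (m l : nat) (f : 'I_l -> {mpoly k[m]}) (xi : 'rV[K]_m)
    : K -> Prop :=
  let y := ev_tuple (fun j => map_mpoly iota (f j)) xi in
  field_gen (fun x => family_set iota x \/
    exists i j, y ord0 j != 0 /\ x = y ord0 i / y ord0 j).

Definition separable_rational_map (m l : nat) (X : 'rV[k]_m -> Prop)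
    (G : 'rV[k]_m -> 'rV[k]_l -> Prop) (xi : 'rV[K]_m) : Prop :=
  exists f, represents X G f /\ separable_ext (image_field f xi).

(* The subring k[L] of K, for a family of characters z : M -> K. *)
Definition group_algebra (M : zmodType) (z : M -> K) (L : M -> Prop) : K -> Prop :=
  fun x => exists (l : nat) (w : 'I_l -> M) (c : 'I_l -> k),
    (forall i, L (w i)) /\ x = \sum_i iota (c i) * z (w i).

(* K is the field of fractions of k[M], in which z u is the monomial z^u. *)
Record is_torus_field (M : zmodType) (z : M -> K) : Prop := IsTorusField {
  monomial0 : z 0 = 1;
  monomialD : forall a b, z (a + b) = z a * z b;
  monomial_free : forall (l : nat) (w : 'I_l -> M) (c : 'I_l -> k), injective w ->
    \sum_i iota (c i) * z (w i) = 0 -> forall i, c i = 0;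
  monomial_fractions : forall x : K, exists a b,
    [/\ group_algebra z (@full M) a, group_algebra z (@full M) b, b != 0
      & x = a / b] }.

(* the function field of T_L inside that of T_M *)
Definition torus_field (M : zmodType) (z : M -> K) (L : M -> Prop) : K -> Prop :=
  field_gen (fun x => family_set iota x \/ exists a, L a /\ x = z a).

(* T_H -> T_L is finite: k[H] is a finitely generated k[L]-module. *)
Definition finite_torus_map (M : zmodType) (z : M -> K) (H L : M -> Prop) : Prop :=
  exists (l : nat) (e : 'I_l -> K),
    (forall i, group_algebra z H (e i)) /\
    (forall x, group_algebra z H x -> exists a : 'I_l -> K,
       (forall i, group_algebra z L (a i)) /\ x = \sum_i a i * e i).

(* the ideal of k[M] defining the scheme-theoretic fiber of T_M -> T_H over s *)
Definition fiber_ideal (M : zmodType) (z : M -> K) (H : M -> Prop) (s : M -> k)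
    : K -> Prop :=
  fun x => exists (l : nat) (w : 'I_l -> M) (a : 'I_l -> K),
    [/\ forall i, H (w i), forall i, group_algebra z (@full M) (a i)
      & x = \sum_i a i * (z (w i) - iota (s (w i)))].

(* The fibers of T_M -> T_H over closed points are reduced and irreducible, i.e.
   their ideals are prime. *)
Definition integral_fibers (M : zmodType) (z : M -> K) (H : M -> Prop) : Prop :=
  forall s : M -> k, torus_point H s ->
    ~ fiber_ideal z H s 1 /\
    (forall x y, group_algebra z (@full M) x -> group_algebra z (@full M) y ->
       fiber_ideal z H s (x * y) -> fiber_ideal z H s x \/ fiber_ideal z H s y).

End FunctionFields.

(* Main.v *)
Require Import Defs.
From HB Require Import structures.
From mathcomp Require Import all_boot all_order all_algebra all_field.
From mathcomp Require cyclic.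
From mathcomp Require Import mpoly.
From mathcomp Require Import reals boolp.
From mathcomp Require Import ring.

(** Everything is read off the matrix with columns [(1, u_j)], and off the
    elementary divisors of [L := <B - B>] in [M].

    The Gauss map.  The ideal of [X_A] is generated by the binomials given by
    the integer relations between the [(1, u_j)] ([toricP]), so the tangent space
    at a point [x] is cut out by the derivatives of binomials ([tangentP]).  When
    the coordinates of [x] are invertible, logarithmic derivatives make these
    equations linear in the exponents, and the tangent space is the row space of
    the matrix with columns [x_j (1, u_j)] ([tangent_unit]).  Its Pluecker
    coordinates are the minors of [(1, u_j)] times monomials of weights
    [u_(i_0) + ... + u_(i_n)], and a minor is nonzero exactly when the [u_(i_j)]
    span ([gauss_unit], [spanning_pcoef]): on the torus, the Gauss map is given
    by the monomials [z^b] for [b] in [B].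

    Adapted coordinates.  By the Smith normal form ([adapted_coords]), [L] is
    given by the divisibility of the [i]-th coordinate by [D i], and the lattice
    [H := L_R \cap M] by the vanishing of the coordinates with [D i = 0].  Then
    the rank of [L] is the number of nonzero [D i], the dimension of [Aff_k(B)] is
    the number of the [D i] that are nonzero in [k], and the index of [L] in [H]
    is the product of the nonzero [D i].

    Rank and separability.  The differential of the Gauss map at [x] has the rank
    of the vectors [(1, b)] over [k], minus one ([gauss_differential]).  The
    generic point of [X_A] identifies its function field with [k(M)] and the one
    of the image with [k(L)] ([generic_point], [image_field_gauss]).  If no
    nonzero [D i] is divisible by the characteristic, [k(M)] is obtained from
    [k(L)] by adjoining independent variables and roots of order prime to the
    characteristic; otherwise it contains a [p]-th root of a monomial of [L], and
    a separable extension has no such element outside [k(L)].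

    Degrees.  Monomials that represent the cosets of [L] in [H] form a basis of
    [k(H)] over [k(L)] ([degree_cosets]).  Let [L'] be the lattice in between
    whose divisors are the [p]-parts of the [D i].  Characters separate [L'/L], so
    [k(L')] is separable over [k(L)] ([separable_cosets]), while a power of
    Frobenius maps [k(H)] to [k(L')]; so [k(L')] is the separable closure.

    The general fiber.  On the torus, a fiber is a coset of the group of the
    characters trivial on [L]; its components are cosets of the subtorus of the
    characters trivial on [H], one for each character of [H/L], and the number of
    these is the prime-to-[p] part of the index.  But the Gauss map is defined at
    all smooth points of [X_A], and two facts are needed about those on the
    boundary: they do not enlarge the closure of the image ([gauss_vanish]), and
    those in a general fiber are in the closure of the cosets above
    ([fiber_point], [coset_zclosure]).  The first holds because the tangent space
    varies algebraically near a smooth point; for the second, a point of the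
    boundary with the tangent space of a point of the torus agrees, on its
    support, with a character that preserves this tangent space, and which is
    therefore constant on [B] ([char_const_on_B]). *)


Set Implicit Arguments.
Unset Strict Implicit.
Unset Printing Implicit Defensive.

Import Order.TTheory GRing.Theory Num.Theory.
Local Open Scope ring_scope.

(** * Linear independence of monomials *)

(** Dedekind's argument: if the relation holds at [t] and at all products
    [t * t0], then subtracting [t0 i0] times the former from the latter gives a
    shorter relation, from which the term [i0] has gone. *)
Lemma indep_functions (k : fieldType) (I : eqType) (T : (I -> k) -> Prop)
    (s : seq I) :
  (forall t t', T t -> T t' -> T (fun i => t i * t' i)) ->
  (forall i, i \in s -> exists2 t, T t & t i != 0) ->
  (forall i j, i \in s -> j \in s -> i != j -> exists2 t, T t & t i != t j) ->
  uniq s -> forall c : I -> k,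
  (forall t, T t -> \sum_(i <- s) c i * t i = 0) ->
  forall i, i \in s -> c i = 0.
Proof.
move=> TM; elim: s => [|i0 s IH] // T0 Tsep /= /andP[i0s us] c Hc.
have cs i : i \in s -> c i = 0.
  move=> si; have ne : i != i0 by apply: contraNneq i0s => <-.
  have [t0 Tt0 nt0] : exists2 t, T t & t i != t i0.
    by apply: Tsep; rewrite ?inE ?eqxx ?si ?orbT.
  (* the relation at [t * t0] minus [t0 i0] times the relation at [t] *)
  have H : c i * (t0 i - t0 i0) = 0.
    apply: (IH _ _ us (fun j => c j * (t0 j - t0 i0))) => //.
    - by move=> j sj; apply: T0; rewrite inE sj orbT.
    - by move=> j l sj sl; apply: Tsep; rewrite inE ?sj ?sl orbT.
    move=> t Tt.
    have := Hc _ (TM _ _ Tt Tt0); rewrite big_cons => H1.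
    have := Hc _ Tt; rewrite big_cons => H2.
    transitivity (c i0 * (t i0 * t0 i0) + \sum_(j <- s) c j * (t j * t0 j)
       - t0 i0 * (c i0 * t i0 + \sum_(j <- s) c j * t j)); last first.
      by rewrite H1 H2 mulr0 subr0.
    rewrite mulrDr opprD addrACA [t0 i0 * (_ * _)]mulrC -mulrA subrr add0r.
    rewrite mulr_sumr -sumrB; apply: eq_bigr => j _.
    by ring.
  by move/eqP: H; rewrite mulf_eq0 subr_eq0 (negPf nt0) orbF => /eqP.
move=> i; rewrite inE => /orP[/eqP->|]; last exact: cs.
have [t Tt nt] := T0 i0 (mem_head _ _).
have := Hc _ Tt; rewrite big_cons big_seq big1 ?addr0; last first.
  by move=> j sj; rewrite cs // mul0r.
by move/eqP; rewrite mulf_eq0 (negPf nt) orbF => /eqP.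
Qed.

Section Grouping.
Variables (J I : eqType) (w : J -> I).

(** Collecting like terms does not look at the values of the terms. *)
Lemma group_sum (k K : nzRingType) (iota : {rmorphism k -> K}) (r : seq J)
    (c : J -> k) (F : I -> K) :
  \sum_(j <- r) iota (c j) * F (w j) =
  \sum_(i <- undup (map w r)) iota (\sum_(j <- r | w j == i) c j) * F i.
Proof.
under [RHS]eq_bigr => i _ do rewrite rmorph_sum big_distrl /= big_mkcond /=.
rewrite exchange_big /= big_seq [RHS]big_seq; apply: eq_bigr => j rj.
rewrite (bigD1_seq (w j)) ?undup_uniq ?mem_undup ?map_f //= eqxx big1 ?addr0 //.
by move=> i; rewrite eq_sym => /negPf->.
Qed.

(** This is how an identity between formal sums, known for enough choices of
    [F], is carried over to a choice of [F] that was not among them. *)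
Lemma group_sum0 (k K : nzRingType) (iota : {rmorphism k -> K}) (r : seq J)
    (c : J -> k) (F : J -> K) :
  (forall i, \sum_(j <- r | w j == i) c j = 0) ->
  (forall j j', j \in r -> j' \in r -> w j = w j' -> F j = F j') ->
  \sum_(j <- r) iota (c j) * F j = 0.
Proof.
move=> Hc HF; case: r Hc HF => [|j0 r'] Hc HF; first by rewrite big_nil.
move: (j0 :: r') Hc HF => r Hc HF {r'}.
pose F' i := F (nth j0 r (find (fun j => w j == i) r)).
rewrite (eq_big_seq (fun j => iota (c j) * F' (w j))).
  by rewrite group_sum big1 // => i _; rewrite Hc rmorph0 mul0r.
move=> j rj /=; congr (_ * _); rewrite /F'.
have hj : has (fun j' => w j' == w j) r by apply/hasP; exists j.
apply: HF => //; first by rewrite mem_nth -?has_find.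
by apply/esym/eqP; have /= := nth_find j0 hj.
Qed.

Lemma indep_group (k : fieldType) (T : (I -> k) -> Prop) (r : seq J)
    (c : J -> k) :
  (forall t t', T t -> T t' -> T (fun i => t i * t' i)) ->
  (forall i, exists2 t, T t & t i != 0) ->
  (forall i j, i != j -> exists2 t, T t & t i != t j) ->
  (forall t, T t -> \sum_(j <- r) c j * t (w j) = 0) ->
  forall i, \sum_(j <- r | w j == i) c j = 0.
Proof.
move=> TM T0 Ts H i; set s := undup (map w r).
have Hs t : T t -> \sum_(i <- s) (\sum_(j <- r | w j == i) c j) * t i = 0.
  by move=> Tt; rewrite -(group_sum idfun) H.
case: (boolP (i \in s)) => si.
  by apply: (indep_functions TM _ _ (undup_uniq _) Hs si); auto.
rewrite big_seq_cond big_pred0 // => j; apply: contraNF si => /andP[rj /eqP<-].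
by rewrite mem_undup map_f.
Qed.

End Grouping.

(** * Coordinates on the lattice *)

Section Coordinates.
Variables (n : nat) (M : zmodType) (co : {additive M -> 'rV[int]_n}).

Lemma coMz (b : M) (m : int) i : co (b *~ m) 0 i = m * co b 0 i.
Proof. by rewrite raddfMz -scaler_int mxE intz. Qed.

Lemma coMn (b : M) d i : co (b *+ d) 0 i = d%:Z * co b 0 i.
Proof. by rewrite raddfMn /= -scaler_nat mxE natz. Qed.

Lemma co_sum (J : Type) (r : seq J) (P : pred J) (F : J -> M) i :
  co (\sum_(j <- r | P j) F j) 0 i = \sum_(j <- r | P j) co (F j) 0 i.
Proof. by rewrite raddf_sum summxE. Qed.

Lemma basis_vectors : bijective co -> exists e : 'I_n -> M,
  (forall i, co (e i) = delta_mx 0 i) /\ forall x, x = \sum_i e i *~ co x 0 i.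
Proof.
move=> co_bij; have /fin_all_exists[e He] i : exists b : M, co b = delta_mx 0 i.
  by case: co_bij => f _ cK; exists (f (delta_mx 0 i)).
exists e; split=> // x; apply: (bij_inj co_bij); rewrite raddf_sum.
rewrite [LHS]row_sum_delta; apply: eq_bigr => i _.
by rewrite raddfMz He -scaler_int intz.
Qed.

(** With [a := co x] this is the projection of [x] to the span of the basis
    vectors that satisfy [P]. *)
Lemma co_combination (e : 'I_n -> M) (P : pred 'I_n) (a : 'I_n -> int) j :
  (forall i, co (e i) = delta_mx 0 i) ->
  co (\sum_(i | P i) e i *~ a i) 0 j = if P j then a j else 0.
Proof.
move=> He; rewrite co_sum big_mkcond (bigD1 j) //= big1 ?addr0 => [|i ij].
  by case: ifP => // _; rewrite coMz He mxE !eqxx mulr1.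
by case: ifP => // _; rewrite coMz He mxE eqxx eq_sym (negPf ij) mulr0.
Qed.

End Coordinates.

(** * Characters *)

Lemma closed_root (k : closedFieldType) (b : k) n : (0 < n)%N ->
  exists a : k, a ^+ n = b.
Proof.
case: n => // n _; have [a Ha] := @solve_monicpoly k n.+1 (fun i => if i == 0%N then b else
  0) isT.
exists a; rewrite Ha big_ord_recl /= expr0 mulr1 big1 ?addr0 // => i _.
by rewrite mul0r.
Qed.

(** A root of [X^2 - X + 1] may be a root of unity, but neither 0 nor 1; take
    an [n]-th root of it. *)
Lemma expr_neq1 (k : closedFieldType) n : (0 < n)%N ->
  exists2 a : k, a != 0 & a ^+ n != 1.
Proof.
move=> n0.
have [b Hb] := @solve_monicpoly k 2 (fun i => if i == 0%N then -1 else 1) isT.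
rewrite !big_ord_recl big_ord0 /= expr0 mulr1 mul1r expr1 addr0 in Hb.
have b0 : b != 0.
  by apply/eqP => b0; move: Hb; rewrite b0 expr0n /= addr0 => /eqP;
    rewrite eq_sym oppr_eq0 oner_eq0.
have b1 : b != 1.
  by apply/eqP => b1; move: Hb; rewrite b1 expr1n addNr => /eqP; rewrite oner_eq0.
have [a Ha] := closed_root b n0; exists a; last by rewrite Ha.
by apply: contraNneq b0 => a0; rewrite -Ha a0 expr0n eqn0Ngt n0.
Qed.

Lemma exprz_neq1 (k : closedFieldType) (m : int) : m != 0 ->
  exists2 a : k, a != 0 & a ^ m != 1.
Proof.
move=> m0; have [|a a0 Ha] := @expr_neq1 k `|m|%N; first by rewrite absz_gt0.
exists a => //; case: m m0 Ha => m m0 Ha //.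
by rewrite NegzE -exprnN invr_eq1.
Qed.

Lemma expr_sep (k : closedFieldType) (d e : nat) : d != e ->
  exists2 a : k, a != 0 & a ^+ d != a ^+ e.
Proof.
wlog lt : d e / (d < e)%N.
  move=> Hw de; have [lt|] := ltnP d e; first exact: Hw.
  rewrite leq_eqVlt eq_sym (negPf de) /= => ed.
  by have [|nu ? ?] := Hw e d ed; [rewrite eq_sym|exists nu; rewrite // eq_sym].
move=> de; have [|nu nu0 Hnu] := @expr_neq1 k (e - d); first by rewrite subn_gt0.
exists nu => //; apply: contra Hnu => /eqP E; apply/eqP.
apply: (mulfI (expf_neq0 d nu0)).
by rewrite -exprD subnKC ?mulr1 // ltnW.
Qed.

Section Characters.
Variables (k : closedFieldType) (M : zmodType).
Implicit Types (t : M -> k) (a b : M).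
Local Notation char := (torus_point (k := k) (@full M)).

Lemma char0 t : char t -> t 0 = 1. Proof. by case. Qed.
Lemma charD t a b : char t -> t (a + b) = t a * t b.
Proof. by case=> _; exact. Qed.
Lemma char_neq0 t a : char t -> t a != 0.
Proof.
move=> ct; apply/eqP => t0; have := charD a (- a) ct.
by rewrite subrr (char0 ct) t0 mul0r => /eqP; rewrite oner_eq0.
Qed.
Lemma charN t a : char t -> t (- a) = (t a)^-1.
Proof.
move=> ct; apply: (mulfI (char_neq0 a ct)).
by rewrite -charD // subrr char0 // mulfV ?char_neq0.
Qed.
Lemma charB t a b : char t -> t (a - b) = t a / t b.
Proof. by move=> ct; rewrite charD // charN. Qed.
Lemma charMn t a n : char t -> t (a *+ n) = t a ^+ n.
Proof.
move=> ct; elim: n => [|n IH]; first by rewrite mulr0n char0.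
by rewrite mulrS charD // IH exprS.
Qed.
Lemma charMz t a (m : int) : char t -> t (a *~ m) = t a ^ m.
Proof.
move=> ct; case: m => m; first by rewrite -pmulrn charMn.
by rewrite NegzE mulrNz -pmulrn charN // charMn // -exprnN.
Qed.
Lemma char_sum t (I : Type) (r : seq I) (P : pred I) (F : I -> M) : char t ->
  t (\sum_(i <- r | P i) F i) = \prod_(i <- r | P i) t (F i).
Proof.
by move=> ct; apply: (big_morph t (fun a b => charD a b ct)); exact: char0.
Qed.
Lemma char1 : char (fun=> 1).
Proof. by split=> // a b _ _; rewrite mulr1. Qed.
Lemma charM t t' : char t -> char t' -> char (fun a => t a * t' a).
Proof.
move=> ct ct'; split; first by rewrite !char0 // mulr1.
by move=> a b _ _; rewrite !charD // mulrACA.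
Qed.
Lemma charV t : char t -> char (fun a => (t a)^-1).
Proof.
move=> ct; split; first by rewrite char0 // invr1.
by move=> a b _ _; rewrite charD // invfM.
Qed.
Variables (n : nat) (co : {additive M -> 'rV[int]_n}).

Definition char_of (al : 'I_n -> k) : M -> k :=
  fun a => \prod_i al i ^ co a 0 i.

Lemma char_ofP al : (forall i, al i != 0) -> char (char_of al).
Proof.
move=> al0; split; first by rewrite /char_of big1 // => i _; rewrite raddf0 mxE.
move=> a b _ _; rewrite /char_of -big_split; apply: eq_bigr => i _ /=.
by rewrite raddfD mxE expfzDr.
Qed.

(** The one-parameter subgroup of the torus dual to the [i]-th coordinate. *)
Definition char_at (i : 'I_n) (z : k) : M -> k :=
  char_of (fun j => if j == i then z else 1).

Lemma char_atP i z : z != 0 -> char (char_at i z).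
Proof. by move=> z0; apply: char_ofP => j; case: ifP; rewrite ?oner_eq0. Qed.

Lemma char_atE i z x : char_at i z x = z ^ co x 0 i.
Proof.
rewrite /char_at /char_of (bigD1 i) //= eqxx big1 ?mulr1 // => j /negPf->.
by rewrite exp1rz.
Qed.

Lemma char_sep (co_bij : bijective co) a b : a != b ->
  exists2 t, char t & t a != t b.
Proof.
move=> ab.
have /eqP/rowP/existsNP[i /eqP]: co a != co b.
  by rewrite (inj_eq (bij_inj co_bij)).
rewrite -subr_eq0 => /(@exprz_neq1 k)[x x0 Hx].
have ct := char_atP i x0; exists (char_at i x) => //.
rewrite -subr_eq0 -(can_eq (mulfVK (char_neq0 b ct))) mulrBl mul0r mulfV ?char_neq0 //.
by rewrite -charB // subr_eq0 char_atE raddfB !mxE.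
Qed.

End Characters.

(** * The ideal and the tangent spaces of a toric variety *)

Section Monomials.
Variables (k : fieldType) (m : nat).
Implicit Types (x v : 'rV[k]_m) (a b : 'X_{1..m}).

Definition mon x a : k := \prod_i x 0 i ^+ a i.

(** The directional derivative of the monomial [a] at [x] along [v];
    [a - U_(i)] is truncated, but the factor [a i] vanishes where this matters.
    *)
Definition dmon x v a : k := \sum_i (a i)%:R * mon x (a - U_(i))%MM * v 0 i.

Lemma evE P x : ev P x = \sum_(a <- msupp P) P@_a * mon x a.
Proof. exact: mevalE. Qed.

Lemma evX a x : ev 'X_[a] x = mon x a.
Proof. exact: mevalX. Qed.

Lemma evM P Q x : ev (P * Q) x = ev P x * ev Q x. Proof. exact: mevalM. Qed.
Lemma evB P Q x : ev (P - Q) x = ev P x - ev Q x. Proof. exact: mevalB. Qed.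
Lemma evZ c P x : ev (c *: P) x = c * ev P x. Proof. exact: mevalZ. Qed.

Lemma monD x a b : mon x (a + b)%MM = mon x a * mon x b.
Proof. by rewrite -big_split; apply: eq_bigr => i _; rewrite mnmDE exprD. Qed.

Lemma monU x i : mon x U_(i)%MM = x 0 i.
Proof.
rewrite /mon (bigD1 i) //= mnm1E eqxx expr1 big1 ?mulr1 // => j ji.
by rewrite mnm1E eq_sym (negPf ji).
Qed.

Lemma mon_subU x a i : a i != 0%N -> mon x a = mon x (a - U_(i))%MM * x 0 i.
Proof. by move=> ai; rewrite -monU -monD submK // lep1mP. Qed.

Lemma monMn x a n : mon x (a *+ n)%MM = mon x a ^+ n.
Proof.
by rewrite -prodrXl; apply: eq_bigr => i _; rewrite mulmnE exprM.
Qed.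

Lemma mdegEo a : mdeg a = (\sum_i a i)%N.
Proof. by rewrite mdegE. Qed.

Lemma monZ c x a : mon (c *: x) a = c ^+ mdeg a * mon x a.
Proof.
rewrite mdegEo -prodrXr -big_split; apply: eq_bigr => i _ /=.
by rewrite mxE exprMn.
Qed.

Lemma mon_eq0 x a : (mon x a == 0) = [exists i, (x 0 i == 0) && (a i != 0%N)].
Proof.
rewrite prodf_seq_eq0; apply/hasP/existsP => [[i _]|[i]].
  by rewrite /= expf_eq0 lt0n andbC => ?; exists i.
by move=> ?; exists i; rewrite ?mem_index_enum //= expf_eq0 lt0n andbC.
Qed.

Lemma ev_homog d (P : {mpoly k[m]}) c x : P \is d.-homog ->
  ev P (c *: x) = c ^+ d * ev P x.
Proof.
move=> /dhomogP hP; rewrite !evE mulr_sumr big_seq [RHS]big_seq.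
by apply: eq_bigr => a /hP <-; rewrite monZ mulrCA.
Qed.

Lemma dev (P : {mpoly k[m]}) x v :
  \sum_i ev (P^`M(i)) x * v 0 i = \sum_(a <- msupp P) P@_a * dmon x v a.
Proof.
transitivity (\sum_i \sum_(a <- msupp P) P@_a * ((a i)%:R * mon x (a - U_(i))%MM * v 0 i)).
  apply: eq_bigr => i _; rewrite {1}[P]mpolyE raddf_sum /ev raddf_sum /= mulr_suml.
  apply: eq_bigr => a _; rewrite mderivZ mderivX !mevalZ -/(ev _ _) evX.
  by rewrite -!mulrA.
by rewrite exchange_big; apply: eq_bigr => a _; rewrite mulr_sumr.
Qed.

(** When all coordinates are invertible, the derivative is logarithmic. *)
Lemma dmon_log x v a : (forall i, a i != 0%N -> x 0 i != 0) ->
  dmon x v a = mon x a * \sum_i (a i)%:R * (v 0 i / x 0 i).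
Proof.
move=> x0; rewrite mulr_sumr; apply: eq_bigr => i _.
have [->|ai] := eqVneq (a i) 0%N; first by rewrite !mul0r mulr0.
by rewrite (mon_subU x ai); field; exact: x0.
Qed.

End Monomials.

Section Weights.
Variables (M : zmodType) (m : nat) (u : 'I_m -> M).
Implicit Types (a b : 'X_{1..m}).

Definition wt a : M := \sum_i u i *+ a i.

(** Having the same image in [k[Z x M]]: the differences of such monomials are
    the binomials in the ideal of the toric variety. *)
Definition meq a b := mdeg a = mdeg b /\ wt a = wt b.

Lemma wtD a b : wt (a + b)%MM = wt a + wt b.
Proof.
by rewrite -big_split; apply: eq_bigr => i _; rewrite mnmDE mulrnDr.
Qed.

Lemma wtU i : wt U_(i)%MM = u i.
Proof.
rewrite /wt (bigD1 i) //= mnm1E eqxx big1 ?addr0 // => j ji.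
by rewrite mnm1E eq_sym (negPf ji).
Qed.

Lemma wtMn a d : wt (a *+ d)%MM = wt a *+ d.
Proof. by rewrite -sumrMnl; apply: eq_bigr => i _; rewrite mulmnE mulrnA. Qed.

(** The positive and the negative part of an integer vector of total weight
    zero are the exponents of two monomials of the same degree; so integer
    relations become binomials. *)
Lemma weight_split (la : 'I_m -> int) : \sum_j la j = 0 ->
  exists a b, [/\ mdeg a = mdeg b, wt a - wt b = \sum_j u j *~ la j,
    forall i, la i = (a i)%:Z - (b i)%:Z
    & forall i, la i = 0 -> a i = 0%N /\ b i = 0%N].
Proof.
move=> s0.
pose a : 'X_{1..m} := [multinom (if la i is Posz m then m else 0%N) | i < m].
pose b : 'X_{1..m} := [multinom (if la i is Negz m then m.+1 else 0%N) | i < m].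
have E i : la i = (a i)%:Z - (b i)%:Z.
  by rewrite !mnmE; case: (la i) => l; rewrite ?subr0 // sub0r NegzE.
exists a, b; split=> // [||i l0]; last by rewrite !mnmE l0.
  apply/eqP; rewrite -eqz_nat -subr_eq0 !mdegEo !(big_morph _ PoszD (erefl _)).
  by rewrite -sumrB -(eq_bigr _ (fun i _ => E i)) s0.
by rewrite -sumrB; apply: eq_bigr => i _; rewrite E mulrzBr.
Qed.

Lemma relation_split (la : 'I_m -> int) :
  \sum_j la j = 0 -> \sum_j u j *~ la j = 0 ->
  exists a b, meq a b /\ forall i, la i = (a i)%:Z - (b i)%:Z.
Proof.
move=> /weight_split[a [b [ed ew E _]]] w0; exists a, b; split=> //; split=> //.
by apply/eqP; rewrite -subr_eq0 ew w0.
Qed.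

End Weights.

Section Toric.
Variables (k : closedFieldType) (n N : nat) (M : zmodType).
Variables (co : {additive M -> 'rV[int]_n}) (co_bij : bijective co).
Variables (u : 'I_N.+1 -> M).
Implicit Types (x v : 'rV[k]_N.+1) (a b : 'X_{1..N.+1}) (nu : k) (t : M -> k).
Local Notation char := (torus_point (k := k) (@full M)).
Local Notation X := (toric_variety (k := k) u).
Local Notation wt := (wt u).
Local Notation meq := (meq u).

Lemma mon_phi t a : char t -> mon (phi u t) a = t (wt a).
Proof.
move=> ct; rewrite char_sum //; apply: eq_bigr => i _.
by rewrite mxE charMn.
Qed.

Lemma mon_cone nu t a : char t ->
  mon (nu *: phi u t) a = nu ^+ mdeg a * t (wt a).
Proof. by move=> ct; rewrite monZ mon_phi. Qed.

Lemma cone_neq0 nu t i : nu != 0 -> char t -> (nu *: phi u t) 0 i != 0.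
Proof. by move=> nu0 ct; rewrite !mxE mulf_neq0 // char_neq0. Qed.

(** The pairs of a weight [d] and of [b] in [M] are the characters of the torus
    [k^* x T_M], and distinct ones are independent. *)
Lemma cone_group (J : eqType) (w : J -> nat * M) (c : J -> k) (r : seq J) :
  (forall nu t, nu != 0 -> char t ->
     \sum_(a <- r) c a * (nu ^+ (w a).1 * t (w a).2) = 0) ->
  forall i, \sum_(a <- r | w a == i) c a = 0.
Proof.
move=> H; pose T (f : nat * M -> k) := exists nu t,
  [/\ nu != 0, char t & forall i, f i = nu ^+ i.1 * t i.2].
apply: (indep_group (T := T)).
- move=> f g [nu [t [nu0 ct Hf]]] [nu' [t' [nu0' ct' Hg]]].
  exists (nu * nu'), (fun z => t z * t' z); split=> [||i].
  + by rewrite mulf_neq0.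
  + exact: charM.
  by rewrite Hf Hg exprMn mulrACA.
- move=> i; exists (fun=> 1); last by rewrite oner_eq0.
  exists 1, (fun=> 1); split; rewrite ?oner_eq0 //; first exact: char1.
  by move=> j; rewrite expr1n mulr1.
- move=> [d a] [e b] ne.
  have [ab|ab] := eqVneq a b; last first.
    have [t ct Ht] := char_sep k co_bij ab; exists (fun i => t i.2) => //.
    by exists 1, t; split; rewrite ?oner_eq0 // => i; rewrite expr1n mul1r.
  have de : d != e by apply: contra ne => /eqP->; rewrite ab.
  have [nu nu0 Hnu] := expr_sep k de.
  exists (fun i => nu ^+ i.1) => //.
  by exists nu, (fun=> 1); split=> // [|i]; [exact: char1|rewrite mulr1].
move=> f [nu [t [nu0 ct Hf]]]; rewrite -[RHS](H nu t nu0 ct).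
by apply: eq_bigr => a _; rewrite Hf.
Qed.

Definition toric_eq x := forall a b, meq a b -> mon x a = mon x b.

(** A polynomial, homogeneous or not, vanishing on the torus (in
    homogeneous coordinates) has coefficients summing to zero over each class
    of monomials; so it kills every function of monomials that only depends on
    the class. *)
Lemma cone_kills P (F : 'X_{1..N.+1} -> k) :
  (forall nu t, nu != 0 -> char t -> ev P (nu *: phi u t) = 0) ->
  (forall a b, meq a b -> F a = F b) ->
  \sum_(a <- msupp P) P@_a * F a = 0.
Proof.
move=> HP HF.
apply: (group_sum0 (w := fun a => (mdeg a, wt a)) idfun) => [|a b _ _ [? ?]].
  apply: (cone_group (w := fun a => (mdeg a, wt a))) => nu t nu0 ct;
    rewrite -[RHS](HP nu t nu0 ct) evE.
  by apply: eq_bigr => a _; rewrite mon_cone.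
exact: HF.
Qed.

Lemma cone_vanish P x :
  (forall nu t, nu != 0 -> char t -> ev P (nu *: phi u t) = 0) ->
  toric_eq x -> ev P x = 0.
Proof. by move=> HP Hx; rewrite evE; apply: cone_kills. Qed.

Lemma phi_neq0 t : char t -> phi u t != 0.
Proof.
move=> ct; apply/eqP => /rowP/(_ ord0); rewrite !mxE => /eqP.
by rewrite (negPf (char_neq0 _ ct)).
Qed.

Lemma toric_phi t : char t -> X (phi u t).
Proof.
by move=> ct; split=> [|d P hP]; [exact: phi_neq0|by apply; exists t; split].
Qed.

Lemma homog_binom a b : mdeg a = mdeg b ->
  ('X_[a] - 'X_[b] : {mpoly k[N.+1]}) \is (mdeg a).-homog.
Proof. by move=> e; apply: rpredB; rewrite dhomogX /= ?e. Qed.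

(** The ideal of [X_A] is generated by binomials: a point with [toric_eq] kills
    every form that vanishes on the torus by [cone_vanish]. *)
Lemma toricP x : X x <-> x != 0 /\ toric_eq x.
Proof.
split=> [[x0 Hx]|[x0 Hx]]; split=> //.
  move=> a b [e w]; apply/eqP; rewrite -subr_eq0 -!evX -evB.
  apply/eqP/(Hx _ _ (homog_binom e)) => _ [t [ct ->]].
  by rewrite evB !evX !mon_phi // w subrr.
move=> d P hP VP; apply: cone_vanish => // nu t nu0 ct.
by rewrite (ev_homog _ _ hP) VP ?mulr0 //; exists t; split.
Qed.

Lemma toric_vanish P :
  (forall nu t, nu != 0 -> char t -> ev P (nu *: phi u t) = 0) ->
  vanishes X P.
Proof. by move=> HP x /toricP[_]; exact: cone_vanish. Qed.

Lemma toricZ c x : c != 0 -> X x -> X (c *: x).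
Proof.
move=> c0 /toricP[x0 Hx]; apply/toricP; split; first by rewrite scaler_eq0 negb_or c0.
by move=> a b [e w]; rewrite !monZ e (Hx a b).
Qed.

Lemma toric_cone nu t : nu != 0 -> char t -> X (nu *: phi u t).
Proof. by move=> nu0 ct; apply/toricZ/toric_phi. Qed.

(** The coefficients of a form that vanishes on [X] cancel over each class of
    monomials; so its derivatives are combinations of those of binomials, at
    singular points too. *)
Lemma tangentP x v : tangent X x v <->
  forall a b, meq a b -> dmon x v a = dmon x v b.
Proof.
split=> [Tv a b [e w]|Hv d P hP VP].
  apply/eqP; rewrite -subr_eq0; apply/eqP.
  have := Tv _ _ (homog_binom e); under eq_bigr => i _ do
    rewrite mderivB !mderivX evB !evZ !evX mulrBl.
  rewrite sumrB; apply; apply: toric_vanish => nu t nu0 ct.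
  by rewrite evB !evX !mon_cone // e w subrr.
rewrite dev; apply: cone_kills => // nu t nu0 ct.
by rewrite VP //; exact: toric_cone.
Qed.

End Toric.

(** * The Gauss map on the torus *)

Section Plucker.
Variables (k : closedFieldType) (n N : nat).
Implicit Types (W : 'M[k]_(n.+1, N.+1)).

Definition fmon (f : plucker_index n N) : 'X_{1..N.+1} := (\sum_j U_(f j))%MM.

Lemma mdeg_fmon f : mdeg (fmon f) = n.+1.
Proof.
rewrite /fmon mdeg_sum (eq_bigr (fun=> 1%N)) => [|j _]; last exact: mdeg1.
by rewrite sum_nat_const card_ord muln1.
Qed.

Lemma wt_fmon (M : zmodType) (u : 'I_N.+1 -> M) f : wt u (fmon f) = vertex_sum u f.
Proof.
rewrite /fmon (big_morph _ (@wtD _ _ u) (_ : _ = 0)).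
  by apply: eq_bigr => j _; rewrite wtU.
by rewrite /wt big1 // => i _; rewrite mnmE.
Qed.

Lemma mon_fmon (x : 'rV[k]_N.+1) f : mon x (fmon f) = \prod_j x 0 (f j).
Proof.
rewrite /fmon (big_morph _ (monD x) (_ : _ = 1)).
  by apply: eq_bigr => j _; rewrite monU.
by rewrite /mon big1 // => i _; rewrite mnmE.
Qed.

Lemma pluckerM (P : 'M[k]_n.+1) W : plucker (P *m W) = \det P *: plucker W.
Proof.
apply/rowP => j; rewrite !mxE -det_mulmx; congr (\det _).
by rewrite [LHS]mxsub_mul mxsub_eq_id.
Qed.

Lemma plucker_diag W (x : 'rV[k]_N.+1) j : plucker (W *m diag_mx x) 0 j =
  plucker W 0 j * mon x (fmon (enum_val j)).
Proof.
rewrite !mxE mon_fmon; set f := enum_val j.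
have -> : colsub f (W *m diag_mx x) = colsub f W *m diag_mx (\row_i x 0 (f i)).
  by apply/matrixP => a b; rewrite !mul_mx_diag !mxE.
rewrite det_mulmx det_diag; congr (_ * _).
by apply: eq_bigr => i _; rewrite mxE.
Qed.

Lemma same_rowspace W W' : row_free W ->
  (forall v : 'rV[k]_N.+1, (v <= W)%MS <-> (v <= W')%MS) ->
  exists2 P, P \in unitmx & W = P *m W'.
Proof.
move=> fW H.
have s1 : (W <= W')%MS by apply/row_subP => i; apply/H; exact: row_sub.
have /submxP[P eP] := s1; exists P => //.
rewrite -row_free_unit -row_leq_rank; apply: leq_trans (mxrankM_maxl P W').
by rewrite -eP row_leq_rank.
Qed.

Lemma row_free_minor W : row_free W -> exists f : plucker_index n N, \det (colsub f W) != 0.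
Proof.
move=> fW; have fU : row_full W^T by rewrite -col_leq_rank mxrank_tr row_leq_rank.
have /= := fullrowsub_unit fU; set f := fullrankfun fU => uf.
exists [ffun i => f i]; rewrite -unitfE -unitmxE -unitmx_tr.
suff -> : (colsub [ffun i => f i] W)^T = rowsub f W^T by [].
by apply/matrixP => i j; rewrite !mxE ffunE.
Qed.

(** A change of the basis of the tangent space multiplies the Pluecker vector
    by the determinant of the change, which can be any nonzero scalar. *)
Lemma gaussE (X : 'rV[k]_N.+1 -> Prop) x (W : 'M[k]_(n.+1, N.+1)) y :
  row_free W -> (forall v, (v <= W)%MS <-> tangent X x v) ->
  gauss n X x y <-> X x /\ exists2 mu, mu != 0 & y = mu *: plucker W.
Proof.
move=> fW HW; split=> [[Xx [W' [fW' HW' ->]]]|[Xx [mu mu0 ->]]]; split=> //.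
  have [|P uP ->] := same_rowspace (W' := W) fW'.
    by move=> v; rewrite HW HW'.
  by exists (\det P); rewrite ?pluckerM // -unitfE -unitmxE.
pose P : 'M[k]_n.+1 := diag_mx (\row_i if i == ord0 then mu else 1).
have dP : \det P = mu.
  rewrite det_diag big_ord_recl !mxE big1 ?mulr1 // => i _.
  by rewrite mxE.
have uP : P \in unitmx by rewrite unitmxE dP unitfE.
exists (P *m W); rewrite pluckerM dP; split=> //.
  by rewrite -row_leq_rank (eqmxMfull _ (_ : row_full P)) ?row_leq_rank // row_full_unit.
by move=> v; rewrite (eqmxMfull _ (_ : row_full P)) ?row_full_unit.
Qed.

End Plucker.

Section GaussTorus.
Variables (k : closedFieldType) (n N : nat) (M : zmodType).
Variables (co : {additive M -> 'rV[int]_n}) (co_bij : bijective co).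
Variables (u : 'I_N.+1 -> M).
Hypothesis Aff_A : forall x : M, Aff (family_set u) x.
Implicit Types (x v : 'rV[k]_N.+1) (a b : 'X_{1..N.+1}) (nu : k) (t : M -> k).
Local Notation char := (torus_point (k := k) (@full M)).
Local Notation X := (toric_variety (k := k) u).
Local Notation pidx := (plucker_index n N).

Lemma gen_family (d : int) (y : M) :
  exists2 a : 'I_N.+1 -> int, \sum_j a j = d & y = \sum_j u j *~ a j.
Proof.
have gen1 (z : M) :
  exists2 a : 'I_N.+1 -> int, \sum_j a j = 1 & z = \sum_j u j *~ a j.
  have [l [w [a [/fin_all_exists[f Hf] sa ->]]]] := Aff_A z.
  exists (fun j => \sum_(i | f i == j) a i).
    by rewrite -sa [RHS](partition_big f xpredT).
  rewrite (partition_big f xpredT) //=; apply: eq_bigr => j _.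
  by rewrite mulrz_sumr; apply: eq_bigr => i /eqP <-; rewrite -Hf.
have [a sa ->] := gen1 y; have [b sb b0] := gen1 0.
exists (fun j => a j + (d - 1) * b j).
  by rewrite big_split -mulr_sumr /= sa sb mulr1 addrCA subrr addr0.
transitivity (\sum_j u j *~ a j + (\sum_j u j *~ b j) *~ (d - 1)).
  by rewrite -b0 mul0rz addr0.
rewrite mulrz_suml -big_split; apply: eq_bigr => j _ /=.
by rewrite -mulrzA -mulrzDr [b j * _]mulrC.
Qed.

(** An affine function on [M] with values in [k]: [g] lists the constant term
    and the linear part; [d] homogenizes. *)
Definition afun (g : 'rV[k]_n.+1) (d : int) (b : M) : k :=
  g 0 ord0 * d%:~R + \sum_i g 0 (lift ord0 i) * (co b 0 i)%:~R.

Lemma afun_sum g (a : 'I_N.+1 -> int) :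
  \sum_j (a j)%:~R * afun g 1 (u j) = afun g (\sum_j a j) (\sum_j u j *~ a j).
Proof.
rewrite /afun rmorph_sum mulr_sumr.
have -> : \sum_i g 0 (lift ord0 i) * (co (\sum_j u j *~ a j) 0 i)%:~R =
    \sum_i \sum_j g 0 (lift ord0 i) * (co (u j *~ a j) 0 i)%:~R.
  by apply: eq_bigr => i _; rewrite co_sum rmorph_sum mulr_sumr.
rewrite exchange_big -big_split; apply: eq_bigr => j _ /=.
rewrite mulrDr mulr_sumr mulr1 mulrC; congr (_ + _).
by apply: eq_bigr => i _; rewrite coMz rmorphM /= mulrCA.
Qed.

Lemma afun_mon g a : \sum_i (a i)%:R * afun g 1 (u i) = afun g (mdeg a) (wt u a).
Proof.
rewrite (eq_bigr (fun i => ((a i)%:Z)%:~R * afun g 1 (u i))) => [|i _]; last first.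
  by rewrite -pmulrn.
rewrite afun_sum mdegEo (big_morph _ PoszD (erefl _)); exact: erefl.
Qed.

(** The columns are the vectors [(1, u_j)] over [k]. *)
Definition Uk : 'M[k]_(n.+1, N.+1) :=
  \matrix_(i, j) oapp (fun i' => (co (u j) 0 i')%:~R) 1 (unlift ord0 i).

Lemma mulUk (g : 'rV[k]_n.+1) j : (g *m Uk) 0 j = afun g 1 (u j).
Proof.
rewrite !mxE big_ord_recl !mxE unlift_none mulr1 /afun mulr1; congr (_ + _).
by apply: eq_bigr => i _; rewrite !mxE liftK.
Qed.

(** The affine function is determined by its values at 0 and on a basis of [M],
    which are combinations of the [u_j] of total weight 1 and 0, as [A]
    generates [M]; the relations make it take the value [y j] at [u_j]. *)
Lemma affine_of_relation (y : 'I_N.+1 -> k) :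
  (forall a b, meq u a b -> \sum_i (a i)%:R * y i = \sum_i (b i)%:R * y i) ->
  exists g, forall j, y j = afun g 1 (u j).
Proof.
move=> Hy.
(* the hypothesis, for integer relations between the [(1, u_j)] *)
have Hla la : \sum_j la j = 0 -> \sum_j u j *~ la j = 0 ->
    \sum_j (la j)%:~R * y j = 0.
  move=> s0 w0; have [a [b [ab E]]] := relation_split s0 w0.
  rewrite (eq_bigr (fun i => (a i)%:R * y i - (b i)%:R * y i)) => [|i _].
    by rewrite sumrB (Hy _ _ ab) subrr.
  by rewrite E rmorphB /= -!pmulrn mulrBl.
have [e [He _]] := basis_vectors co_bij.
have [s0 sum0 w0] := gen_family 1 0.
have /fin_all_exists[s Hs] i : exists s : 'I_N.+1 -> int,
    \sum_j s j = 0 /\ e i = \sum_j u j *~ s j.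
  by have [s ? ?] := gen_family 0 (e i); exists s.
(* the values of the affine function at 0 and on a basis of [M] *)
exists (\row_i oapp (fun i' => \sum_j (s i' j)%:~R * y j)
   (\sum_j (s0 j)%:~R * y j) (unlift ord0 i)) => j.
rewrite /afun mxE unlift_none mulr1 /=.
under [X in _ = _ + X]eq_bigr => i _ do rewrite mxE liftK /= mulr_suml.
rewrite exchange_big -big_split /=; apply/eqP; rewrite -subr_eq0; apply/eqP.
have := Hla (fun l => (l == j)%:Z - s0 l - \sum_i s i l * co (u j) 0 i).
rewrite !sumrB sum0 (bigD1 j) //= eqxx big1 ?addr0; last by move=> l /negPf->.
rewrite subrr sub0r exchange_big big1 ?oppr0; last first.
  by move=> i _; rewrite -mulr_suml (proj1 (Hs i)) mul0r.
move=> /(_ erefl); under eq_bigr => l _ do rewrite !mulrzBr.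
rewrite !sumrB -w0 subr0 (bigD1 j) //= eqxx mulr1z big1 ?addr0; last first.
  by move=> l /negPf->.
have -> : \sum_l u l *~ (\sum_i s i l * co (u j) 0 i) = u j.
  under eq_bigr => l _ do rewrite mulrz_sumr.
  rewrite exchange_big; apply: (bij_inj co_bij); rewrite raddf_sum /=.
  rewrite [RHS]row_sum_delta; apply: eq_bigr => i _.
  under eq_bigr => l _ do rewrite mulrzA.
  by rewrite -mulrz_suml -(proj2 (Hs i)) raddfMz He -scaler_int intz.
rewrite subrr => /(_ erefl) H; rewrite -[RHS]H.
under [RHS]eq_bigr => l _ do rewrite !rmorphB !mulrBl /=.
rewrite [RHS]sumrB sumrB big_split opprD addrA /=; congr (_ - _ - _).
- by rewrite (bigD1 j) //= eqxx mul1r big1 ?addr0 // => l /negPf->; rewrite mul0r.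
- apply: eq_bigr => l _; rewrite rmorph_sum mulr_suml; apply: eq_bigr => i _.
  by rewrite rmorphM mulrAC.
Qed.

Lemma afun_meq g a b : meq u a b ->
  \sum_i (a i)%:R * afun g 1 (u i) = \sum_i (b i)%:R * afun g 1 (u i).
Proof. by case=> e w; rewrite !afun_mon e w. Qed.

Lemma row_free_Uk : row_free Uk.
Proof.
apply: inj_row_free => g /rowP Hg; apply/rowP => i; rewrite mxE.
have Hd d (b : M) : afun g d b = 0.
  have [a <- ->] := gen_family d b; rewrite -afun_sum big1 // => j _.
  by rewrite -mulUk Hg mxE mulr0.
have g0 : g 0 ord0 = 0.
  have := Hd 1 0; rewrite /afun mulr1 big1 ?addr0 // => l _.
  by rewrite raddf0 mxE mulr0.
case: (unliftP ord0 i) => [l ->|->] //.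
have [e [He _]] := basis_vectors co_bij; have := Hd 0 (e l).
rewrite /afun mulr0 add0r (bigD1 l) //= He mxE !eqxx mulr1 big1 ?addr0 //.
by move=> l' /negPf ne; rewrite mxE ne andbF mulr0.
Qed.

(** Dividing the derivative of a monomial by its value gives a linear form in
    the exponents, see [dmon_log]. So [v] is tangent at [x] if and only if
    [v_j / x_j] is constant on classes of monomials, that is, an affine
    function of [u_j]. *)
Lemma tangent_unit x : (forall i, x 0 i != 0) -> toric_eq u x ->
  forall v, tangent X x v <-> (v <= Uk *m diag_mx x)%MS.
Proof.
move=> x0 Hx v; rewrite (tangentP co_bij); split=> [Hv|/submxP[g ->] a b ab].
  have [a b ab|g Hg] := affine_of_relation (y := fun i => v 0 i / x 0 i).
    have := Hv a b ab; rewrite !dmon_log // (Hx _ _ ab); apply: mulfI.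
    by rewrite mon_eq0; apply/existsP => -[i]; rewrite (negPf (x0 i)).
  apply/submxP; exists g; apply/rowP => j.
  by rewrite mulmxA mul_mx_diag mxE mulUk -Hg divfK.
rewrite !dmon_log // (Hx _ _ ab); congr (_ * _).
rewrite mulmxA mul_mx_diag; under eq_bigr => i _ do rewrite mxE mulUk mulfK //.
rewrite (afun_meq _ ab).
by under [RHS]eq_bigr => i _ do rewrite mxE mulUk mulfK //.
Qed.

Lemma row_free_UkD x : (forall i, x 0 i != 0) -> row_free (Uk *m diag_mx x).
Proof.
move=> x0; rewrite -row_leq_rank mxrankMfree ?row_leq_rank ?row_free_Uk //.
rewrite row_free_unit unitmxE det_diag unitfE.
by apply/prodf_neq0 => i _; exact: x0.
Qed.

Lemma toric_eq_cone nu t : char t -> toric_eq u (nu *: phi u t).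
Proof. by move=> ct a b [e w]; rewrite !mon_cone // e w. Qed.

Definition pcoef (f : pidx) : k := \det (colsub f Uk).

(** The coordinate [f] is a constant times the monomial [\prod_j x_(f j)],
    which restricts to the character [z^(u_(f 0) + ... + u_(f n))] of the
    torus. *)
Definition gform (x : 'rV[k]_N.+1) : 'rV[k]_#|pidx| :=
  \row_j (pcoef (enum_val j) * mon x (fmon (enum_val j))).

Lemma plucker_Uk x : plucker (Uk *m diag_mx x) = gform x.
Proof. by apply/rowP => j; rewrite plucker_diag !mxE. Qed.

Lemma gauss_unit x y : (forall i, x 0 i != 0) -> toric_eq u x ->
  gauss n X x y <-> exists2 mu, mu != 0 & y = mu *: gform x.
Proof.
move=> x0 Hx; rewrite (gaussE (W := Uk *m diag_mx x)) ?row_free_UkD //.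
  rewrite plucker_Uk; split=> [[]|] // H; split=> //; apply/(toricP co_bij); split=> //.
  by apply: contraNneq (x0 ord0) => ->; rewrite mxE.
by move=> v; rewrite tangent_unit.
Qed.

(** For [n+1] points of an affine space of dimension [n], to span is to have an
    invertible matrix of homogeneous coordinates. *)
Lemma spanning_pcoef (f : pidx) : spanning k co u f <-> pcoef f != 0.
Proof.
have E : (pcoef f != 0) = row_full (colsub f Uk)^T.
  by rewrite row_full_unit unitmx_tr unitmxE unitfE.
have Ef (a : 'rV[k]_n.+1) : a *m (colsub f Uk)^T =
    \row_i oapp (fun i' => \sum_j a 0 j * (co (u (f j)) 0 i')%:~R)
                (\sum_j a 0 j) (unlift ord0 i).
  apply/rowP => i; rewrite !mxE; case: unliftP => [i' ->|->] /=;
  apply: eq_bigr => j _; rewrite !mxE ?liftK ?unlift_none ?mulr1 //.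
rewrite E; split=> [Hs|/row_fullP[P HP] v]; last first.
  pose w : 'rV[k]_n.+1 := \row_i oapp (v 0) 1 (unlift ord0 i).
  have := Ef (w *m P); rewrite -mulmxA HP mulmx1 => /rowP Hw.
  exists n.+1, (fun j => u (f j)), (fun j => (w *m P) 0 j); split.
  - by move=> i; exists i.
  - by have := Hw ord0; rewrite !mxE unlift_none.
  apply/rowP => i; rewrite summxE; have := Hw (lift ord0 i).
  rewrite !mxE liftK /= => ->; apply: eq_bigr => j _.
  by rewrite !mxE.
have Hv (v : 'rV[k]_n) : (\row_i oapp (v 0) 1 (unlift ord0 i) <= (colsub f Uk)^T)%MS.
  have [l [w [a [/fin_all_exists[h Hh] sa ->]]]] := Hs v.
  apply/submxP; exists (\row_j \sum_(i | h i == j) a i); rewrite Ef.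
  apply/rowP => i; rewrite !mxE; case: unliftP => [i' _|_] /=.
    rewrite summxE (partition_big h xpredT) //=; apply: eq_bigr => j _.
    rewrite mxE mulr_suml; apply: eq_bigr => i0 /eqP <-.
    by rewrite !mxE -Hh.
  by rewrite -sa (partition_big h xpredT) //=; apply: eq_bigr => j _; rewrite mxE.
rewrite -sub1mx; apply/row_subP => i; rewrite row1.
have e0 : delta_mx 0 ord0 = \row_i oapp ((0 : 'rV[k]_n) 0) 1 (unlift ord0 i).
  by apply/rowP => j; rewrite !mxE; case: unliftP => [j' ->|->] /=; rewrite ?mxE ?eqxx.
case: (unliftP ord0 i) => [i' ->|->]; last by rewrite e0.
have -> : delta_mx 0 (lift ord0 i') =
  \row_i oapp ((delta_mx 0 i' : 'rV[k]_n) 0) 1 (unlift ord0 i) -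
  \row_i oapp ((0 : 'rV[k]_n) 0) 1 (unlift ord0 i).
  apply/rowP => j; rewrite !mxE; case: unliftP => [j' ->|->] /=.
    by rewrite !mxE ?eqxx (inj_eq lift_inj) subr0.
  by rewrite subrr.
by rewrite addmx_sub ?eqmx_opp.
Qed.

Lemma gauss_on_torusP : gauss_on_torus k co u.
Proof.
exists pcoef; split=> [f|t ct]; first by rewrite spanning_pcoef.
apply/gauss_unit.
- by move=> i; rewrite mxE char_neq0.
- by rewrite -[phi u t]scale1r; exact: toric_eq_cone.
exists 1; rewrite ?oner_eq0 // scale1r; apply/rowP => j.
by rewrite !mxE mon_phi // wt_fmon.
Qed.

End GaussTorus.

(** * The rank of the Gauss map *)

Section GaussRank.
Variables (k : closedFieldType) (n N : nat) (M : zmodType).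
Variables (co : {additive M -> 'rV[int]_n}) (co_bij : bijective co).
Variables (u : 'I_N.+1 -> M).
Hypothesis Aff_A : forall x : M, Aff (family_set u) x.
Implicit Types (x v : 'rV[k]_N.+1) (nu : k) (t : M -> k).
Local Notation char := (torus_point (k := k) (@full M)).
Local Notation X := (toric_variety (k := k) u).
Local Notation pidx := (plucker_index n N).
Local Notation Uk := (Uk k co u).
Local Notation pcoef := (pcoef k co u).
Local Notation gform := (gform co u).
Local Notation B := (Bset k co u).
Let bs (j : 'I_#|pidx|) := vertex_sum u (enum_val j).
Let cj (j : 'I_#|pidx|) := pcoef (enum_val j).

Lemma afun_delta0 d (b : M) :
  afun co (delta_mx 0 ord0 : 'rV[k]_n.+1) d b = d%:~R.
Proof.
rewrite /afun big1 => [|i _]; first by rewrite addr0 mxE !eqxx mul1r.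
by rewrite mxE mul0r.
Qed.

Lemma afun_deltaS i d (b : M) :
  afun co (delta_mx 0 (lift ord0 i) : 'rV[k]_n.+1) d b = (co b 0 i)%:~R.
Proof.
rewrite /afun (bigD1 i) //= big1 => [|j /negPf ji].
  by rewrite !mxE !eqxx /= mul0r add0r addr0 mul1r.
by rewrite mxE (inj_eq lift_inj) ji mul0r.
Qed.

Definition full_mon : 'X_{1..N.+1} := [multinom 1%N | i < N.+1].

Lemma mon_full_mon x : (mon x full_mon != 0) = [forall i, x 0 i != 0].
Proof.
rewrite mon_eq0 negb_exists; apply: eq_forallb => i.
by rewrite mnmE andbT.
Qed.

Lemma torus_coord_neq0 t : char t -> forall i, phi u t 0 i != 0.
Proof. by move=> ct i; rewrite mxE char_neq0. Qed.

(** The points with invertible coordinates are the complement in [X] of the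
    form [\prod_i x_i]. *)
Lemma generically_unit (Pr : 'rV[k]_N.+1 -> Prop) :
  (forall x, X x -> (forall i, x 0 i != 0) -> Pr x) -> generically X Pr.
Proof.
move=> H; exists (mdeg full_mon), 'X_[full_mon]; split.
- by rewrite dhomogX /=.
- exists (phi u (fun=> 1)); rewrite evX mon_full_mon; split.
    exact/toric_phi/char1.
  by apply/forallP/torus_coord_neq0; exact: char1.
by move=> x Xx; rewrite evX mon_full_mon => /forallP; exact: H.
Qed.

Definition gpoly (j : 'I_#|pidx|) : {mpoly k[N.+1]} :=
  cj j *: 'X_[fmon (enum_val j : pidx)].

Lemma gpoly_homog j : gpoly j \is n.+1.-homog.
Proof. by rewrite dhomogZ // dhomogX /= mdeg_fmon. Qed.

Lemma ev_gpoly x : ev_tuple gpoly x = gform x.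
Proof. by apply/rowP => j; rewrite !mxE evZ evX. Qed.

Lemma represents_gpoly : represents X (gauss n X) gpoly.
Proof.
split; first by exists n.+1 => j; exact: gpoly_homog.
apply: generically_unit => x /(toricP co_bij)[_ Hx] x0; rewrite ev_gpoly.
by apply/(gauss_unit co_bij Aff_A _ x0 Hx); exists 1; rewrite ?oner_eq0 ?scale1r.
Qed.

Lemma exists_spanning : exists j, cj j != 0.
Proof.
have [f df] := row_free_minor (row_free_Uk k co_bij Aff_A).
by exists (enum_rank f); rewrite /cj enum_rankK.
Qed.

Lemma BsetP b : B b <-> exists2 j : 'I_#|pidx|, cj j != 0 & b = bs j.
Proof.
split=> [[f [/(spanning_pcoef k co u) sf ->]]|[j cj0 ->]].
  by exists (enum_rank f); rewrite /cj /bs enum_rankK.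
by exists (enum_val j); split=> //; apply/(spanning_pcoef k co u).
Qed.

Variable j0 : 'I_#|pidx|.
Hypothesis cj0 : cj j0 != 0.

(** The row space is the direction of [Aff_k(B)]. *)
Definition Bdiff : 'M[k]_(#|pidx|, n) :=
  \matrix_(j < #|pidx|) (if cj j != 0 then base k co (bs j) - base k co (bs j0) else 0).

Lemma Bdiff_sub j : cj j != 0 ->
  (base k co (bs j) - base k co (bs j0) <= Bdiff)%MS.
Proof. by move=> c0; have := row_sub j Bdiff; rewrite rowK c0. Qed.

Lemma aff_dim_B : aff_dim (Aff_over (F := k) co B) (\rank Bdiff).
Proof.
exists (base k co (bs j0)), (row_base Bdiff); split; first exact: row_base_free.
move=> v; rewrite eq_row_base; split.
  move=> [l [w [a [Hw sa ->]]]].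
  have /fin_all_exists2[f cf Hf] i := proj1 (BsetP _) (Hw i).
  have -> : \sum_i a i *: base k co (w i) - base k co (bs j0) =
      \sum_i a i *: (base k co (bs (f i)) - base k co (bs j0)).
    under [RHS]eq_bigr => i _ do rewrite scalerBr -Hf.
    by rewrite sumrB -scaler_suml sa scale1r.
  by apply: summx_sub => i _; apply/scalemx_sub/Bdiff_sub.
move=> /submxP[c Hc].
have {Hc}-> : v = c *m Bdiff + base k co (bs j0) by rewrite -Hc subrK.
pose w (i : 'I_#|pidx|.+1) :=
  oapp (fun j => if cj j != 0 then bs j else bs j0) (bs j0) (unlift ord0 i).
pose a (i : 'I_#|pidx|.+1) :=
  oapp (fun j => c 0 j) (1 - \sum_j c 0 j) (unlift ord0 i).
exists #|pidx|.+1, w, a; split.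
- move=> i; apply/BsetP; rewrite /w; case: unliftP => [j _|_] /=; last by exists j0.
  by case: ifP => c0; [exists j|exists j0].
- rewrite big_ord_recl /a unlift_none /=.
  by under [X in _ + X]eq_bigr => i _ do rewrite liftK /=; rewrite subrK.
rewrite big_ord_recl /a /w unlift_none /= addrC.
under [X in _ = _ + X]eq_bigr => i _ do rewrite liftK /=.
rewrite scalerBl scale1r -addrA; congr (_ + _).
rewrite scaler_suml addrC -sumrB mulmx_sum_row; apply: eq_bigr => j _.
by rewrite -scalerBr rowK; case: ifP => //; rewrite subrr.
Qed.

(** By Euler's formula the differential of [z^b] in homogeneous coordinates has
    the row [n+1] instead of [1], which may vanish in [k]; adding the row of
    values repairs this, so the rank is the one of the points [(1, b)] for [b]
    in [B]. *)
Lemma gauss_differential x : toric_eq u x -> (forall i, x 0 i != 0) ->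
  differential_rank X gpoly x (\rank Bdiff).
Proof.
move=> Hx x0; exists <<Uk *m diag_mx x>>%MS; split.
  by move=> v; rewrite genmxE (tangent_unit co_bij Aff_A x0 Hx).
set J := \matrix_(i, j) _; rewrite ev_gpoly.
pose Bm : 'M[k]_(n.+1, #|pidx|) := \matrix_(i < n.+1, j < #|pidx|) afun co (delta_mx 0 i) 1
  (bs j).
have EJ i j : (Uk *m diag_mx x *m J) i j =
    gform x 0 j * afun co (delta_mx 0 i : 'rV[k]_n.+1) n.+1 (bs j).
  pose v : 'rV[k]_N.+1 := \row_l (Uk i l * x 0 l).
  transitivity (cj j * dmon x v (fmon (enum_val j : pidx))).
    rewrite mul_mx_diag !mxE /dmon mulr_sumr; apply: eq_bigr => l _.
    rewrite !mxE /gpoly mderivZ mderivX !evZ evX -/(mxE); ring.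
  rewrite dmon_log => [|l _]; last exact: x0.
  rewrite mulrA !mxE; congr (_ * _).
  have -> : afun co (delta_mx 0 i : 'rV[k]_n.+1) n.+1 (bs j) =
      afun co (delta_mx 0 i : 'rV[k]_n.+1) (mdeg (fmon (enum_val j))) (wt u (fmon (enum_val
        j))).
    by rewrite mdeg_fmon wt_fmon.
  rewrite -afun_mon.
  apply: eq_bigr => l _; rewrite !mxE mulfK // -mulUk -rowE.
  by rewrite !mxE.
set D := diag_mx (gform x).
have e0 (b : M) d i : afun co (delta_mx 0 i : 'rV[k]_n.+1) d b =
    (i == ord0)%:R * (d%:~R - 1) + afun co (delta_mx 0 i : 'rV[k]_n.+1) 1 b.
  case: (unliftP ord0 i) => [i' ->|->]; first by rewrite !afun_deltaS mul0r add0r.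
  by rewrite !afun_delta0 mul1r subrK.
(* Only the first row of the differential, which comes from [x] itself,
   differs from the one of [Bm]: by the factor [n+1], as the row of values is
   the first row of [Bm *m D]. *)
have E1 : (col_mx (<<Uk *m diag_mx x>>%MS *m J) (gform x) :=: Bm *m D)%MS.
  have rowBD i : row i (Bm *m D) =
      \row_(j < #|pidx|) (gform x 0 j * afun co (delta_mx 0 i) 1 (bs j)).
    by apply/rowP => j; rewrite mul_mx_diag !mxE mulrC.
  have F0 : gform x = row ord0 (Bm *m D).
    by rewrite rowBD; apply/rowP => j; rewrite [RHS]mxE afun_delta0 mulr1.
  have RJ i : row i (Uk *m diag_mx x *m J) =
      row i (Bm *m D) + ((i == ord0)%:R * n%:R) *: row ord0 (Bm *m D).
    apply/rowP => j; rewrite -F0 rowBD mxE EJ e0 [RHS]mxE [X in _ = X + _]mxE.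
    have -> : n.+1%:~R - 1 = n%:R :> k by rewrite -pmulrn -addn1 natrD addrK.
    rewrite [X in _ = _ + X]mxE; ring.
  apply: eqmx_trans (eqmx_sym (addsmxE _ _)) _.
  apply: eqmx_trans (adds_eqmx (eqmxMr J (genmxE _)) (eqmx_refl _)) _.
  apply/eqmxP/andP; split.
    rewrite addsmx_sub F0 row_sub andbT; apply/row_subP => i.
    by rewrite RJ addmx_sub ?scalemx_sub ?row_sub.
  apply/row_subP => i.
  have -> : row i (Bm *m D) = row i (Uk *m diag_mx x *m J) -
      ((i == ord0)%:R * n%:R) *: gform x by rewrite RJ F0 addrK.
  rewrite addmx_sub ?eqmx_opp ?scalemx_sub ?addsmxSr //.
  exact: submx_trans (row_sub _ _) (addsmxSl _ _).
rewrite E1.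
pose chi : 'rV[k]_#|pidx| := \row_(j < #|pidx|) (cj j != 0)%:R.
pose g' : 'rV[k]_#|pidx| := \row_(j < #|pidx|) (if cj j != 0 then gform x 0 j else 1).
(* the columns outside [B] vanish, the others are rescaled by units *)
have ED : D = diag_mx chi *m diag_mx g'.
  rewrite mulmx_diag; congr diag_mx; apply/rowP => j; rewrite !mxE -/(cj j).
  by case: eqP => [->|] /=; rewrite !(mul0r, mul1r).
rewrite ED mulmxA mxrankMfree; last first.
  rewrite row_free_unit unitmxE det_diag unitfE; apply/prodf_neq0 => j _.
  rewrite !mxE; case: ifP => [c0|]; last by rewrite oner_eq0.
  rewrite mulf_neq0 // mon_eq0; apply/existsP => -[i].
  by rewrite (negPf (x0 i)).
rewrite -mxrank_tr.
pose b0 : 'rV[k]_n := base k co (bs j0).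
have E2 : ((Bm *m diag_mx chi)^T :=: (block_mx 1%:M b0 0 Bdiff : 'M_(1 + _, 1 + n)))%MS.
  have rowT j : row j (Bm *m diag_mx chi)^T = chi 0 j *: row_mx 1%:M b0 + row_mx 0 (row j
    Bdiff) :> 'rV[k]_(1 + n).
    rewrite rowK scale_row_mx add_row_mx addr0; apply/rowP => i.
    rewrite mul_mx_diag !mxE; case: (unliftP ord0 i) => [i' Ei|Ei].
      have -> : split (i : 'I_(1 + n)) = inr i'.
        by rewrite -(unsplitK (inr i')); congr split; apply: val_inj; rewrite Ei.
      rewrite Ei afun_deltaS !mxE -/(cj j).
      by case: ifP => _ /=; rewrite !mxE; ring.
    have -> : split (i : 'I_(1 + n)) = inl ord0.
      by rewrite -(unsplitK (inl ord0)); congr split; apply: val_inj; rewrite Ei.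
    by rewrite Ei afun_delta0 !mxE -/(cj j) /=; ring.
  have -> : (block_mx 1%:M b0 0 Bdiff : 'M_(1 + _, 1 + n)) = col_mx (row_mx 1%:M b0) (row_mx
    0 Bdiff) by [].
  apply: eqmx_trans (addsmxE _ _); apply/eqmxP/andP; split.
    apply/row_subP => j; rewrite rowT addmx_sub_adds ?scalemx_sub //.
    have <- : row j (row_mx (0 : 'M_(_, 1)) Bdiff) = row_mx 0 (row j Bdiff).
      by rewrite row_row_mx row0.
    exact: row_sub.
  have s0 : (row_mx 1%:M b0 <= (Bm *m diag_mx chi)^T)%MS.
    have := row_sub j0 (Bm *m diag_mx chi)^T.
    by rewrite rowT rowK cj0 subrr row_mx0 addr0 mxE cj0 scale1r.
  rewrite addsmx_sub s0; apply/row_subP => j.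
  have -> : row j (row_mx (0 : 'M_(_, 1)) Bdiff) = row j (Bm *m diag_mx chi)^T - chi 0 j *:
    row_mx 1%:M b0.
    by rewrite rowT row_row_mx row0 addrAC subrr add0r.
  by rewrite addmx_sub ?eqmx_opp ?scalemx_sub // row_sub.
rewrite E2.
have uT : (block_mx 1%:M (- b0) 0 1%:M : 'M_(1 + n)) \in unitmx.
  by rewrite unitmxE det_ublock !det1 mulr1 unitr1.
rewrite -(mxrankMfree _ (_ : row_free (block_mx 1%:M (- b0) 0 1%:M))) ?row_free_unit //.
rewrite mulmx_block !mul1mx !mul0mx !mulmx1 !mulmx0 addr0 addNr addr0 add0r.
by rewrite rank_diag_block_mx mxrank1.
Qed.

Lemma gauss_rank : rational_map_rank X (gauss n X) (\rank Bdiff).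
Proof.
exists gpoly; split; first exact: represents_gpoly.
apply: generically_unit => x /(toricP co_bij)[_ Hx] x0.
exact: gauss_differential.
Qed.

End GaussRank.

(** * Sublattices in adapted coordinates *)

Lemma subgroup_genP (M : zmodType) (S : M -> Prop) x : subgroup_gen S x <->
  exists2 s : seq (M * int), (forall p, p \in s -> S p.1) &
    x = \sum_(p <- s) p.1 *~ p.2.
Proof.
split=> [[l [w [a [Sw ->]]]]|[s Ss ->]].
  exists [seq (w i, a i) | i <- enum 'I_l]; first by move=> p /mapP[i _ ->]; exact: Sw.
  by rewrite big_map big_enum.
exists (size s), (fun i => (tnth (in_tuple s) i).1), (fun i => (tnth (in_tuple s) i).2).
split; first by move=> i; apply/Ss/mem_tnth.
by rewrite big_tnth.
Qed.

Definition is_subgroup (M : zmodType) (S : M -> Prop) : Prop :=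
  S 0 /\ forall x y, S x -> S y -> S (x - y).

Section Subgroups.
Variables (M : zmodType) (S : M -> Prop).
Hypothesis sgS : is_subgroup S.

Lemma sg0 : S 0. Proof. by case: sgS. Qed.
Lemma sgB x y : S x -> S y -> S (x - y). Proof. by case: sgS => _; exact. Qed.
Lemma sgN x : S x -> S (- x).
Proof. by move=> Sx; rewrite -sub0r; apply: sgB => //; exact: sg0. Qed.
Lemma sgD x y : S x -> S y -> S (x + y).
Proof. by move=> Sx Sy; rewrite -[y]opprK; apply/sgB/sgN. Qed.
Lemma sg_sum (I : Type) (r : seq I) (P : pred I) (F : I -> M) :
  (forall i, P i -> S (F i)) -> S (\sum_(i <- r | P i) F i).
Proof. by move=> H; elim/big_rec: _ => [|i x Pi Sx]; [exact: sg0|apply/sgD; auto]. Qed.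
Lemma sgMn x d : S x -> S (x *+ d).
Proof. by move=> Sx; elim: d => [|d IH]; rewrite ?mulr0n ?mulrS; [exact: sg0|exact: sgD]. Qed.
Lemma sgMz x d : S x -> S (x *~ d).
Proof.
by move=> Sx; case: d => d; rewrite ?NegzE ?mulrNz -pmulrn; [|apply: sgN]; exact: sgMn.
Qed.
End Subgroups.

Lemma sg_full (M : zmodType) : is_subgroup (@full M). Proof. by []. Qed.

Lemma sg_gen (M : zmodType) (S : M -> Prop) : is_subgroup (subgroup_gen S).
Proof.
split; first by apply/subgroup_genP; exists [::]; rewrite ?big_nil.
move=> x y /subgroup_genP[s Ss ->] /subgroup_genP[s' Ss' ->].
apply/subgroup_genP; exists (s ++ [seq (p.1, - p.2) | p <- s']).
  by move=> p; rewrite mem_cat => /orP[/Ss//|/mapP[q /Ss' ? ->]].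
rewrite big_cat big_map -sumrN; congr (_ + _).
by apply: eq_bigr => p _; rewrite mulrNz.
Qed.

Lemma sub_gen (M : zmodType) (S : M -> Prop) x : S x -> subgroup_gen S x.
Proof.
move=> Sx; apply/subgroup_genP; exists [:: (x, 1)]; last by rewrite big_seq1 mulr1z.
by move=> p; rewrite inE => /eqP->.
Qed.

Lemma gen_sub (M : zmodType) (S G : M -> Prop) x : is_subgroup G ->
  (forall y, S y -> G y) -> subgroup_gen S x -> G x.
Proof.
move=> sgG SG [l [w [a [Sw ->]]]]; apply: sg_sum => // i _.
by apply: sgMz => //; exact: SG.
Qed.

Section Lattices.
Variables (n : nat) (M : zmodType).

(** A sublattice of [M] for which the basis underlying the coordinates [co] is
    adapted; the elementary divisors may vanish. *)
Definition Lat (co : M -> 'rV[int]_n) (D : 'I_n -> nat) : M -> Prop :=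
  fun x => forall i, ((D i)%:Z %| co x 0%R i)%Z.

Lemma sg_Lat (co : {additive M -> 'rV[int]_n}) D : is_subgroup (Lat co D).
Proof.
split=> [i|x y Hx Hy i]; first by rewrite raddf0 mxE dvdz0.
by rewrite raddfB !mxE rpredB ?Hx ?Hy.
Qed.

Lemma Lat_sub (co : M -> 'rV[int]_n) D E x :
  (forall i, (E i %| D i)%N) -> Lat co D x -> Lat co E x.
Proof. by move=> ED Hx i; apply: dvdz_trans (Hx i); exact: ED. Qed.

Variables (co : {additive M -> 'rV[int]_n}) (co_bij : bijective co).

(** This is the Smith normal form of the matrix of the generators. *)
Lemma adapted_coords (I : finType) (v : I -> M) :
  exists (co' : {additive M -> 'rV[int]_n}) (D : 'I_n -> nat) (R : 'M[int]_n),
    [/\ bijective co', R \in unitmx, forall x, co x = co' x *m R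
      & forall x, Lat co' D x <-> exists a : I -> int, x = \sum_i v i *~ a i].
Proof.
pose m := #|I|; pose A : 'M[int]_(m, n) := \matrix_(i < m) co (v (enum_val i)).
have [L uL [R uR [d _ EA]]] := int_Smith_normal_form A.
pose co1 x := co x *m invmx R.
have co1_add : zmod_morphism co1.
  by move=> x y; rewrite /co1 raddfB mulmxBl.
pose ad := GRing.isZmodMorphism.Build _ _ co1 co1_add.
pose co' : {additive M -> 'rV[int]_n} := HB.pack co1 ad.
pose D (i : 'I_n) : nat := if (i < m)%N then absz (d`_i)%R else 0%N.
have coE x : co x = co' x *m R by rewrite /= /co1 mulmxKV.
exists co', D, R; split=> //.
  case: co_bij => g gK Kg; exists (fun y => g (y *m R)) => y /=.
    by rewrite /co1 mulmxKV ?gK.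
  by rewrite /co1 Kg mulmxK.
have coV x : co' x = co x *m invmx R by [].
clearbody co'.
pose S : 'M[int]_(m, n) := \matrix_(i, j) (d`_i *+ (i == j :> nat)).
have ES (b : 'rV_m) j : (b *m S) 0 j =
    if insub (val j) is Some i then b 0 i * d`_j else 0.
  rewrite mxE; case: insubP => [i _ Ei|jm].
    rewrite (bigD1 i) //= mxE Ei eqxx mulr1n big1 ?addr0 // => l.
    by rewrite -(inj_eq val_inj) Ei => /negPf ne; rewrite mxE ne mulr0.
  rewrite big1 // => i _; rewrite mxE; case: eqP => [E|]; last by rewrite mulr0.
  by move: jm; rewrite /= -E ltn_ord.
have EC (a : 'rV[int]_m) : a *m A = co (\sum_i v (enum_val i) *~ a 0 i).
  rewrite raddf_sum mulmx_sum_row; apply: eq_bigr => i _ /=.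
  by rewrite rowK raddfMz -scaler_int intz.
move=> x; split=> [Hx|[a ->]].
  pose b : 'rV[int]_m := \row_i
    (if insub (val i) is Some j then (co' x 0%R j %/ (d`_i)%R)%Z else 0).
  pose a := b *m invmx L.
  exists (fun i => a 0 (enum_rank i)).
  have -> : \sum_i v i *~ a 0 (enum_rank i) = \sum_(i < m) v (enum_val i) *~ a 0 i.
    rewrite (reindex (@enum_val I predT)) /=; last exact/onW_bij/enum_val_bij.
    by apply: eq_bigr => i _; rewrite enum_valK.
  apply: (bij_inj co_bij); rewrite -EC EA !mulmxA mulmxKV // coE; congr (_ *m _).
  apply/rowP => j; rewrite ES; have := Hx j; rewrite /D.
  case: insubP => [i im Ei|jm]; last by rewrite (negPf jm) dvd0z => /eqP.
  have Ed : d`_i = d`_j by congr (nth _ _ _).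
  by rewrite im [b 0 i]mxE Ei valK Ed => Hd; rewrite divzK.
have -> : \sum_i v i *~ a i = \sum_(i < m) v (enum_val i) *~ (\row_i a (enum_val i)) 0 i.
  rewrite (reindex (@enum_val I predT)) /=; last exact/onW_bij/enum_val_bij.
  by apply: eq_bigr => i _; rewrite mxE.
move=> j; move: (\row_i _) => b {a}.
have -> : co' (\sum_i v (enum_val i) *~ b 0 i) = b *m L *m S.
  by rewrite coV -EC EA !mulmxA mulmxK.
rewrite ES /D; case: insubP => [i im Ei|/negPf->]; last by rewrite dvdz0.
by rewrite im; apply/dvdz_mull; rewrite dvdzE.
Qed.

End Lattices.

Section LatticeFacts.
Variables (n : nat) (M : zmodType).
Variables (co : {additive M -> 'rV[int]_n}) (co_bij : bijective co).

Lemma Lat_basis D (e : 'I_n -> M) i : (forall j, co (e j) = delta_mx 0 j) ->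
  Lat co D (e i *+ D i).
Proof.
move=> He j; rewrite coMn He mxE eqxx /=.
by case: eqP => [->|_]; rewrite ?mulr1 ?mulr0 ?dvdzz ?dvdz0.
Qed.

(** The cosets are represented by the vectors with [i]-th coordinate [E i * a]
    for [0 <= a < r i]; when [E i = 0] this coordinate is 0, whence the
    condition on [r]. *)
Lemma index_Lat (E D r : 'I_n -> nat) :
  (forall i, D i = (E i * r i)%N) -> (forall i, (0 < r i)%N) ->
  (forall i, E i = 0%N -> r i = 1%N) ->
  group_index (Lat co E) (Lat co D) (\prod_i r i)%N.
Proof.
move=> DE r0 E0; case: (co_bij) => g gK Kg.
pose J := {dffun forall i : 'I_n, 'I_(r i)}.
have <- : #|J| = (\prod_i r i)%N.
  rewrite card_dep_ffun foldrE big_map -big_enum /=.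
  by apply: eq_bigr => i _; rewrite card_ord.
pose c (a : J) := g (\row_i (E i * a i)%:Z).
have cE a i : co (c a) 0 i = (E i * a i)%:Z by rewrite Kg mxE.
exists (fun i => c (enum_val i)); split=> [i j|x Hx].
  by rewrite cE PoszM dvdz_mulr.
have /fin_all_exists[q Hq] i : exists q, co x 0 i = q * (E i)%:Z.
  by have /dvdzP := Hx i.
have HL (a : J) : Lat co D (x - c a) <->
    forall i, E i = 0%N \/ ((r i)%:Z %| q i - (a i : nat)%:Z)%Z.
  have HLi i : ((D i)%:Z %| co (x - c a) 0%R i)%Z <->
      E i = 0%N \/ ((r i)%:Z %| q i - (a i : nat)%:Z)%Z.
    rewrite raddfB !mxE cE Hq DE !PoszM [q i * _]mulrC -mulrBr.
    have [->|Ei] := eqVneq (E i) 0%N; first by rewrite !mul0r dvdz0; split=> //; left.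
    rewrite dvdz_mul2l; last by rewrite eqz_nat.
    by split=> [|[/eqP|//]]; [right|rewrite (negPf Ei)].
  by split=> H i; apply/HLi/H.
have r_neq0 i : (r i)%:Z != 0 by rewrite eqz_nat -lt0n.
have lt_r i : (`|(q i %% (r i)%:Z)%Z| < r i)%N.
  by rewrite -ltz_nat gez0_abs ?modz_ge0 // ltz_pmod // ltz_nat.
pose a : J := [ffun i => Ordinal (lt_r i)].
have aE i : a i = Ordinal (lt_r i) by rewrite ffunE.
have Ha : Lat co D (x - c a).
  apply/HL => i; right; rewrite aE /= gez0_abs ?modz_ge0 //.
  by rewrite {1}(divz_eq (q i) (r i)%:Z) addrK dvdz_mull.
exists (enum_rank a); split=> [|j]; first by rewrite enum_rankK.
move=> /HL Hj; rewrite -[j]enum_valK; congr enum_rank; apply/ffunP => i.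
apply: val_inj; move/HL: Ha => /(_ i); have := Hj i.
case: (eqVneq (E i) 0%N) => [/E0 r1 _ _|/eqP Ei [//|Hji] [//|Hai]].
  have := ltn_ord (a i); have := ltn_ord (enum_val j i).
  rewrite [X in (_ < X)%N -> _]r1 [X in _ -> (_ < X)%N -> _]r1 !ltnS !leqn0 => /eqP Ej /eqP Ea.
  exact: etrans Ea (esym Ej).
have : ((r i)%:Z %| (a i : nat)%:Z - (enum_val j i : nat)%:Z)%Z.
  rewrite -[X in (_ %| X)%Z](_ : (q i - (enum_val j i : nat)%:Z) - (q i - (a i : nat)%:Z) = _).
    by rewrite rpredB.
  by rewrite opprB addrC addrA subrK.
rewrite -eqz_mod_dvd !modz_nat eqz_nat => /eqP.
by rewrite !modn_small.
Qed.

(** The divisors of the saturation of a lattice, and the quotients of the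
    divisors of the lattice by them. *)
Definition zero_or_one (D : 'I_n -> nat) (i : 'I_n) : nat := (D i != 0)%N.
Definition nonzero_factor (D : 'I_n -> nat) i := (if D i == 0 then 1 else D i)%N.

Lemma zero_or_oneM D i : D i = (zero_or_one D i * nonzero_factor D i)%N.
Proof.
by rewrite /zero_or_one /nonzero_factor; case: eqP => [->|_] //; rewrite mul1n.
Qed.

Lemma nonzero_factor_gt0 D i : (0 < nonzero_factor D i)%N.
Proof. by rewrite /nonzero_factor; case: eqP => // /eqP; rewrite lt0n. Qed.

Lemma nonzero_factor1 D i : zero_or_one D i = 0%N -> nonzero_factor D i = 1%N.
Proof. by rewrite /zero_or_one /nonzero_factor; case: eqP. Qed.

Lemma Lat_zero_or_one D x : Lat co (zero_or_one D) x <->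
  forall i, D i = 0%N -> co x 0 i = 0.
Proof.
split=> [H i Di|H i]; first by have := H i; rewrite /zero_or_one Di eqxx dvd0z => /eqP.
rewrite /zero_or_one; have [Di|] := eqVneq; last by rewrite dvd1z.
by rewrite H.
Qed.

Lemma Lat_torsion D x : Lat co (zero_or_one D) x ->
  Lat co D (x *+ \prod_i nonzero_factor D i).
Proof.
move=> /Lat_zero_or_one Hx i; rewrite coMn (bigD1 i) //= /nonzero_factor.
case: eqP => [Di|_]; first by rewrite Hx // mulr0 dvdz0.
by rewrite PoszM -mulrA dvdz_mulr.
Qed.

(** The real span of [L] is cut out by the coordinates with divisor 0. *)
Lemma real_span_Lat (F : realType) (co0 : M -> 'rV[int]_n) (R : 'M[int]_n) D (L : M -> Prop) :
  R \in unitmx -> (forall x, co0 x = co x *m R) ->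
  (forall x, L x <-> Lat co D x) ->
  forall x, real_span_cap F co0 L x <-> Lat co (zero_or_one D) x.
Proof.
move=> uR coR LD x; rewrite Lat_zero_or_one.
have cobase y : base F co y = base F co0 y *m map_mx intr (invmx R).
  by rewrite -map_mxM /base coR mulmxK.
have cobase' y : base F co0 y = base F co y *m map_mx intr R.
  by rewrite -map_mxM /base coR.
split=> [[l [w [a [Lw Ex]]]] i Di|Hx].
  have : base F co x = \sum_i a i *: base F co (w i).
    rewrite cobase Ex mulmx_suml; apply: eq_bigr => j _.
    by rewrite cobase scalemxAl.
  move/rowP/(_ i); rewrite mxE summxE big1 => [/eqP|j _].
    by rewrite intr_eq0 => /eqP.
  have /LD/(_ i) := Lw j; rewrite Di dvd0z => /eqP E.
  by rewrite !mxE E mulr0.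
have [e [He Ee]] := basis_vectors co_bij.
exists n, (fun i => e i *+ D i), (fun i => (co x 0 i)%:~R / (D i)%:R); split.
  by move=> i; apply/LD; exact: Lat_basis.
rewrite cobase' [base F co x](_ : _ = \sum_i ((co x 0 i)%:~R / (D i)%:R) *: base F co (e i *+
  D i)).
  by rewrite mulmx_suml; apply: eq_bigr => i _; rewrite cobase' scalemxAl.
apply/rowP => j; rewrite mxE summxE (bigD1 j) //= big1 ?addr0; last first.
  by move=> i ij; rewrite !mxE coMn He mxE eqxx eq_sym (negPf ij) !mulr0.
rewrite !mxE coMn He mxE !eqxx mulr1.
have [Dj|Dj] := eqVneq (D j) 0%N; first by rewrite Hx // mulr0z !mul0r.
by rewrite -[X in _ * X]pmulrn divfK // pnatr_eq0.
Qed.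

Lemma rank_Lat D : lattice_rank (Lat co D) #|[pred i | D i != 0]|%N.
Proof.
have [e [He Ee]] := basis_vectors co_bij.
pose b (i : 'I_#|[pred i | D i != 0]%N|) := e (enum_val i) *+ D (enum_val i).
have cb i j : co (b i) 0 j = (D j *+ (j == enum_val i))%:Z.
  by rewrite coMn He mxE eqxx /=; case: eqP => [->|]; rewrite ?mulr1 ?mulr0.
have cs c j : co (\sum_i b i *~ c i) 0 j = \sum_i c i * (D j *+ (j == enum_val i))%:Z.
  by rewrite co_sum; apply: eq_bigr => i _; rewrite coMz cb.
have cs1 c i : co (\sum_i b i *~ c i) 0 (enum_val i) = c i * (D (enum_val i))%:Z.
  rewrite cs (bigD1 i) //= eqxx big1 ?addr0 // => j ji.
  by rewrite (inj_eq enum_val_inj) eq_sym (negPf ji) mulr0.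
exists b; split=> [c c0 i|x].
  have := cs1 c i; rewrite c0 raddf0 mxE => /esym/eqP.
  by have := enum_valP i; rewrite inE mulf_eq0 eqz_nat => /negPf->; rewrite orbF => /eqP.
split=> [Hx|[c ->] j]; last first.
  rewrite cs; apply: rpred_sum => i _; apply: dvdz_mull.
  by case: eqP => _; rewrite ?mulr1n ?dvdzz ?dvdz0.
exists (fun i => (co x 0%R (enum_val i) %/ (D (enum_val i))%:Z)%Z).
apply: (bij_inj co_bij); apply/rowP => j.
case: (boolP (D j == 0)%N) => Dj.
  have := Hx j; rewrite (eqP Dj) dvd0z => /eqP->.
  rewrite cs big1 // => i _; rewrite (eqP Dj); case: eqP => _; by rewrite mulr0.
have jD : j \in [pred i | D i != 0%N] by [].
by rewrite -(enum_rankK_in jD jD) cs1 divzK // Hx.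
Qed.

(** The vector [D i *: e i] survives in [M (x) k] when [D i] is invertible in
    [k]. *)
Lemma rank_Lat_over (k : fieldType) (co0 : M -> 'rV[int]_n) (R : 'M[int]_n) D
    (L : M -> Prop) m (V : 'M[k]_(m, n)) :
  R \in unitmx -> (forall x, co0 x = co x *m R) ->
  (forall x, L x <-> Lat co D x) ->
  (forall x, L x -> (base k co0 x <= V)%MS) ->
  (forall i, exists2 x, L x & row i V = base k co0 x) ->
  \rank V = #|[pred i | (D i)%:R != 0 :> k]|.
Proof.
move=> uR coR LD LV VL.
have [e [He Ee]] := basis_vectors co_bij.
pose Rk : 'M[k]_n := map_mx intr R.
have cobase y : base k co0 y = base k co y *m Rk.
  by rewrite -map_mxM /base coR.
pose f (i : 'I_#|[pred i | (D i)%:R != 0 :> k]|) : 'I_n := enum_val i.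
have Ebase j : base k co0 (e j *+ D j) = (D j)%:R *: row j Rk.
  rewrite cobase rowE scalemxAl; congr (_ *m _); apply/rowP => l.
  by rewrite !mxE coMn He mxE eqxx rmorphM /= -pmulrn rmorph_nat.
have EV : (V :=: rowsub f Rk)%MS.
  apply/eqmxP/andP; split; apply/row_subP => i; last first.
    rewrite row_rowsub; have fi : (D (f i))%:R != 0 :> k by have := enum_valP i.
    rewrite -[row _ _]scale1r -(mulVf fi) -scalerA -Ebase scalemx_sub //.
    by apply: LV; apply/LD; exact: Lat_basis.
  have [x Lx ->] := VL i.
  have -> : base k co0 x = \sum_j (co x 0 j)%:~R *: row j Rk.
    rewrite cobase mulmx_sum_row; apply: eq_bigr => j _.
    by rewrite !mxE.
  apply: summx_sub => j _; move/LD/(_ j): Lx => /dvdzP[q ->].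
  rewrite rmorphM /= -pmulrn; have [->|Dj] := eqVneq ((D j)%:R : k) 0.
    by rewrite mulr0 scale0r sub0mx.
  have jD : j \in [pred i | (D i)%:R != 0 :> k] by [].
  have -> : row j Rk = row (enum_rank_in jD j) (rowsub f Rk).
    by rewrite row_rowsub /f enum_rankK_in.
  by rewrite scalemx_sub ?row_sub.
rewrite EV; apply/eqP; rewrite -/(row_free _).
have uRk : Rk \in unitmx by rewrite unitmxE det_map_mx rmorph_unit // -unitmxE.
have -> : rowsub f Rk = rowsub f 1%:M *m Rk by rewrite mul_rowsub_mx mul1mx.
rewrite /row_free mxrankMfree ?row_free_unit // -/(row_free _).
apply/row_freeP; exists (rowsub f 1%:M)^T; apply/matrixP => i j.
rewrite !mxE (bigD1 (f i)) //= !mxE eqxx mul1r big1 ?addr0.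
  by rewrite (inj_eq enum_val_inj) eq_sym.
by move=> l li; rewrite !mxE eq_sym (negPf li) mul0r.
Qed.

End LatticeFacts.

(** * Extension of characters *)

Lemma primitive_root_exists (k : closedFieldType) d : (d%:R : k) != 0 ->
  exists z : k, d.-primitive_root z.
Proof.
move=> dk; have d0 : (0 < d)%N by rewrite lt0n; apply: contraNneq dk => ->.
have [r Er] := closed_field_poly_normal ('X^d - 1 : {poly k}).
rewrite (monicP (monic_Xn_sub_1 k d0)) scale1r in Er.
have ur : uniq r by rewrite -separable_prod_XsubC -Er separable_Xn_sub_1.
have sr : size r = d.
  by apply: succn_inj; rewrite -(size_prod_XsubC r id) -Er size_Xn_sub_1.
have /hasP[z _ pz] : has d.-primitive_root r.
  apply: cyclic.has_prim_root => //; last by rewrite sr.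
  apply/allP => z zr; rewrite unity_rootE -subr_eq0.
  have : root ('X^d - 1 : {poly k}) z by rewrite Er root_prod_XsubC.
  by rewrite rootE !hornerE.
by exists z.
Qed.

Section Extension.
Variables (k : closedFieldType) (n : nat) (M : zmodType).
Variables (co : {additive M -> 'rV[int]_n}) (co_bij : bijective co).
Local Notation char := (torus_point (k := k) (@full M)).

Lemma prodz (I : Type) (r : seq I) (P : pred I) (F : I -> k) (m : int) :
  (\prod_(i <- r | P i) F i) ^ m = \prod_(i <- r | P i) F i ^ m.
Proof. by apply: (big_morph (fun x => x ^ m)) => [x y|]; rewrite ?exp1rz ?expfzMl. Qed.

Lemma prodz_sum (I : Type) (r : seq I) (P : pred I) (x : k) (F : I -> int) :
  x != 0 -> x ^ (\sum_(i <- r | P i) F i) = \prod_(i <- r | P i) x ^ F i.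
Proof.
by move=> x0; apply: (big_morph (fun m => x ^ m)) => [a b|]; rewrite ?expr0z ?expfzDr.
Qed.

(** Divisibility of [k^*]: in coordinates adapted to the differences of the
    [b_i], a character of the sublattice that they generate is extended by
    extracting roots. *)
Lemma char_extend (I : finType) (b : I -> M) (Y : I -> k) :
  (forall i, Y i != 0) ->
  (forall a : I -> int, \sum_i a i = 0 -> \sum_i b i *~ a i = 0 ->
     \prod_i Y i ^ a i = 1) ->
  exists mu t, [/\ mu != 0, char t & forall i, Y i = mu * t (b i)].
Proof.
move=> Y0 HY.
have [i0 _|I0] := pickP I; last first.
  by exists 1, (fun=> 1); split=> [||i]; [exact: oner_neq0|exact: char1|have := I0 i].
pose y i := Y i / Y i0; pose v i := b i - b i0.
have y0 i : y i != 0 by rewrite mulf_neq0 ?invr_eq0.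
have Hy (c : I -> int) : \sum_i v i *~ c i = 0 -> \prod_i y i ^ c i = 1.
  move=> Hc; pose s := \sum_j c j; pose a i := c i - s *+ (i == i0).
  have := HY a; have -> : \sum_i a i = 0.
    rewrite sumrB [X in _ - X](bigD1 i0) //= eqxx [X in _ - (_ + X)]big1 ?addr0 ?subrr //.
    by move=> i /negPf->.
  have -> : \sum_i b i *~ a i = 0.
    rewrite -[RHS]Hc /a /v; under eq_bigr => i _ do rewrite mulrzBr.
    under [RHS]eq_bigr => i _ do rewrite mulrzBl.
    rewrite !sumrB; congr (_ - _).
    rewrite (bigD1 i0) //= eqxx [X in _ + X]big1 ?addr0; last by move=> i /negPf->.
    by rewrite mulr1n mulrz_sumr.
  move=> /(_ erefl erefl) H; rewrite -[RHS]H /a /y.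
  under [RHS]eq_bigr => i _ do rewrite expfzDr //.
  under eq_bigr => i _ do rewrite expfzMl.
  rewrite !big_split /=; congr (_ * _).
  rewrite [RHS](bigD1 i0) //= eqxx mulr1n [X in _ * X]big1 ?mulr1 => [|i /negPf->].
    by rewrite -prodz_sum ?invr_eq0 // exprz_inv.
  by rewrite mulr0n oppr0 expr0z.
have [co' [D [R [co'_bij _ _ HL]]]] := adapted_coords co_bij v.
have [e [He _]] := basis_vectors co'_bij.
have /fin_all_exists[c Hc] j : exists c : I -> int, e j *+ D j = \sum_i v i *~ c i.
  by apply/HL; exact: Lat_basis.
pose be j := \prod_i y i ^ c j i.
have be0 j : be j != 0 by apply/prodf_neq0 => i _; rewrite expfz_neq0.
have /fin_all_exists2[al al0 Hal] j :
    exists2 al : k, al != 0 & D j != 0%N -> al ^+ D j = be j.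
  have [_|Dj] := eqVneq (D j) 0%N; first by exists 1; rewrite ?oner_neq0.
  have [|a Ha] := @closed_root k (be j) (D j); first by rewrite lt0n.
  exists a => //; apply: contraNneq (be0 j) => a0.
  by rewrite -Ha a0 expr0n (negPf Dj).
have ct := char_ofP co' al0; set t := char_of co' al in ct.
have tv i : t (v i) = y i.
  have Hv : Lat co' D (v i).
    apply/HL; exists (fun j => (j == i)%:Z).
    by rewrite (bigD1 i) //= eqxx mulr1z big1 ?addr0 // => j /negPf->.
  pose q j := (co' (v i) 0%R j %/ (D j)%:Z)%Z.
  have Eq j : co' (v i) 0 j = q j * (D j)%:Z by rewrite divzK.
  have -> : t (v i) = \prod_j be j ^ q j.
    apply: eq_bigr => j _; rewrite Eq mulrC -exprz_exp.
    have [Dj|Dj] := eqVneq (D j) 0%N; last by rewrite -exprnP Hal.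
    by rewrite /q Dj divz0 !expr0z.
  have -> : \prod_j be j ^ q j = \prod_l y l ^ (\sum_j c j l * q j).
    under [RHS]eq_bigr => l _ do rewrite prodz_sum //.
    rewrite exchange_big; apply: eq_bigr => j _ /=.
    by rewrite /be prodz; apply: eq_bigr => l _; rewrite exprz_exp.
  have /= := Hy (fun l => \sum_j c j l * q j - (l == i)%:Z).
  under eq_bigr => l _ do rewrite mulrzBr.
  rewrite sumrB [X in _ - X](bigD1 i) //= eqxx mulr1z [X in _ - (_ + X)]big1 ?addr0; last first.
    by move=> l /negPf->.
  have -> : \sum_l v l *~ (\sum_j c j l * q j) = v i.
    under eq_bigr => l _ do rewrite mulrz_sumr.
    rewrite exchange_big; apply: (bij_inj co'_bij); rewrite raddf_sum /=.
    rewrite [RHS]row_sum_delta; apply: eq_bigr => j _.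
    under eq_bigr => l _ do rewrite mulrzA.
    rewrite -mulrz_suml -Hc raddfMz raddfMn /= He Eq -scaler_int -scaler_nat scalerA.
    by rewrite intz natz.
  rewrite subrr => /(_ erefl); under eq_bigr => l _ do rewrite expfzDr //.
  rewrite big_split /= [X in _ * X](bigD1 i) //= eqxx [X in _ * (_ * X)]big1 => [|l /negPf->].
    by rewrite mulr1 => /(canRL (mulfK _)) ->;
      rewrite ?expfz_neq0 // mul1r invr_expz opprK expr1z.
  by rewrite expr0z.
exists (Y i0 / t (b i0)), t; split=> //; first by rewrite mulf_neq0 ?invr_eq0 ?char_neq0.
move=> i; rewrite -[Y i](divfK (Y0 i0)) -/(y i) -tv charB //; ring.
Qed.

(** A character with prescribed values on a sublattice is free in the
    directions that vanish on the sublattice, so [x] has no component there. *)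
Lemma char_one_saturated (I : finType) (b : I -> M) (x : M) :
  (forall t, char t -> (forall i, t (b i) = 1) -> t x = 1) ->
  exists2 d, (0 < d)%N & exists a : I -> int, x *+ d = \sum_i b i *~ a i.
Proof.
move=> Hx; have [co' [D [R [co'_bij _ _ HL]]]] := adapted_coords co_bij b.
exists (\prod_j nonzero_factor D j)%N.
  by apply: prodn_gt0 => j; exact: nonzero_factor_gt0.
apply/HL/Lat_torsion/Lat_zero_or_one => j Dj; apply/eqP/contraT.
move=> /(@exprz_neq1 k)[z zn0 Hz].
have := Hx _ (char_atP co' j zn0); rewrite char_atE => H; rewrite H ?eqxx // in Hz.
move=> i; rewrite char_atE; have /(_ j) : Lat co' D (b i).
  apply/HL; exists (fun l => (l == i)%:Z).
  by rewrite (bigD1 i) //= eqxx mulr1z big1 ?addr0 // => l /negPf->.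
by rewrite Dj dvd0z => /eqP->.
Qed.

(** The values of the character are powers of an [E i]-th root of a primitive
    root of unity of order [r i]; such a root of unity exists as [r i] is
    invertible in [k]. *)
Lemma char_sep_Lat (E D r : 'I_n -> nat) x :
  (forall i, D i = (E i * r i)%N) -> (forall i, (r i)%:R != 0 :> k) ->
  Lat co E x -> ~ Lat co D x ->
  exists t, [/\ char t, forall y, Lat co D y -> t y = 1 & t x != 1].
Proof.
move=> DE r0 Ex /existsNP[i Hi].
have /dvdzP[q Eq] := Ex i.
have Ei : (0 < E i)%N.
  by rewrite lt0n; apply/eqP => E0; case: Hi; rewrite Eq E0 mulr0 dvdz0.
have [z pz] := primitive_root_exists (r0 i).
have [a Ha] := closed_root z Ei.
have z0 : z != 0.
  by apply/eqP => z0; have := prim_expr_order pz; rewrite z0 expr0n;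
    case: eqP => [ri|_ /esym/eqP]; [have := r0 i; rewrite ri eqxx|rewrite oner_eq0].
have a0 : a != 0 by apply: contraNneq z0 => a0; rewrite -Ha a0 expr0n eqn0Ngt Ei.
exists (char_at co i a); split=> [|y Dy|]; first exact: char_atP.
  have /dvdzP[c Ec] := Dy i.
  rewrite char_atE Ec mulrC -exprz_exp -exprnP DE exprM Ha prim_expr_order //.
  by rewrite exp1rz.
rewrite char_atE Eq mulrC -exprz_exp -exprnP Ha; apply/eqP => zq; apply: Hi.
rewrite Eq DE PoszM [q * _]mulrC dvdz_mul2l ?eqz_nat -?lt0n // dvdzE /=.
rewrite (prim_order_dvd pz); apply/eqP; case: q zq {Eq} => // m.
by rewrite NegzE -exprnN => /(canRL invrK); rewrite invr1.
Qed.

End Extension.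

(** * Continuity of the Gauss map at smooth points *)

Section PluckerDetermines.
Variables (k : closedFieldType) (n N : nat).
Implicit Types (W : 'M[k]_(n.+1, N.+1)) (f : plucker_index n N).

(** By Cramer's rule the entries of this product are again Pluecker
    coordinates. *)
Lemma adj_colsub W f i j : (\adj (colsub f W) *m W) i j =
  \det (colsub ([ffun l => if l == i then j else f l] : plucker_index n N) W).
Proof.
rewrite (expand_det_col _ i) mxE; apply: eq_bigr => l _.
rewrite !mxE ffunE eqxx mulrC; congr (_ * (_ * \det _)).
by apply/matrixP => a b; rewrite !mxE ffunE eq_sym (negPf (neq_lift _ _)).
Qed.

(** When the minor [f] is nonzero, [\adj (W_f) *m W] has the same rows as [W]
    up to a change of basis, and its entries are Pluecker coordinates. *)
Lemma plucker_rowspace W W' mu : row_free W -> mu != 0 ->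
  plucker W = mu *: plucker W' -> (W :=: W')%MS.
Proof.
move=> fW mu0 E; have Ef f : \det (colsub f W) = mu * \det (colsub f W').
  by have /rowP/(_ (enum_rank f)) := E; rewrite !mxE enum_rankK.
have [f df] := row_free_minor fW.
have df' : \det (colsub f W') != 0 by apply: contraNneq df => d0; rewrite Ef d0 mulr0.
have adjE (V : 'M[k]_(n.+1, N.+1)) : \det (colsub f V) != 0 ->
    (\adj (colsub f V) *m V :=: V)%MS.
  move=> dV; apply: eqmxMfull; rewrite row_full_unit unitmxE.
  have /(congr1 determinant) := mul_adj_mx (colsub f V).
  rewrite det_mulmx det_scalar => H; apply: contraLR (dV); rewrite unitfE negbK => /eqP a0.
  by move/eqP: H; rewrite a0 mul0r eq_sym expf_eq0 => /andP[_ ->].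
apply: eqmx_trans (eqmx_sym (adjE _ df)) _; apply: eqmx_trans (adjE _ df').
have -> : \adj (colsub f W) *m W = mu *: (\adj (colsub f W') *m W').
  by apply/matrixP => i j; rewrite [RHS]mxE !adj_colsub Ef.
exact: eqmx_scale.
Qed.

(** One row at a time: as long as the matrix is not square some [v] is
    orthogonal to its rows, and the next row is an element of [S] not
    orthogonal to [v]. *)
Lemma complete_rows p (S : 'rV[k]_p -> Prop) :
  forall d m (A : 'M[k]_(m, p)), row_free A -> (m + d = p)%N ->
  (forall v : 'rV[k]_p, (forall r, S r -> r *m v^T = 0) -> A *m v^T = 0 -> v = 0) ->
  exists2 Z : 'M[k]_p, Z \in unitmx &
    (forall (i : 'I_p) (j : 'I_m), val i = val j -> row i Z = row j A) /\
    (forall i : 'I_p, (m <= i)%N -> S (row i Z)).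
Proof.
elim=> [|d IH] m A fA md HS.
  rewrite addn0 in md; subst m; exists A; first by rewrite -row_free_unit.
  by split=> [i j /val_inj->|i] //; rewrite leqNgt ltn_ord.
have [v v0 Av] : exists2 v : 'rV[k]_p, v != 0 & A *m v^T = 0.
  have : kermx A^T != 0.
    rewrite kermx_eq0 /row_free mxrank_tr; move: fA => /eqP->.
    by rewrite -md -addSnnS neq_ltn leq_addr.
  move=> /rowV0Pn[v /sub_kermxP Hv v0]; exists v => //.
  by apply: trmx_inj; rewrite trmx_mul trmxK Hv trmx0.
have [r Sr rv] : exists2 r, S r & r *m v^T != 0.
  apply: contrapT => H; case/negP: v0; apply/eqP/HS => // r Sr.
  by apply: contrapT => /eqP rv; apply: H; exists r.
have [||v' H1 /eqP|Z uZ [Z1 Z2]] := IH (m + 1)%N (col_mx A r).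
- apply: inj_row_free => w; rewrite -[w]hsubmxK mul_row_col.
  set w1 := lsubmx w; set w2 := rsubmx w => Hw.
  have : (w1 *m A + w2 *m r) *m v^T = 0 by rewrite Hw mul0mx.
  rewrite mulmxDl -!mulmxA Av mulmx0 add0r [w2]mx11_scalar mul_scalar_mx.
  move/eqP; rewrite scaler_eq0 (negPf rv) orbF => /eqP w20.
  move: Hw; rewrite [w2]mx11_scalar w20 mul_scalar_mx scale0r addr0 => Hw.
  have -> : w1 = 0 by apply: (row_free_inj fA); rewrite Hw mul0mx.
  by rewrite mxE mul0rn raddf0 row_mx0.
- by rewrite -addnA add1n.
- by rewrite mul_col_mx col_mx_eq0 => /andP[/eqP A0 _]; exact: HS.
exists Z => //; split=> [i j ij|i].
  rewrite (Z1 i (lshift 1 j)) //.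
  by apply/rowP => l; rewrite !mxE (unsplitK (inl _)).
rewrite leq_eqVlt => /orP[/eqP mi|mi]; last by apply: Z2; rewrite addn1.
rewrite (Z1 i (rshift m ord0)) /= ?addn0 //.
suff -> : row (rshift m ord0) (col_mx A r) = r by [].
by apply/rowP => l; rewrite !mxE (unsplitK (inr _)) ord1.
Qed.

End PluckerDetermines.

Section Continuity.
Variables (k : closedFieldType) (n N : nat) (M : zmodType).
Variables (co : {additive M -> 'rV[int]_n}) (co_bij : bijective co).
Variables (u : 'I_N.+1 -> M).
Hypothesis Aff_A : forall x : M, Aff (family_set u) x.
Implicit Types (x v : 'rV[k]_N.+1) (a b : 'X_{1..N.+1}) (nu : k) (t : M -> k).
Local Notation char := (torus_point (k := k) (@full M)).
Local Notation X := (toric_variety (k := k) u).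
Local Notation pidx := (plucker_index n N).

(** The gradient of the monomial [a]. *)
Definition pgrad a : 'rV[{mpoly k[N.+1]}]_N.+1 :=
  \row_i ((a i)%:R *: 'X_[a - U_(i)]).

Lemma pgradE x v a : map_mx (meval (x ord0)) (pgrad a) *m v^T = (dmon x v a)%:M.
Proof.
rewrite [LHS]mx11_scalar; congr _%:M; rewrite mxE; apply: eq_bigr => i _.
by rewrite !mxE mevalZ mevalX.
Qed.

(** Near a smooth point [x] the tangent space is cut out by finitely many
    binomials; Cramer's rule then writes its Pluecker coordinates as
    polynomials, so a form that vanishes on the image of the torus also
    vanishes at the image of [x]. This is needed because the Gauss map is
    defined at all smooth points, some of which may lie on the boundary. *)
Lemma gauss_vanish (Q : {mpoly k[#|pidx|]}) d : Q \is d.-homog ->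
  (forall nu t, nu != 0 -> char t -> ev Q (gform co u (nu *: phi u t)) = 0) ->
  forall x y, gauss n X x y -> ev Q y = 0.
Proof.
move=> hQ HQ x y [Xx [W [fW HW ->]]].
have [f df] := row_free_minor fW.
pose A : 'M[k]_(n.+1, N.+1) := \matrix_i delta_mx 0 (f i).
have AE v i : (A *m v^T) i 0 = v 0 (f i).
  rewrite mxE (bigD1 (f i)) //= !mxE !eqxx mul1r big1 ?addr0 // => j ji.
  by rewrite !mxE eqxx (negPf ji) mul0r.
have WA : W *m A^T = colsub f W.
  apply/matrixP => i j; rewrite mxE (bigD1 (f j)) //= !mxE !eqxx mulr1 big1 ?addr0 //.
  by move=> l lj; rewrite !mxE eqxx (negPf lj) mulr0.
have uf : colsub f W \in unitmx by rewrite unitmxE unitfE.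
have fA : row_free A.
  rewrite /row_free -mxrank_tr eqn_leq rank_leq_col /=.
  have : row_full (W *m A^T) by rewrite WA row_full_unit.
  by rewrite -col_leq_rank => /leq_trans->//; exact: mxrankM_maxr.
have nN : (n.+1 <= N.+1)%N by have := rank_leq_col A; move: fA => /eqP->.
pose S (r : 'rV[k]_N.+1) := exists a b, meq u a b /\
  r = map_mx (meval (x ord0)) (pgrad a - pgrad b).
have [|v Sv Av|Z uZ [Z1 Z2]] := @complete_rows k N.+1 S (N.+1 - n.+1) n.+1 A fA.
- by rewrite subnKC.
- have : tangent X x v.
    apply/(tangentP co_bij) => a b ab; apply/eqP; rewrite -subr_eq0; apply/eqP.
    have := Sv _ (ex_intro _ a (ex_intro _ b (conj ab erefl))).
    rewrite map_mxB mulmxBl !pgradE -raddfB => /matrixP/(_ 0 0).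
    by rewrite !mxE eqxx.
  move=> /HW/submxP[g Eg]; move/(congr1 trmx): Av.
  rewrite trmx_mul trmxK trmx0 Eg -mulmxA WA => /(canRL (mulmxK uf)) ->.
  by rewrite mul0mx mul0mx.
have /fin_all_exists[ab Hab] (i : 'I_N.+1) : exists ab : 'X_{1..N.+1} * 'X_{1..N.+1},
    (n < i)%N -> meq u ab.1 ab.2 /\
      row i Z = map_mx (meval (x ord0)) (pgrad ab.1 - pgrad ab.2).
  case: (ltnP n i) => [/Z2[a [b H]]|_]; first by exists (a, b).
  by exists (0%MM, 0%MM).
pose w := widen_ord nN.
(* The rows are those of [A], and gradients of binomials that vanish on the
   tangent space: a tangent vector is determined by its coordinates [f]. *)
pose Zp : 'M[{mpoly k[N.+1]}]_N.+1 := \matrix_i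
  if insub (val i) is Some j then map_mx (@mpolyC N.+1 k) (row j A)
  else pgrad (ab i).1 - pgrad (ab i).2.
pose Wp : 'M[{mpoly k[N.+1]}]_(n.+1, N.+1) := \matrix_(i, j) (\adj Zp) j (w i).
have evZ x' : map_mx (meval (x' ord0)) Zp = \matrix_i
    if insub (val i) is Some j then row j A
    else map_mx (meval (x' ord0)) (pgrad (ab i).1 - pgrad (ab i).2).
  apply/row_matrixP => i; rewrite -map_row !rowK; case: insubP => [j _ _|//].
  by apply/rowP => l; rewrite !mxE mevalC.
have evZx : map_mx (meval (x ord0)) Zp = Z.
  rewrite evZ; apply/row_matrixP => i; rewrite rowK.
  case: insubP => [j _ ij|ni]; first by rewrite (Z1 i j).
  by have [|_ ->] := Hab i; rewrite // ltnNge.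
pose W' x' := map_mx (meval (x' ord0)) Wp.
pose dZ x' := (\det Zp).@[x' ord0].
have dZE x' : dZ x' = \det (map_mx (meval (x' ord0)) Zp) by rewrite det_map_mx.
(* wherever [\det Zp] does not vanish, [Wp] computes the tangent space *)
have key x' y' : dZ x' != 0 -> gauss n X x' y' ->
    exists2 c, c != 0 & y' = c *: plucker (W' x').
  move=> dx [Xx' [V [fV HV ->]]]; set Z' := map_mx (meval (x' ord0)) Zp.
  have VW : (V <= W' x')%MS.
    apply/row_subP => i; move: (row_sub i V); set v := row i V => /HV.
    move=> /(tangentP co_bij) Tv.
    have Zv l : (Z' *m v^T) l 0 = if insub (val l) is Some j then v 0 (f j) else 0.
      have -> : (Z' *m v^T) l 0 = (row l Z' *m v^T) 0 0 by rewrite -row_mul [RHS]mxE.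
      rewrite /Z' evZ rowK; case: insubP => [j _ _|nl].
        by rewrite -row_mul [LHS]mxE AE.
      have [|mab _] := Hab l; first by rewrite ltnNge.
      rewrite map_mxB mulmxBl !pgradE -raddfB (Tv _ _ mab) subrr.
      by rewrite mxE mul0rn.
    have Ev : dZ x' *: v^T = \adj Z' *m (Z' *m v^T).
      by rewrite mulmxA mul_adj_mx mul_scalar_mx dZE.
    suff : (dZ x' *: v <= W' x')%MS by rewrite (eqmx_scale _ dx).
    apply/submxP; exists (\row_j v 0 (f j)); apply: trmx_inj.
    rewrite linearZ /= Ev trmx_mul; apply/matrixP => l c; rewrite ord1 {c}.
    rewrite [LHS]mxE [RHS]mxE (bigID (fun l' : 'I_N.+1 => (l' < n.+1)%N)) /=.
    rewrite [X in _ + X]big1 ?addr0; last first.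
      by move=> l' nl; rewrite Zv insubF ?mulr0 //; apply: negbTE.
    rewrite (big_ord_narrow nN) /=.
    apply: eq_bigr => j _; rewrite Zv.
    have -> : insub (val (widen_ord nN j)) = Some j by rewrite valK.
    by rewrite !mxE -cofactor_map_mx.
  have /submxP[P EP] := VW; exists (\det P); last by rewrite EP pluckerM.
  rewrite -unitfE -unitmxE -row_free_unit -row_leq_rank.
  by apply: leq_trans (mxrankM_maxl P (W' x')); rewrite -EP row_leq_rank.
pose T := [tuple \det (colsub (enum_val j : pidx) Wp) | j < #|pidx|].
have evT x' : ev (Q \mPo T) x' = ev Q (plucker (W' x')).
  rewrite /ev comp_mpoly_meval; apply: meval_eq => j.
  rewrite tnth_mktuple mxE -det_map_mx; congr (\det _).
  by apply/matrixP => a b; rewrite !mxE.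
have dx : dZ x != 0 by rewrite dZE evZx -unitfE -unitmxE.
have [|c c0 Ec] := key x (plucker W) dx; first by split=> //; exists W.
suff : ev ((Q \mPo T) * \det Zp) x = 0.
  rewrite evM evT => /eqP; rewrite mulf_eq0 (negPf dx) orbF => /eqP QW.
  by rewrite Ec (ev_homog _ _ hQ) QW mulr0.
have /(toricP co_bij)[_ Hx] := Xx.
apply: (cone_vanish co_bij) Hx => nu t nu0 ct; rewrite evM evT.
set x' := nu *: phi u t; have [dx'|dx'] := eqVneq (dZ x') 0.
  by rewrite -/(dZ x') [X in _ * X]dx' mulr0.
have [|c' c'0 Ec'] := key x' (gform co u x') dx'.
  apply/(gauss_unit co_bij Aff_A).
  - by move=> i; exact: cone_neq0.
  - exact: toric_eq_cone.
  by exists 1; rewrite ?oner_neq0 ?scale1r.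
have := HQ nu t nu0 ct; rewrite -/x' Ec' (ev_homog _ _ hQ) => /eqP.
by rewrite mulf_eq0 expf_eq0 (negPf c'0) andbF => /eqP->; rewrite mul0r.
Qed.

End Continuity.

(** * Boundary points of the fibers *)

Section ToricExtend.
Variables (k : closedFieldType) (n : nat) (M : zmodType).
Variables (co : {additive M -> 'rV[int]_n}) (co_bij : bijective co).
Local Notation char := (torus_point (k := k) (@full M)).

(** Points in the boundary of a toric variety are the points of tori of smaller
    rank; their coordinates extend to characters of [M] by [char_extend]. *)
Lemma toric_extend m (w : 'I_m -> M) (Y : 'rV[k]_m) : Y != 0 ->
  (forall a b, meq w a b -> mon Y a != 0 -> mon Y b != 0 -> mon Y a = mon Y b) ->
  exists mu t, [/\ mu != 0, char t & forall j, Y 0 j != 0 -> Y 0 j = mu * t (w j)].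
Proof.
move=> /eqP/rowP/existsNP[j1]; rewrite mxE => /eqP Yj1 HY.
pose s j := if Y 0 j != 0 then j else j1.
have sY j : Y 0 (s j) != 0 by rewrite /s; case: ifP.
(* the monomials in the coordinates [s j], written in all coordinates *)
pose mm (a : 'X_{1..m}) := (\sum_j U_(s j) *+ a j)%MM.
have mon_mm a : mon Y (mm a) = \prod_j Y 0 (s j) ^+ a j.
  rewrite /mm (big_morph _ (monD Y) (_ : _ = 1)).
    by apply: eq_bigr => j _; rewrite monMn monU.
  by rewrite /mon big1 // => i _; rewrite mnmE.
have mdeg_mm a : mdeg (mm a) = mdeg a.
  rewrite /mm mdeg_sum mdegEo; apply: eq_bigr => j _.
  by rewrite mdegMn mdeg1 mul1n.
have wt_mm a : wt w (mm a) = wt (fun j => w (s j)) a.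
  rewrite /mm (big_morph _ (@wtD _ _ w) (_ : _ = 0)).
    by apply: eq_bigr => j _; rewrite wtMn wtU.
  by rewrite /wt big1 // => i _; rewrite mnmE.
have nz a : mon Y (mm a) != 0.
  by rewrite mon_mm; apply/prodf_neq0 => j _; rewrite expf_neq0.
have [||mu [t [mu0 ct Ht]]] := @char_extend k n M co co_bij 'I_m (fun j => w (s j)) (fun j =>
  Y 0 (s j)).
- by move=> j; exact: sY.
- move=> c c0 wc; have [a [b [[ed ew] Ec]]] := relation_split c0 wc.
  have := HY (mm a) (mm b) _ (nz a) (nz b).
  rewrite /meq !mdeg_mm !wt_mm => /(_ (conj ed ew)) Eab.
  under eq_bigr => j _ do rewrite Ec expfzDr //.
  rewrite big_split /=; under [X in _ * X]eq_bigr => j _ do rewrite -invr_expz.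
  rewrite prodfV -[X in X / _]mon_mm -[X in _ / X]mon_mm Eab mulfV //.
exists mu, t; split=> // j Yj; have := Ht j.
by rewrite /s Yj.
Qed.

End ToricExtend.

Section Boundary.
Variables (k : closedFieldType) (n N : nat) (M : zmodType).
Variables (co : {additive M -> 'rV[int]_n}) (co_bij : bijective co).
Variables (u : 'I_N.+1 -> M).
Hypothesis Aff_A : forall x : M, Aff (family_set u) x.
Implicit Types (x v : 'rV[k]_N.+1) (a b : 'X_{1..N.+1}) (nu : k) (t : M -> k).
Local Notation char := (torus_point (k := k) (@full M)).
Local Notation X := (toric_variety (k := k) u).
Local Notation pidx := (plucker_index n N).
Local Notation Uk := (Uk k co u).
Local Notation wt := (wt u).
Local Notation meq := (meq u).

Definition mulv (y v : 'rV[k]_N.+1) : 'rV[k]_N.+1 := \row_i (y 0 i * v 0 i).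
Definition one_point : 'rV[k]_N.+1 := const_mx 1.
(** The part of [v] along the support of [y]. *)
Definition mask (y v : 'rV[k]_N.+1) : 'rV[k]_N.+1 :=
  \row_i (if y 0 i != 0 then v 0 i else 0).

Lemma mon_mulv y x a : mon (mulv y x) a = mon y a * mon x a.
Proof. by rewrite -big_split; apply: eq_bigr => i _; rewrite mxE exprMn. Qed.

Lemma mon_one a : mon one_point a = 1.
Proof. by rewrite /mon big1 // => i _; rewrite mxE expr1n. Qed.

Lemma dmon_one v a : dmon one_point v a = \sum_i (a i)%:R * v 0 i.
Proof. by apply: eq_bigr => i _; rewrite mon_one mulr1. Qed.

Lemma dmonD x v v' a : dmon x (v + v') a = dmon x v a + dmon x v' a.
Proof. by rewrite -big_split; apply: eq_bigr => i _; rewrite mxE mulrDr. Qed.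

Lemma dmon_scale x c v a : dmon x (c *: v) a = c * dmon x v a.
Proof. by rewrite mulr_sumr; apply: eq_bigr => i _; rewrite mxE mulrCA. Qed.

Lemma dmon_mulv y x v a : dmon (mulv y x) (mulv y v) a = mon y a * dmon x v a.
Proof.
rewrite mulr_sumr; apply: eq_bigr => i _.
have [->|ai] := eqVneq (a i) 0%N; first by rewrite !mul0r mulr0.
by rewrite mon_mulv mxE (mon_subU _ ai); ring.
Qed.

Lemma dmon_mask x v a :
  dmon x (mask x v) a = if mon x a != 0 then dmon x v a else 0.
Proof.
case: ifP => [xa|/negbT/negPn/eqP xa].
  apply: eq_bigr => i _; rewrite mxE.
  have [->|ai] := eqVneq (a i) 0%N; first by rewrite !mul0r.
  case: ifP => // /negbT/negPn/eqP xi; move: xa.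
  by rewrite (mon_subU _ ai) xi mulr0 eqxx.
rewrite /dmon big1 // => i _; rewrite mxE.
have [->|ai] := eqVneq (a i) 0%N; first by rewrite !mul0r.
case: ifP => [xi|_]; last by rewrite mulr0.
move: xa; rewrite (mon_subU _ ai) => /eqP; rewrite mulf_eq0 (negPf xi) orbF.
by move=> /eqP->; rewrite mulr0 mul0r.
Qed.

Section Core.
Variable x : 'rV[k]_N.+1.
Hypothesis Hx : toric_eq u x.
Hypothesis Tx : forall v, tangent X x v <-> tangent X one_point v.

Lemma tangent_mask v : tangent X x v -> tangent X x (mask x v).
Proof.
move=> /(tangentP co_bij) Tv; apply/(tangentP co_bij) => a b ab.
by rewrite !dmon_mask (Hx ab) (Tv _ _ ab).
Qed.

Lemma tangent_mul v : tangent X one_point v -> tangent X x (mulv x v).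
Proof.
move=> /(tangentP co_bij) Tv; apply/(tangentP co_bij) => a b ab.
have E y : dmon x (mulv x v) y = mon x y * dmon one_point v y.
  rewrite -dmon_mulv; congr (dmon _ _ _); apply/rowP => i.
  by rewrite !mxE mulr1.
by rewrite !E (Hx ab) (Tv _ _ ab).
Qed.

Variables (nu : k) (t : M -> k).
Hypotheses (nu0 : nu != 0) (ct : char t).
Hypothesis xt : forall i, x 0 i != 0 -> x 0 i = nu * t (u i).

Lemma mon_supp a : mon x a != 0 -> mon x a = nu ^+ mdeg a * t (wt a).
Proof.
move=> xa; rewrite -(mon_cone _ _ _ ct); apply: eq_bigr => i _.
have [->|ai] := eqVneq (a i) 0%N; first by rewrite !expr0.
rewrite !mxE xt //; apply: contraNneq xa => xi.
by rewrite mon_eq0; apply/existsP; exists i; rewrite xi eqxx.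
Qed.

Definition off_support v := forall i, x 0 i != 0 -> v 0 i = 0.

(** Some [a - U_(i)] is supported on the support of [x], while [i] is not in
    it: so [a] has degree one in the coordinates off the support, and no other
    term of the two derivatives survives. *)
Lemma dmon_off v a : off_support v -> dmon x v a != 0 ->
  exists i, [/\ a i != 0%N, mon x (a - U_(i))%MM != 0 & forall v', off_support v' ->
    dmon x v' a = mon x (a - U_(i))%MM * v' 0 i /\ dmon one_point v' a = v' 0 i].
Proof.
move=> v0 /eqP nz.
have [i Hi] : exists i, (a i)%:R * mon x (a - U_(i))%MM * v 0 i != 0.
  apply: contrapT => H; apply: nz; rewrite /dmon big1 // => i _.
  by apply: contrapT => /eqP ne; apply: H; exists i.
move: Hi; rewrite !mulf_eq0 !negb_or => /andP[/andP[ai xai] vi].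
have xi : x 0 i = 0 by apply: contraNeq vi => xi; rewrite v0.
have ai0 : a i != 0%N by apply: contraNneq ai => ->.
exists i; split=> // v' v'0.
have sub l : (a l != (l == i))%N -> x 0 l != 0.
  move=> al; apply/eqP => xl; case/negP: xai; rewrite mon_eq0; apply/existsP; exists l.
  rewrite xl eqxx /= mnmBE mnm1E [i == l]eq_sym; have [li|li] := eqVneq l i.
    by rewrite li eqxx in al *; rewrite subn_eq0 -ltnNge ltn_neqAle eq_sym al lt0n.
  by move: al; rewrite (negPf li) subn0.
have ai1 : a i = 1%N.
  by apply/eqP; apply: contraT => H; have := sub i; rewrite eqxx xi eqxx => /(_ H).
have other l : l != i -> (a l)%:R * mon x (a - U_(l))%MM * v' 0 l = 0 /\ (a l)%:R * v' 0 l = 0.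
  move=> li; have [->|al] := eqVneq (a l) 0%N; first by rewrite !mul0r.
  by rewrite v'0 ?mulr0 //; apply: sub; rewrite (negPf li).
rewrite dmon_one /dmon; split; rewrite (bigD1 i) //= ai1 mul1r big1 ?addr0 //.
  by move=> l li; case: (other l li).
by move=> l li; case: (other l li).
Qed.

(** The tangent space at [x], equal to the one at the unit point, is the direct
    sum of its part along the support of [x] and of its part off the support.
    On the former, multiplying by [x] sends the tangent space at the unit point
    to the one at [x]; on the latter, by [dmon_off], the equations of the
    tangent space at [x] are those at the unit point twisted by [t]. *)
Lemma tangent_char v : tangent X one_point v ->
  tangent X one_point (mulv (phi u t) v).
Proof.
move=> Tv; have Tv' := proj2 (Tx _) Tv.
have Tm := tangent_mask Tv'.
have E : v = mask x v + (v - mask x v) by rewrite addrC subrK.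
have To : tangent X x (v - mask x v).
  apply/(tangentP co_bij) => a b ab.
  rewrite -scaleN1r !dmonD !dmon_scale.
  by rewrite (proj1 (tangentP co_bij u _ _) Tv' _ _ ab) (proj1 (tangentP co_bij u _ _) Tm _ _
    ab).
have off : off_support (v - mask x v).
  by move=> i xi; rewrite !mxE xi subrr.
have H1 : tangent X one_point (mulv (phi u t) (v - mask x v)).
  apply/Tx/(tangentP co_bij) => a b ab.
  have Txab := proj1 (tangentP co_bij u _ _) To _ _ ab.
  have T1ab := proj1 (tangentP co_bij u _ _) (proj1 (Tx _) To) _ _ ab.
  have offt : off_support (mulv (phi u t) (v - mask x v)).
    by move=> i xi; rewrite mxE off // mulr0.
  have zero c : dmon x (v - mask x v) c = 0 ->
      dmon x (mulv (phi u t) (v - mask x v)) c = 0.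
    move=> z; apply: contrapT => /eqP nz; have [i [_ m0 H]] := dmon_off offt nz.
    have [Ht _] := H _ offt; have [H0 _] := H _ off.
    move/eqP: z; rewrite H0 mulf_eq0 (negPf m0) => /eqP vi.
    by move: nz; rewrite Ht mxE vi !mulr0 eqxx.
  have [z|nz] := eqVneq (dmon x (v - mask x v) a) 0.
    by rewrite !zero // -Txab.
  have value c : dmon x (v - mask x v) c != 0 ->
      dmon x (mulv (phi u t) (v - mask x v)) c =
      nu ^+ (mdeg c).-1 * t (wt c) * dmon one_point (v - mask x v) c.
    move=> /(dmon_off off)[i [ci m0 H]].
    have [-> _] := H _ offt; have [_ ->] := H _ off.
    have -> : t (wt c) = t (wt (c - U_(i))%MM) * t (u i).
      by rewrite -charD // -(wtU u i) -wtD submK // lep1mP.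
    have -> : (mdeg c).-1 = mdeg (c - U_(i))%MM.
      by rewrite -{1}(submK (m := U_(i)) (m' := c)) ?lep1mP // mdegD mdeg1 addn1.
    rewrite mon_supp // [mulv _ _ 0 i]mxE [phi _ _ 0 i]mxE; ring.
  have nz' : dmon x (v - mask x v) b != 0 by rewrite -Txab.
  by rewrite !value // T1ab; case: ab => -> ->.
have H2 : tangent X one_point (mulv (phi u t) (mask x v)).
  have /tangent_mul /Tx /(tangentP co_bij) H := proj1 (Tx _) Tm.
  have -> : mulv (phi u t) (mask x v) = nu^-1 *: mulv x (mask x v).
    apply/rowP => i; rewrite !mxE; case: ifP => [xi|_]; last by rewrite !mulr0.
    by rewrite xt // mulrA mulrA mulVf // mul1r.
  by apply/(tangentP co_bij) => a b ab; rewrite !dmon_scale (H _ _ ab).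
have -> : mulv (phi u t) v =
    mulv (phi u t) (mask x v) + mulv (phi u t) (v - mask x v).
  by apply/rowP => i; rewrite !mxE -mulrDr addrCA subrr addr0.
apply/(tangentP co_bij) => a b ab; rewrite !dmonD.
by rewrite (proj1 (tangentP co_bij u _ _) H1 _ _ ab) (proj1 (tangentP co_bij u _ _) H2 _ _ ab).
Qed.

(** By [tangent_char], [t] stabilizes the tangent space at the unit point, so
    it multiplies all its Pluecker coordinates by the same factor, a
    determinant. *)
Lemma char_const_on_B (f g : pidx) :
  pcoef k co u f != 0 -> pcoef k co u g != 0 ->
  t (vertex_sum u f) = t (vertex_sum u g).
Proof.
have T1 v : tangent X one_point v <-> (v <= Uk)%MS.
  rewrite (tangent_unit co_bij Aff_A).
  - rewrite (_ : diag_mx one_point = 1%:M) ?mulmx1 //.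
    by apply/matrixP => i j; rewrite !mxE.
  - by move=> i; rewrite mxE oner_eq0.
  - by move=> a b _; rewrite !mon_one.
have /submxP[P EP] : (Uk *m diag_mx (phi u t) <= Uk)%MS.
  apply/row_subP => i; apply/T1.
  have -> : row i (Uk *m diag_mx (phi u t)) = mulv (phi u t) (row i Uk).
    by apply/rowP => j; rewrite mul_mx_diag !mxE mulrC.
  by apply/tangent_char/T1; exact: row_sub.
have Pf h : pcoef k co u h != 0 -> t (vertex_sum u h) = \det P.
  move=> ch; apply: (mulfI ch); have := congr1 (@plucker k n N) EP.
  rewrite pluckerM plucker_Uk => /rowP/(_ (enum_rank h)).
  by rewrite !mxE enum_rankK mon_phi // wt_fmon [\det P * _]mulrC.
by move=> /Pf-> /Pf->.
Qed.

End Core.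
End Boundary.

(** * Irreducible components *)

Section Components.
Variables (k : closedFieldType) (m : nat).
Implicit Types (Y Z C : 'rV[k]_m -> Prop) (P Q : {mpoly k[m]}).

(** Irreducibility of the closure of [C] inside any set of points, tested on
    forms. *)
Definition form_irreducible C : Prop := (exists x, C x) /\
  forall d e P Q, P \is d.-homog -> Q \is e.-homog -> vanishes C (P * Q) ->
    vanishes C P \/ vanishes C Q.

Lemma sub_zclosure C x : x != 0 -> C x -> zclosure C x.
Proof. by move=> x0 Cx; split=> // d P _; apply. Qed.

(** If [C1] and [C2] cover the closure and neither contains it, the product of
    a form of [C1] and of a form of [C2] not vanishing on [C] contradicts
    [form_irreducible]. *)
Lemma zirreducible_closure Z C : (forall x, Z x -> x != 0) ->
  (forall x, C x -> Z x) -> form_irreducible C ->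
  zirreducible (fun x => Z x /\ zclosure C x).
Proof.
move=> Z0 CZ [[x0 Cx0] irr].
have CY x : C x -> Z x /\ zclosure C x.
  by move=> Cx; split; [exact: CZ|exact/sub_zclosure/Cx/Z0/CZ].
split=> [|C1 C2 [S1 [hS1 E1]] [S2 [hS2 E2]] cov]; first by exists x0; exact: CY.
have out (C' : 'rV[k]_m -> Prop) S : (forall P, S P -> exists d, P \is d.-homog) ->
    (forall x, C' x <-> x != 0 /\ forall P, S P -> ev P x = 0) ->
    ~ (forall x, Z x /\ zclosure C x -> C' x) ->
    exists d P, [/\ P \is d.-homog, S P & ~ vanishes C P].
  move=> hS ES /existsNP[x /not_implyP[[Zx Hx] nCx]].
  have /existsNP[P /not_implyP[SP nP]] : ~ forall P, S P -> ev P x = 0.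
    by move=> H; apply/nCx/ES; split=> //; exact: Z0.
  have [d hP] := hS P SP; exists d, P; split=> // VP; apply: nP.
  by case: Hx => _ /(_ d P hP VP).
apply: contrapT => /not_orP[n1 n2].
have [d [P [hP SP nP]]] := out _ _ hS1 E1 n1.
have [e [Q [hQ SQ nQ]]] := out _ _ hS2 E2 n2.
have [|//|//] := irr d e P Q hP hQ.
move=> x /CY/cov[/E1[_ H]|/E2[_ H]]; rewrite evM.
  by rewrite H ?mul0r.
by rewrite [ev Q x]H ?mulr0.
Qed.

Lemma zirreducible_forms Y d e P Q : zirreducible Y -> (forall x, Y x -> x != 0) ->
  P \is d.-homog -> Q \is e.-homog -> vanishes Y (P * Q) ->
  vanishes Y P \/ vanishes Y Q.
Proof.
move=> [_ irr] Y0 hP hQ VPQ.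
pose Zr R : 'rV[k]_m -> Prop := fun x => x != 0 /\ ev R x = 0.
have cl f R : R \is f.-homog -> zclosed (Zr R).
  move=> hR; exists (fun P => P = R); split=> [_ ->|x]; first by exists f.
  by split=> [[x0 Rx]|[x0 H]]; split=> //; [move=> _ ->|exact: H].
have [|H|H] := irr _ _ (cl _ _ hP) (cl _ _ hQ).
- move=> x Yx; have /eqP := VPQ x Yx; rewrite evM mulf_eq0.
  by move=> /orP[] /eqP ?; [left|right]; split=> //; exact: Y0.
- by left=> x /H[].
- by right=> x /H[].
Qed.

(** An irreducible subset lies in one of the finitely many closed sets that
    cover [Z], by the product of forms that separate it from each of them; so
    the maximal ones are these sets. *)
Lemma components_of_cover Z c (C : 'I_c -> 'rV[k]_m -> Prop) :
  (forall x, Z x -> x != 0) -> (forall i x, C i x -> Z x) ->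
  (forall i, form_irreducible (C i)) ->
  (forall x, Z x -> exists i, zclosure (C i) x) ->
  (forall i j, (forall x, C i x -> zclosure (C j) x) -> i = j) ->
  irr_component_count Z c.
Proof.
move=> Z0 CZ irrC cov sep.
pose Y i x := Z x /\ zclosure (C i) x.
have CY i x : C i x -> Y i x.
  by move=> Cx; split; [exact: CZ Cx|exact/sub_zclosure/Cx/Z0/CZ/Cx].
have in_one Y' : (forall x, Y' x -> Z x) -> zirreducible Y' ->
    exists j, forall x, Y' x -> Y j x.
  move=> Y'Z irrY; apply: contrapT => /forallNP H.
  have /fin_all_exists[P HP] j : exists P, [/\ exists d, P \is d.-homog,
      vanishes (C j) P & ~ vanishes Y' P].
    have /existsNP[x /not_implyP[Yx nx]] := H j.
    have : ~ forall d P, P \is d.-homog -> vanishes (C j) P -> ev P x = 0.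
      by move=> Hx; apply: nx; split; [exact: Y'Z|split=> //; exact/Z0/Y'Z].
    move=> /existsNP[d /existsNP[P /not_implyP[hP /not_implyP[VP nP]]]].
    by exists P; split=> //; [exists d|move=> /(_ x Yx)].
  have [[y0 Yy0] _] := irrY.
  suff : exists j, vanishes Y' (P j) by case=> j; case: (HP j).
  have : vanishes Y' (\prod_(j <- enum 'I_c) P j).
    move=> x /Y'Z/cov[j [_ Hj]]; have [[d hP] VP _] := HP j.
    by rewrite (bigD1_seq j) ?enum_uniq ?mem_enum //= evM (Hj d) ?mul0r.
  elim: (enum 'I_c) => [|j s IH].
    by move=> /(_ y0 Yy0); rewrite big_nil /ev meval1 => /eqP; rewrite oner_eq0.
  have [e he] : exists e, \prod_(i <- s) P i \is e.-homog.
    elim: s {IH} => [|i s [e he]]; first by exists 0%N; rewrite big_nil; exact: dhomog1.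
    have [[d hP] _ _] := HP i; exists (d + e)%N; rewrite big_cons.
    exact: dhomogM.
  have [[d hP] _ _] := HP j; rewrite big_cons.
  move=> /(zirreducible_forms irrY (fun x Yx => Z0 x (Y'Z x Yx)) hP he)[H'|/IH//].
  by exists j.
have irrY i : zirreducible (Y i) by apply: zirreducible_closure => //; exact: CZ.
have YZ i x : Y i x -> Z x by case.
have compY i : irr_component Z (Y i).
  split=> // [x|Y' Y'Z irrY' sYY' x Y'x]; first exact: YZ.
  have [j Hj] := in_one Y' Y'Z irrY'.
  suff -> : i = j by exact: Hj.
  by apply: sep => z /CY/sYY'/Hj[].
exists Y; split=> // [i j Eij|Y' [Y'Z irrY' maxY']].
  by apply: sep => x /CY/Eij[].
have [j Hj] := in_one Y' Y'Z irrY'; exists j => x; split; last exact: Hj.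
exact: (maxY' _ (YZ j) (irrY j) Hj).
Qed.

(** Distinct monomials are distinct characters of the torus. *)
Lemma mpoly_torus0 P : (forall x : 'rV[k]_m, (forall i, x 0 i != 0) -> ev P x = 0) -> P = 0.
Proof.
move=> HP; apply/mpolyP => a; rewrite mcoeff0; have [sa|] := boolP (a \in msupp P); last first.
  by rewrite -mcoeff_eq0 => /eqP.
pose T f := exists x : 'rV[k]_m, (forall i, x 0 i != 0) /\ forall b, f b = mon x b.
apply: (@indep_functions k _ T (msupp P) _ _ _ (msupp_uniq P) (fun a => P@_a) _ a sa).
- move=> f g [x [x0 Hf]] [y [y0 Hg]]; exists (\row_i (x 0 i * y 0 i)); split.
    by move=> i; rewrite mxE mulf_neq0.
  move=> b; rewrite Hf Hg -big_split; apply: eq_bigr => i _ /=.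
  by rewrite mxE exprMn.
- move=> b _; exists (fun=> 1); last by rewrite oner_eq0.
  exists (const_mx 1); split=> [i|b']; first by rewrite mxE oner_eq0.
  by rewrite /mon big1 // => i _; rewrite mxE expr1n.
- move=> b b' _ _ /eqP/mnmP/existsNP[i /eqP bi].
  have [z z0 Hz] := expr_sep k bi.
  pose x : 'rV[k]_m := \row_j (if j == i then z else 1).
  have xE c : mon x c = z ^+ c i.
    rewrite /mon (bigD1 i) //= mxE eqxx big1 ?mulr1 // => j /negPf ji.
    by rewrite mxE ji expr1n.
  exists (mon x); last by rewrite !xE.
  by exists x; split=> // j; rewrite mxE; case: ifP; rewrite ?oner_eq0.
move=> f [x [x0 Hf]]; rewrite -[RHS](HP x x0) evE.
by apply: eq_bigr => b _; rewrite Hf.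
Qed.

End Components.

(** * The general fiber of the Gauss map *)

Lemma shift_nonneg (I J : finType) (s : I -> J -> int) :
  exists T : nat, forall i j, 0 <= s i j + T%:Z.
Proof.
exists (\sum_i \sum_j `|s i j|)%N => i j; set T := (\sum_i _)%N.
have : (`|s i j| <= T)%N by rewrite /T (bigD1 i) //= (bigD1 j) //= -addnA leq_addr.
rewrite -lez_nat abszE -subr_ge0 => h; apply: le_trans h _.
by rewrite addrC lerD2r lerNl -normrN ler_norm.
Qed.

Section Cosets.
Variables (k : closedFieldType) (n N : nat) (M : zmodType).
Variables (co : {additive M -> 'rV[int]_n}) (co_bij : bijective co).
Variables (u : 'I_N.+1 -> M) (D : 'I_n -> nat).
Implicit Types (x v : 'rV[k]_N.+1) (a b : 'X_{1..N.+1}) (nu : k) (t : M -> k).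
Local Notation char := (torus_point (k := k) (@full M)).
Local Notation H := (Lat co (zero_or_one D)).
Local Notation wt := (wt u).

(** When [t1] lies in a general fiber of the Gauss map, the closure of this
    cone over an orbit is one of the components of the fiber. *)
Definition coset_cone (t1 : M -> k) : 'rV[k]_N.+1 -> Prop := fun x =>
  exists nu t, [/\ nu != 0, char t, forall h, H h -> t h = 1
    & x = nu *: phi u (fun z => t1 z * t z)].

(** The characters trivial on [H] are those with arbitrary values on the basis
    vectors with divisor 0, and value 1 on the others. *)
Definition free_char (al : 'I_n -> k) : M -> k :=
  char_of co (fun i => if D i == 0%N then al i else 1).

Lemma free_charP al : (forall i, al i != 0) ->
  char (free_char al) /\ forall h, H h -> free_char al h = 1.
Proof.
move=> al0; split.
  by apply: char_ofP => i; case: ifP; rewrite ?oner_eq0.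
move=> h /Lat_zero_or_one Hh; rewrite /free_char /char_of big1 // => i _.
by case: ifP => [/eqP Di|_]; rewrite ?exp1rz // Hh.
Qed.

Lemma char_coords t z (e : 'I_n -> M) : char t -> z = \sum_i e i *~ co z 0 i ->
  t z = \prod_i t (e i) ^ co z 0 i.
Proof.
by move=> ct {1}->; rewrite char_sum //; apply: eq_bigr => i _; rewrite charMz.
Qed.

(** The orbit is a translate of a toric variety, with [M / H] in place of [M];
    so the binomials that hold on it generate its ideal. *)
Lemma coset_zclosure t1 x : char t1 -> x != 0 ->
  (forall a b, mdeg a = mdeg b -> H (wt a - wt b) ->
     mon x a / t1 (wt a) = mon x b / t1 (wt b)) ->
  zclosure (coset_cone t1) x.
Proof.
move=> ct1 x0 Hx; split=> // d P hP VP.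
have [e [He Ee]] := basis_vectors co_bij.
(* the projection to [M / H], lifted to [M] *)
pose rho z := \sum_(i | D i == 0%N) e i *~ co z 0 i.
have rhoE z i : co (rho z) 0 i = if D i == 0%N then co z 0 i else 0.
  exact: (co_combination _ _ _ He).
have rho_char t z : char t -> t (rho z) = free_char (fun i => t (e i)) z.
  move=> ct; rewrite char_sum // /free_char /char_of big_mkcond.
  by apply: eq_bigr => i _; case: ifP => _; rewrite ?charMz // exp1rz.
pose c a := P@_a * t1 (wt a).
rewrite evE; transitivity (\sum_(a <- msupp P) c a * (mon x a / t1 (wt a))).
  by apply: eq_bigr => a _; rewrite /c; field; exact: char_neq0.
pose w a := (mdeg a, rho (wt a)).
apply: (group_sum0 (w := w) (c := c) idfun) => [|a b _ _ [ed ew]]; last first.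
  apply: Hx => //; apply/Lat_zero_or_one => i Di.
  by have := rhoE (wt a) i; rewrite ew rhoE Di eqxx raddfB !mxE => ->; rewrite subrr.
apply: (cone_group co_bij) => nu t nu0 ct /=.
have [|ct' Ht'] := @free_charP (fun i => t (e i)); first by move=> i; exact: char_neq0.
have := VP (nu *: phi u (fun z => t1 z * free_char (fun i => t (e i)) z)).
rewrite evE => E; rewrite -[RHS]E; last by exists nu, (free_char (fun i => t (e i))).
apply: eq_bigr => a _; rewrite mon_cone ?rho_char //= /c; first by ring.
exact: charM.
Qed.

(** The orbit is parametrized by a torus, through monomials that become
    polynomials after a shift by [K]; forms vanish on it when their pullbacks
    are zero, and polynomials have no zero divisors. *)
Lemma coset_irreducible t1 : char t1 -> form_irreducible (coset_cone t1).
Proof.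
move=> ct1; split.
  by exists (1 *: phi u (fun z => t1 z * 1)), 1, (fun=> 1); split; rewrite ?oner_eq0 //;
    exact: char1.
move=> d e P Q hP hQ VPQ.
have [K leK] := shift_nonneg (fun j i => co (u j) 0 i).
(* the shift by [K] is absorbed in the scalar [nu'] of the cone *)
pose mj j : 'X_{1..n} := [multinom (if D i == 0%N then `|(co (u j) 0 i + K%:Z)%R|%N else 0%N)
  | i < n].
pose T := [tuple t1 (u j) *: 'X_[mj j] : {mpoly k[n]} | j < N.+1].
pose nu' (al : 'I_n -> k) := \prod_i (if D i == 0%N then al i ^+ K else 1).
have evT (R : {mpoly k[N.+1]}) (al : 'rV[k]_n) : (forall i, al 0 i != 0) ->
    ev (R \mPo T) al = ev R (nu' (al 0) *: phi u (fun z => t1 z * free_char (al 0) z)).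
  move=> al0; rewrite /ev comp_mpoly_meval; apply: meval_eq => j.
  rewrite tnth_mktuple mevalZ mevalX !mxE mulrCA; congr (_ * _).
  rewrite /nu' /free_char /char_of -big_split; apply: eq_bigr => i _ /=.
  rewrite mnmE; case: ifP => _; last by rewrite expr0 exp1rz mul1r.
  by rewrite exprnP gez0_abs // addrC expfzDr // -exprnP.
have nu'0 (al : 'I_n -> k) : (forall i, al i != 0) -> nu' al != 0.
  by move=> al0; apply/prodf_neq0 => i _; case: ifP; rewrite ?oner_eq0 // expf_neq0.
have [e' [He' Ee']] := basis_vectors co_bij.
have back f (R : {mpoly k[N.+1]}) : R \is f.-homog -> R \mPo T = 0 -> vanishes (coset_cone
  t1) R.
  move=> hR R0 _ [nu [t [nu0 ct Ht ->]]].
  pose al : 'rV[k]_n := \row_i t (e' i).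
  have al0 i : al 0 i != 0 by rewrite mxE char_neq0.
  have tE z : t z = free_char (al 0) z.
    rewrite (char_coords ct (Ee' z)) /free_char /char_of.
    apply: eq_bigr => i _; rewrite mxE; case: ifP => // /negbT Di.
    rewrite Ht // => j; rewrite He' mxE eqxx /zero_or_one.
    by case: (eqVneq j i) => [->|_]; rewrite ?Di ?dvd1z ?dvdz0.
  have : ev (R \mPo T) al = 0 by rewrite R0 /ev meval0.
  rewrite evT // (ev_homog _ _ hR) => /eqP.
  rewrite mulf_eq0 expf_eq0 (negPf (nu'0 _ al0)) andbF /= => /eqP E.
  rewrite (ev_homog _ _ hR) (_ : phi u _ = phi u (fun z => t1 z * free_char (al 0) z)).
    by rewrite E mulr0.
  by apply/rowP => j; rewrite !mxE tE.
have : (P * Q) \mPo T = 0.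
  apply: mpoly_torus0 => al al0; rewrite evT //; apply: VPQ.
  have [ct' Ht'] := free_charP al0.
  by exists (nu' (al 0)), (free_char (al 0)); split=> //; exact: nu'0.
rewrite rmorphM /= => /eqP; rewrite mulf_eq0 => /orP[] /eqP R0; [left|right].
  exact: back hP R0.
exact: back hQ R0.
Qed.

End Cosets.

Section FiberCount.
Variables (k : closedFieldType) (n N : nat) (M : zmodType).
Variables (co : {additive M -> 'rV[int]_n}) (co_bij : bijective co).
Variables (u : 'I_N.+1 -> M).
Hypothesis Aff_A : forall x : M, Aff (family_set u) x.
Implicit Types (x v : 'rV[k]_N.+1) (a b : 'X_{1..N.+1}) (nu : k) (t : M -> k).
Local Notation char := (torus_point (k := k) (@full M)).
Local Notation X := (toric_variety (k := k) u).
Local Notation pidx := (plucker_index n N).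
Local Notation L := (diff_group (Bset k co u)).
Local Notation bs j := (vertex_sum u (enum_val (j : 'I_#|pidx|))).
Local Notation cj j := (pcoef k co u (enum_val (j : 'I_#|pidx|))).

Lemma diff_in_L (j j' : 'I_#|pidx|) : cj j != 0 -> cj j' != 0 -> L (bs j - bs j').
Proof.
move=> c c'; apply: sub_gen; exists (bs j), (bs j'); split=> //.
  by apply/BsetP; exists j.
by apply/BsetP; exists j'.
Qed.

Lemma char_one_on_L t : char t ->
  (forall j j' : 'I_#|pidx|, cj j != 0 -> cj j' != 0 -> t (bs j) = t (bs j')) ->
  forall h, L h -> t h = 1.
Proof.
move=> ct Ht h; apply: (@gen_sub _ _ (fun z => t z = 1)) => [|_ [a [b [/BsetP[j cj ->]
  /BsetP[j' cj' ->] ->]]]].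
  split=> [|x y tx ty]; first exact: char0.
  by rewrite charB // tx ty divr1.
by rewrite charB // (Ht j j') // divff // char_neq0.
Qed.

(** The closure of the image satisfies the binomial equations of [X_B], by
    [gauss_vanish]; outside the coordinate hyperplanes, it is the torus orbit.
    *)
Lemma image_point y : image_closure (gauss n X) y ->
  (forall j : 'I_#|pidx|, cj j != 0 -> y 0 j != 0) ->
  exists mu t0, [/\ mu != 0, char t0 & y = mu *: gform co u (phi u t0)].
Proof.
move=> [y0 Hy] yB.
have van d (Q : {mpoly k[#|pidx|]}) : Q \is d.-homog ->
    (forall nu t, nu != 0 -> char t -> ev Q (gform co u (nu *: phi u t)) = 0) -> ev Q y = 0.
  move=> hQ HQ; apply: (Hy d) => // y' [x Hx].
  exact: (gauss_vanish co_bij Aff_A hQ HQ Hx).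
have gE nu t (j : 'I_#|pidx|) : char t ->
    gform co u (nu *: phi u t) 0 j = cj j * (nu ^+ n.+1 * t (bs j)).
  by move=> ct; rewrite mxE mon_cone // mdeg_fmon wt_fmon.
(* coordinates outside [B] vanish on the image *)
have y_out j : cj j = 0 -> y 0 j = 0.
  move=> c0; suff : ev 'X_j y = 0 by rewrite /ev mevalXU.
  apply: (van 1%N) => [|nu t nu0 ct]; first by rewrite dhomogX /= mdeg1.
  by rewrite /ev mevalXU gE // c0 mul0r.
pose ci : 'rV[k]_#|pidx| := \row_j (cj j)^-1.
pose Y : 'rV[k]_#|pidx| := \row_j ((cj j)^-1 * y 0 j).
have YE j : cj j != 0 -> y 0 j = cj j * Y 0 j by move=> c0; rewrite mxE mulVKf.
have Y0 j : Y 0 j != 0 -> cj j != 0.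
  by apply: contraNneq => c0; rewrite mxE c0 invr0 mul0r.
have monY (a : 'X_{1..#|pidx|}) : mon Y a = mon ci a * mon y a.
  by rewrite -big_split; apply: eq_bigr => i _; rewrite !mxE exprMn.
have [j1 cj1] := exists_spanning k co_bij Aff_A.
have [||mu [t [mu0 ct Ht]]] := @toric_extend k n M co co_bij _ (fun j : 'I_#|pidx| => bs j) Y.
- apply/eqP => /rowP/(_ j1); rewrite !mxE => /eqP.
  by rewrite mulf_eq0 invr_eq0 (negPf cj1) (negPf (yB _ cj1)).
- move=> a b [ed ew] Ya Yb.
  have supp (c : 'X_{1..#|pidx|}) : mon Y c != 0 -> forall j, c j != 0%N -> cj j != 0.
    move=> Yc j cj0; apply: Y0; apply: contraNneq Yc => Yj.
    by rewrite mon_eq0; apply/existsP; exists j; rewrite Yj eqxx.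
  have := van (mdeg a) (mon ci a *: 'X_[a] - mon ci b *: 'X_[b]).
  rewrite evB !evZ !evX -!monY => H; apply/eqP; rewrite -subr_eq0; apply/eqP/H.
    by apply: rpredB; apply: dhomogZ; rewrite dhomogX /= ?ed.
  move=> nu t nu0 ct; rewrite evB !evZ !evX.
  have E (c : 'X_{1..#|pidx|}) : mon Y c != 0 ->
      mon ci c * mon (gform co u (nu *: phi u t)) c =
      (nu ^+ n.+1) ^+ mdeg c * t (wt (fun j : 'I_#|pidx| => bs j) c).
    move=> /supp Hc; rewrite mdegEo -prodrXr char_sum // -!big_split.
    apply: eq_bigr => j _ /=; have [->|cj0] := eqVneq (c j) 0%N.
      by rewrite !expr0 mulr0n char0 // mulr1.
    by rewrite gE // mxE charMn // -!exprMn mulKf ?Hc.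
  by rewrite !E // ed ew subrr.
exists mu, t; split=> //; apply/rowP => j; rewrite mxE -[phi u t]scale1r gE //.
rewrite expr1n mul1r; have [c0|c0] := eqVneq (cj j) 0.
  by rewrite c0 mul0r mulr0 y_out.
rewrite YE // (Ht j) 1?mulrCA // mxE mulf_neq0 ?invr_eq0 //; exact: yB.
Qed.

Lemma tangent_mulv t x v : char t ->
  tangent X (mulv (phi u t) x) (mulv (phi u t) v) <-> tangent X x v.
Proof.
move=> ct; rewrite !(tangentP co_bij); split=> T a b ab.
  have := T a b ab; rewrite !dmon_mulv !mon_phi //; case: ab => _ ->.
  exact/mulfI/char_neq0.
by rewrite !dmon_mulv !mon_phi // (T a b ab); case: ab => _ ->.
Qed.

(** A point [x] of a general fiber may lie on the boundary of [X]. After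
    translation by [t0] its tangent space is the one at the unit point, and on
    its support it agrees with a character, which is trivial on [L] by
    [char_const_on_B]. So is any other character with the same restriction to
    the support; hence [L] is torsion modulo the differences of the [u_i] in
    the support, which relates the support to the monomials with the same
    weight modulo [H]. *)
Lemma fiber_point mu t0 x : mu != 0 -> char t0 ->
  gauss n X x (mu *: gform co u (phi u t0)) ->
  exists xi nu chi, [/\ x = mulv (phi u t0) xi, toric_eq u xi,
    nu != 0, char chi & [/\ forall a, mon xi a != 0 ->
        mon xi a = nu ^+ mdeg a * chi (wt u a),
      forall h, L h -> chi h = 1
    & forall h, L h -> exists2 d, (0 < d)%N &
        exists a b, [/\ mdeg a = mdeg b, wt u a - wt u b = h *+ d,
          mon xi a != 0 & mon xi b != 0]]].
Proof.
move=> mu0 ct0 [/(toricP co_bij)[x0 Hx] [W [fW HW EW]]].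
have p0 i : phi u t0 0 i != 0 by rewrite mxE char_neq0.
have Tx v : tangent X x v <-> tangent X (phi u t0) v.
  rewrite (tangent_unit co_bij Aff_A p0); last first.
    by rewrite -[phi u t0]scale1r; exact: toric_eq_cone.
  rewrite -HW (plucker_rowspace (W' := Uk k co u *m diag_mx (phi u t0)) fW mu0) //.
  by rewrite plucker_Uk EW.
pose xi := mulv (phi u (fun z => (t0 z)^-1)) x.
have Ex : x = mulv (phi u t0) xi.
  by apply/rowP => i; rewrite !mxE mulVKf // char_neq0.
have Hxi : toric_eq u xi.
  move=> a b ab; rewrite !mon_mulv (Hx _ _ ab) !mon_phi; try exact: charV.
  by case: ab => _ ->.
have Txi v : tangent X xi v <-> tangent X (one_point k N) v.
  rewrite -(tangent_mulv _ _ ct0) -Ex Tx -(tangent_mulv (one_point k N) _ ct0).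
  suff -> : mulv (phi u t0) (one_point k N) = phi u t0 by [].
  by apply/rowP => i; rewrite !mxE mulr1.
have xi0 : xi != 0.
  apply: contraNneq x0 => xi0; rewrite Ex xi0; apply/eqP/rowP => i.
  by rewrite !mxE mulr0.
have [|nu [chi [nu0 cchi Hchi]]] := @toric_extend k n M co co_bij _ u xi xi0.
  by move=> a b ab _ _; exact: Hxi.
(* any character that gives [xi] on its support is trivial on [L] *)
have trivial nu' chi' : nu' != 0 -> char chi' ->
    (forall i, xi 0 i != 0 -> xi 0 i = nu' * chi' (u i)) -> forall h, L h -> chi' h = 1.
  move=> nu'0 cchi' Hchi'; apply: char_one_on_L => // j j' c c'.
  exact: (char_const_on_B co_bij Aff_A Hxi Txi nu'0 cchi' Hchi' c c').
exists xi, nu, chi; split=> //; split=> [a xa||h Lh].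
- exact: (mon_supp cchi Hchi xa).
- exact: trivial Hchi.
have [j1 /eqP xj1] : exists j, xi 0 j <> 0.
  by move/eqP/rowP/existsNP: xi0 => [j]; rewrite [X in _ <> X]mxE; exists j.
pose w i := if xi 0 i != 0 then u i - u j1 else 0.
have [|d d0 [c Ec]] := @char_one_saturated k n M co co_bij _ w h.
  move=> t ct Ht.
  have tu i : xi 0 i != 0 -> t (u i) = t (u j1).
    move=> xi_i; have := Ht i; rewrite /w xi_i charB // => E.
    by rewrite -[LHS](divfK (char_neq0 (u j1) ct)) E mul1r.
  have := trivial (nu / t (u j1)) (fun z => chi z * t z) _ (charM cchi ct) _ h Lh.
  rewrite (trivial nu chi) // mul1r; apply.
    by rewrite mulf_neq0 ?invr_eq0 ?char_neq0.
  by move=> i xi_i; rewrite Hchi // tu //; field; exact: char_neq0.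
exists d => //.
(* the coefficient of [u_(j1)] makes the total weight vanish *)
pose c' i := (if xi 0 i != 0 then c i else 0) - (\sum_(l | xi 0 l != 0) c l) *+ (i == j1).
have c'0 : \sum_i c' i = 0.
  rewrite sumrB -big_mkcond /= [X in _ - X](bigD1 j1) //= eqxx mulr1n.
  by rewrite [X in _ - (_ + X)]big1 ?addr0 ?subrr // => i /negPf->.
have wc' : \sum_i u i *~ c' i = h *+ d.
  rewrite Ec /c'; under eq_bigr => i _ do rewrite mulrzBr.
  rewrite sumrB [X in _ - X](bigD1 j1) //= eqxx mulr1n [X in _ - (_ + X)]big1 ?addr0;
    last first.
    by move=> i /negPf->.
  rewrite mulrz_sumr [X in _ - X]big_mkcond -sumrB; apply: eq_bigr => i _.
  by rewrite /w; case: ifP => _; rewrite ?mulrzBl // mulr0z mul0rz subr0.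
have [a [b [ed ew _ Hab]]] := weight_split u c'0.
have supp i : xi 0 i = 0 -> a i = 0%N /\ b i = 0%N.
  move=> xi_i; apply: Hab; rewrite /c' xi_i eqxx /=.
  by have [E|_] := eqVneq i j1; [rewrite -E xi_i eqxx in xj1|rewrite subr0].
exists a, b; split=> //; first by rewrite ew wc'.
  rewrite mon_eq0; apply/existsP => -[i /andP[/eqP/supp[-> _]]]; by rewrite eqxx.
rewrite mon_eq0; apply/existsP => -[i /andP[/eqP/supp[_ ->]]]; by rewrite eqxx.
Qed.

Section Count.
Variables (co' : {additive M -> 'rV[int]_n}) (co'_bij : bijective co').
Variables (D D' : 'I_n -> nat).
Hypothesis LD : forall x : M, L x <-> Lat co' D x.
Local Notation H := (Lat co' (zero_or_one D)).
Hypothesis D'1 : forall i, D i = 0%N -> D' i = 1%N.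
Hypothesis D'D : forall i, (D' i %| D i)%N.
Hypothesis D'k : forall i, (D' i)%:R != 0 :> k.
Hypothesis torsion : forall i (x : k), D i != 0%N -> x ^+ D i = 1 -> x ^+ D' i = 1.

Lemma L_sub_H (h : M) : L h -> H h.
Proof.
move=> /LD Lh; apply/Lat_zero_or_one => i Di.
by have := Lh i; rewrite Di dvd0z => /eqP.
Qed.

Lemma H_torsion : exists2 d, (0 < d)%N & forall h, H h -> L (h *+ d).
Proof.
exists (\prod_i nonzero_factor D i)%N => [|h /Lat_torsion/LD//].
by apply: prodn_gt0 => i; exact: nonzero_factor_gt0.
Qed.

(** The fiber over the image of [t0] consists of the translates of [t0] by the
    characters trivial on [L], and of boundary points. The characters of [H]
    trivial on [L] are given by a root of unity of order dividing [D' i] for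
    each [i], by [torsion]: in characteristic [p] there are no roots of unity
    of order [p], so the [p]-part of [D i] has no effect. Each of them gives
    the closed orbit of a subtorus; these are irreducible, cover the fiber by
    [fiber_point] and [coset_zclosure], and are separated by binomials. *)
Lemma general_fiber_count :
  general_fiber_component_count (gauss n X) (\prod_i D' i)%N.
Proof.
have [e [He Ee]] := basis_vectors co'_bij.
have /fin_all_exists[z pz] i := primitive_root_exists (D'k i).
have D'0 i : (0 < D' i)%N by rewrite lt0n; apply: contraNneq (D'k i) => ->.
have z0 i : z i != 0.
  by apply: contraTneq (D'0 i) => E; have := prim_expr_order (pz i); rewrite E expr0n;
    case: (D' i) => // d /eqP; rewrite eq_sym oner_eq0.
pose J := {dffun forall i : 'I_n, 'I_(D' i)}.
pose tau (a : J) := char_of co' (fun i => z i ^+ a i) : M -> k.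
have ctau (a : J) : char (tau a) by apply: char_ofP => i; rewrite expf_neq0.
have tauL (a : J) h : L h -> tau a h = 1.
  move=> /LD Lh; rewrite /tau /char_of big1 // => i _.
  have /dvdzP[q ->] := Lh i; have /dvdnP[c ->] := D'D i.
  have E1 : (z i ^+ a i) ^+ D' i = 1 by rewrite exprAC (prim_expr_order (pz i)) expr1n.
  by rewrite PoszM mulrC [c%:Z * _]mulrC -mulrA -exprz_exp -exprnP E1 exp1rz.
have tau_e (a : J) i : tau a (e i) = z i ^+ a i.
  rewrite /tau /char_of (bigD1 i) //= He mxE !eqxx expr1z big1 ?mulr1 // => j ji.
  by rewrite mxE eqxx (negPf ji) expr0z.
have eH i : D i != 0%N -> H (e i).
  move=> Di j; rewrite He mxE eqxx /zero_or_one.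
  by case: (eqVneq j i) => [->|_]; rewrite ?Di ?dvd1z ?dvdz0.
(* on [H], a character trivial on [L] is one of the [tau a] *)
have tau_onto chi : char chi -> (forall h, L h -> chi h = 1) ->
    exists a : J, forall h, H h -> chi h = tau a h.
  move=> cchi chiL.
  have /fin_all_exists[a Ha] i : exists a : 'I_(D' i), D i != 0%N -> chi (e i) = z i ^+ a.
    have [Di|Di] := eqVneq (D i) 0%N; first by exists (Ordinal (D'0 i)).
    have : chi (e i) ^+ D i = 1.
      by rewrite -charMn //; apply/chiL/LD; exact: Lat_basis.
    by move=> /(torsion Di) /(prim_rootP (pz i))[l ->]; exists l.
  exists [ffun i => a i] => h /Lat_zero_or_one Hh.
  rewrite (char_coords cchi (Ee h)) /tau /char_of; apply: eq_bigr => i _.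
  have [Di|Di] := eqVneq (D i) 0%N; first by rewrite Hh // !expr0z.
  by rewrite Ha // ffunE.
have <- : #|J| = (\prod_i D' i)%N.
  rewrite card_dep_ffun foldrE big_map -big_enum /=.
  by apply: eq_bigr => i _; rewrite card_ord.
have [j1 cj1] := exists_spanning k co_bij Aff_A.
(* general means: all coordinates in [B] are nonzero *)
pose mB : 'X_{1..#|pidx|} := [multinom nat_of_bool (cj j != 0%R) | j < #|pidx|].
exists (mdeg mB), 'X_[mB]; split.
- by rewrite dhomogX /=.
- exists (gform co u (1 *: phi u (fun=> 1))).
  have c1 : char (fun=> 1) by exact: char1.
  have gE (j : 'I_#|pidx|) : gform co u (1 *: phi u (fun=> 1)) 0 j = cj j.
    by rewrite mxE mon_cone // expr1n !mulr1.
  split; last first.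
    rewrite evX mon_eq0; apply/existsP => -[j]; rewrite gE mnmE.
    by case: (cj j == 0).
  apply: sub_zclosure.
    by apply/eqP => /rowP/(_ j1)/eqP; rewrite gE mxE (negPf cj1).
  exists (1 *: phi u (fun=> 1)); apply/(gauss_unit co_bij Aff_A).
  + by move=> i; rewrite cone_neq0 // oner_eq0.
  + exact: toric_eq_cone.
  by exists 1; rewrite ?oner_neq0 ?scale1r.
move=> y Iy; rewrite evX => yB.
have yj (j : 'I_#|pidx|) : cj j != 0 -> y 0 j != 0.
  move=> c0; apply: contraNneq yB => yj0; rewrite mon_eq0; apply/existsP; exists j.
  by rewrite yj0 eqxx mnmE c0.
have [mu [t0 [mu0 ct0 Ey]]] := image_point Iy yj.
have sgH := sg_Lat co' (zero_or_one D).
have ct0tau (a : J) : char (fun h => t0 h * tau a h) by exact: charM.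
apply: (components_of_cover (C := fun i => coset_cone co' u D (fun h => t0 h * tau (enum_val
  i) h))).
- by move=> x [/(toricP co_bij)[]].
- move=> i x [nu [t [nu0 ct tH ->]]].
  pose t1 h := t0 h * tau (enum_val i) h.
  change (gauss n X (nu *: phi u (fun h => t1 h * t h)) y).
  have ct1 : char (fun h => t1 h * t h) by apply: charM => //; exact: ct0tau.
  apply/(gauss_unit co_bij Aff_A).
  + by move=> l; exact: cone_neq0.
  + exact: toric_eq_cone.
  pose r := tau (enum_val i) (bs j1) * t (bs j1).
  have r0 : r != 0 by rewrite mulf_neq0 // char_neq0.
  exists (mu / (nu ^+ n.+1 * r)).
    by apply: mulf_neq0 => //; rewrite invr_eq0; apply: mulf_neq0 => //; exact: expf_neq0.
  rewrite Ey; apply/rowP => j; rewrite !mxE !mon_cone // -[phi u t0]scale1r.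
  rewrite mon_cone // mdeg_fmon wt_fmon expr1n mul1r.
  have [->|c0] := eqVneq (cj j) 0; first by rewrite !mul0r !mulr0.
  have Lj := diff_in_L c0 cj1.
  have -> : t0 (bs j) = t1 (bs j) * t (bs j) / r.
    have : tau (enum_val i) (bs j - bs j1) * t (bs j - bs j1) = 1.
      by rewrite tauL // tH ?mulr1 //; exact: L_sub_H.
    rewrite !charB // => E; rewrite -[LHS]mulr1 -E /t1 /r; field.
    by rewrite !char_neq0.
  by field; rewrite r0 expf_neq0.
- by move=> i; apply: coset_irreducible.
- move=> x; rewrite Ey => Hx.
  have [xi [nu [chi [Ex Hxi nu0 cchi [xiE chiL sat]]]]] := fiber_point mu0 ct0 Hx.
  have [a Ha] := tau_onto chi cchi chiL.
  exists (enum_rank a); rewrite enum_rankK.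
  case: Hx => /(toricP co_bij)[x0 Tx] _.
  apply: coset_zclosure => // b c ebc Hbc.
  have t0tau d : mon x d / (t0 (wt u d) * tau a (wt u d)) = mon xi d / tau a (wt u d).
    by rewrite Ex mon_mulv mon_phi //; field; rewrite !char_neq0.
  rewrite !t0tau.
  (* a multiple of [wt b' - wt c'] is a difference of weights of monomials in
     the support of [xi], and [xi] satisfies the resulting binomial equation *)
  have supp b' c' : mdeg b' = mdeg c' -> H (wt u b' - wt u c') -> mon xi b' != 0 -> mon xi c'
    != 0.
    move=> ed Hd xb; have [d1 d10 Ld] := H_torsion.
    have [d2 d20 [q [q' [eq ew xq xq']]]] := sat _ (Ld _ Hd).
    have : meq u (b' *+ (d1 * d2) + q')%MM (c' *+ (d1 * d2) + q)%MM.
      split; first by rewrite !mdegD !mdegMn ed eq.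
      rewrite !wtD !wtMn; apply/eqP; rewrite -subr_eq0 opprD addrACA -mulrnBl.
      by rewrite mulrnA -ew -[wt u q' - _]opprB subrr.
    move=> /Hxi; rewrite !monD !monMn => E.
    have : mon xi b' ^+ (d1 * d2) * mon xi q' != 0 by rewrite mulf_neq0 ?expf_neq0.
    by rewrite E mulf_eq0 expf_eq0 muln_gt0 d10 d20 /= negb_or => /andP[].
  have [xb|xb] := eqVneq (mon xi b) 0.
    suff -> : mon xi c = 0 by rewrite xb !mul0r.
    apply: contrapT => /eqP xc; suff : mon xi b != 0 by rewrite xb eqxx.
    by apply: supp xc => //; rewrite -opprB; exact: (sgN sgH).
  have xc := supp b c ebc Hbc xb.
  rewrite (xiE b xb) (xiE c xc) ebc -[LHS]mulrA -[RHS]mulrA; congr (_ * _).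
  have := Ha _ Hbc; rewrite !charB // => E.
  by rewrite -[chi (wt u b)](divfK (char_neq0 (wt u c) cchi)) E; field; rewrite !char_neq0.
move=> i j sij; apply: enum_val_inj; apply/ffunP => l.
have [Dl|Dl] := eqVneq (D l) 0%N.
  apply: val_inj; have := ltn_ord (enum_val i l); have := ltn_ord (enum_val j l).
  rewrite [X in (_ < X)%N -> _]D'1 // [X in _ -> (_ < X)%N -> _]D'1 // !ltnS !leqn0 => /eqP
    Ej /eqP Ei.
  exact: etrans Ei (esym Ej).
(* A binomial of weight [e l] is constant on each orbit, and its value tells
   the roots of unity apart. *)
suff : tau (enum_val i) (e l) = tau (enum_val j) (e l).
  rewrite !tau_e => /eqP; rewrite (eq_prim_root_expr (pz l)) => /eqP.
  by rewrite !modn_small // => /val_inj.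
have [c c0 Ec] := gen_family Aff_A 0 (e l).
have [a [b [ed ew _ _]]] := weight_split u c0.
pose t1 h := t0 h * tau (enum_val j) h.
have ct1 : char t1 by exact: ct0tau.
pose P : {mpoly k[N.+1]} := t1 (wt u b) *: 'X_[a] - t1 (wt u a) *: 'X_[b].
have hP : P \is (mdeg a).-homog.
  by apply: rpredB; apply: dhomogZ; rewrite dhomogX /= ?ed.
have VP : vanishes (coset_cone co' u D t1) P.
  move=> _ [nu [t [nu0 ct tH ->]]]; rewrite evB !evZ !evX !mon_cone; try exact: charM.
  have -> : t (wt u a) = t (wt u b).
    have : t (e l) = 1 by apply/tH/eH.
    rewrite Ec -ew charB // => E.
    by rewrite -[LHS](divfK (char_neq0 (wt u b) ct)) E mul1r.
  by rewrite ed; ring.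
have [|_ /(_ _ P hP VP)] := sij (1 *: phi u (fun h => t0 h * tau (enum_val i) h * 1)).
  by exists 1, (fun=> 1); split; rewrite ?oner_eq0 //; exact: char1.
rewrite scale1r evB !evZ !evX !mon_phi; try by apply: charM => //; exact: char1.
rewrite Ec -ew !charB // /t1 => E.
apply/eqP; rewrite eqr_div ?char_neq0 //; apply/eqP.
have nz : t0 (wt u a) * t0 (wt u b) != 0 by rewrite mulf_neq0 // char_neq0.
apply: (mulfI nz); move/eqP: E; rewrite subr_eq0 => /eqP E.
transitivity (t0 (wt u b) * tau (enum_val j) (wt u b) *
  (t0 (wt u a) * tau (enum_val i) (wt u a) * 1)); first by ring.
by rewrite E; ring.
Qed.

End Count.
End FiberCount.

(** * Subfields *)

Section Subfields.
Variables (K : fieldType) (F : K -> Prop).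
Hypothesis sF : is_subfield F.

Lemma sf1 : F 1. Proof. by case: sF. Qed.
Lemma sfB x y : F x -> F y -> F (x - y). Proof. by case: sF => _ H _; exact: H. Qed.
Lemma sf_div x y : F x -> F y -> F (x / y). Proof. by case: sF => _ _; exact. Qed.
Lemma sf0 : F 0. Proof. by rewrite -(subrr 1); apply: sfB; exact: sf1. Qed.
Lemma sfN x : F x -> F (- x). Proof. by rewrite -sub0r; apply: sfB; exact: sf0. Qed.
Lemma sfD x y : F x -> F y -> F (x + y).
Proof. by move=> Fx Fy; rewrite -[y]opprK; apply/sfB/sfN. Qed.
Lemma sfV x : F x -> F x^-1.
Proof. by rewrite -div1r; apply: sf_div; exact: sf1. Qed.
Lemma sfM x y : F x -> F y -> F (x * y).
Proof. by move=> Fx Fy; rewrite -[y]invrK; apply/sf_div/sfV. Qed.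
Lemma sf_sum (I : Type) (r : seq I) (P : pred I) (G : I -> K) :
  (forall i, P i -> F (G i)) -> F (\sum_(i <- r | P i) G i).
Proof. by move=> H; elim/big_rec: _ => [|i x Pi Fx]; [exact: sf0|apply: sfD => //;
  exact: H]. Qed.
Lemma sf_prod (I : Type) (r : seq I) (P : pred I) (G : I -> K) :
  (forall i, P i -> F (G i)) -> F (\prod_(i <- r | P i) G i).
Proof. by move=> H; elim/big_rec: _ => [|i x Pi Fx]; [exact: sf1|apply: sfM => //;
  exact: H]. Qed.
Lemma sfX x d : F x -> F (x ^+ d).
Proof. by move=> Fx; elim: d => [|d IH]; rewrite ?exprS; [exact: sf1|exact: sfM]. Qed.
Lemma sfXz x (d : int) : F x -> F (x ^ d).
Proof. by move=> Fx; case: d => d; [exact: sfX|rewrite NegzE -exprnN; apply/sfV/sfX]. Qed.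

Definition subfield_pred : {pred K} := fun x => `[< F x >].
Lemma subfield_divring : divring_closed subfield_pred.
Proof.
split; rewrite ?unfold_in; first exact/asboolP/sf1.
  by move=> x y /asboolP Fx /asboolP Fy; apply/asboolP/sfB.
by move=> x y /asboolP Fx /asboolP Fy; apply/asboolP/sf_div.
Qed.
HB.instance Definition _ := GRing.isDivringClosed.Build K subfield_pred subfield_divring.

Record subfield_type := SubfieldType { subfield_val :> K; _ : subfield_val \in subfield_pred }.
HB.instance Definition _ := [isSub for subfield_val].
HB.instance Definition _ := [Choice of subfield_type by <:].
HB.instance Definition _ := [SubChoice_isSubComUnitRing of subfield_type by <:].
HB.instance Definition _ := [SubComUnitRing_isSubIntegralDomain of subfield_type by <:].
HB.instance Definition _ := [SubIntegralDomain_isSubField of subfield_type by <:].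

(** This gives access to linear algebra and to polynomial division over a
    subfield given by a predicate. *)
Lemma subfield_embedding : exists (F0 : fieldType) (j : {rmorphism F0 -> K}),
  forall x, F x <-> exists y, x = j y.
Proof.
exists subfield_type, (val : {rmorphism subfield_type -> K}) => x.
split=> [Fx|[[y Hy] ->]]; last exact/asboolP.
have Hx : x \in subfield_pred by apply/asboolP.
by exists (SubfieldType Hx).
Qed.

End Subfields.

Lemma sf_gen (K : fieldType) (S : K -> Prop) : is_subfield (field_gen S).
Proof.
split=> [F sF _|x y Hx Hy F sF HF|x y Hx Hy F sF HF]; first exact: sf1.
  by apply: sfB => //; [exact: Hx|exact: Hy].
by apply: sf_div => //; [exact: Hx|exact: Hy].
Qed.

Lemma sub_field_gen (K : fieldType) (S : K -> Prop) x : S x -> field_gen S x.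
Proof. by move=> Sx F _; exact. Qed.

(** * The group algebra and its field of fractions *)

Section FormalSums.
Variables (k K : fieldType) (iota : {rmorphism k -> K}) (M : zmodType).

(** A formal sum of monomials, given by a list that may have repetitions, with
    the monomials replaced by the values [z]. *)
Definition fsum (z : M -> K) (s : seq (k * M)) : K :=
  \sum_(p <- s) iota p.1 * z p.2.

Lemma fsum_cat z s s' : fsum z (s ++ s') = fsum z s + fsum z s'.
Proof. exact: big_cat. Qed.

End FormalSums.

Section GroupAlgebra.
Variables (k : closedFieldType) (K : fieldType) (iota : {rmorphism k -> K}).
Variables (M : zmodType) (z : M -> K).
Local Notation ga := (group_algebra iota z).

Lemma gaP (L : M -> Prop) x : ga L x <->
  exists2 s, (forall p, p \in s -> L p.2) & x = fsum iota z s.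
Proof.
split=> [[l [w [c [Lw ->]]]]|[s Ls ->]].
  exists [seq (c i, w i) | i <- enum 'I_l]; first by move=> p /mapP[i _ ->]; exact: Lw.
  by rewrite /fsum big_map big_enum.
exists (size s), (fun i => (tnth (in_tuple s) i).2), (fun i => (tnth (in_tuple s) i).1).
split; first by move=> i; apply/Ls/mem_tnth.
by rewrite /fsum big_tnth.
Qed.

Lemma ga_sub (L E : M -> Prop) x : (forall y, L y -> E y) -> ga L x -> ga E x.
Proof. by move=> LE /gaP[s Ls ->]; apply/gaP; exists s => // p /Ls/LE. Qed.

Lemma ga_mono (L : M -> Prop) w : L w -> ga L (z w).
Proof.
move=> Lw; apply/gaP; exists [:: (1, w)]; last by rewrite /fsum big_seq1 rmorph1 mul1r.
by move=> p; rewrite inE => /eqP->.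
Qed.

Lemma ga_add (L : M -> Prop) x y : ga L x -> ga L y -> ga L (x + y).
Proof.
move=> /gaP[s Ls ->] /gaP[s' Ls' ->]; apply/gaP; exists (s ++ s').
  by move=> p; rewrite mem_cat => /orP[/Ls|/Ls'].
by rewrite fsum_cat.
Qed.

Lemma ga0 (L : M -> Prop) : ga L 0.
Proof. by apply/gaP; exists [::] => //; rewrite /fsum big_nil. Qed.

Lemma ga_scale (L : M -> Prop) c x : ga L x -> ga L (iota c * x).
Proof.
move=> /gaP[s Ls ->]; apply/gaP; exists [seq (c * p.1, p.2) | p <- s].
  by move=> p /mapP[q /Ls ? ->].
rewrite /fsum big_map mulr_sumr; apply: eq_bigr => p _.
by rewrite rmorphM mulrA.
Qed.

Lemma ga_opp (L : M -> Prop) x : ga L x -> ga L (- x).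
Proof. by move=> Lx; rewrite -mulN1r -(rmorphN1 iota); exact: ga_scale. Qed.

Lemma ga_sum (L : M -> Prop) (I : Type) (r : seq I) (P : pred I) (G : I -> K) :
  (forall i, P i -> ga L (G i)) -> ga L (\sum_(i <- r | P i) G i).
Proof. by move=> H; elim/big_rec: _ => [|i x Pi Fx]; [exact: ga0|apply: ga_add => //;
  exact: H]. Qed.

Hypothesis Hz : is_torus_field iota z.

Lemma monom0 : z 0 = 1. Proof. exact: monomial0 Hz. Qed.
Lemma monomD a b : z (a + b) = z a * z b. Proof. exact: (monomialD Hz). Qed.
Lemma monom_neq0 a : z a != 0.
Proof.
apply/eqP => E; have := monomD a (- a); rewrite subrr monom0 E mul0r => /eqP.
by rewrite oner_eq0.
Qed.
Lemma monomN a : z (- a) = (z a)^-1.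
Proof. by apply: (mulfI (monom_neq0 a)); rewrite -monomD subrr monom0 mulfV ?monom_neq0. Qed.
Lemma monomMn a d : z (a *+ d) = z a ^+ d.
Proof. by elim: d => [|d IH]; rewrite ?mulr0n ?monom0 // mulrS monomD IH exprS. Qed.
Lemma monomMz a (d : int) : z (a *~ d) = z a ^ d.
Proof.
case: d => d; first by rewrite -pmulrn monomMn.
by rewrite NegzE mulrNz -pmulrn monomN // monomMn // -exprnN.
Qed.
Lemma monom_sum (I : Type) (r : seq I) (P : pred I) (G : I -> M) :
  z (\sum_(i <- r | P i) G i) = \prod_(i <- r | P i) z (G i).
Proof. by apply: (big_morph _ monomD); exact: monom0. Qed.

Lemma ga_iota (L : M -> Prop) c : is_subgroup L -> ga L (iota c).
Proof.
move=> sL; rewrite -[iota c]mulr1 -monom0; apply: ga_scale.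
by apply: ga_mono; exact: sg0.
Qed.

Lemma ga1 (L : M -> Prop) : is_subgroup L -> ga L 1.
Proof. by move=> sL; rewrite -(rmorph1 iota); exact: ga_iota. Qed.

Lemma ga_mul (L : M -> Prop) x y : is_subgroup L -> ga L x -> ga L y -> ga L (x * y).
Proof.
move=> sL /gaP[s Ls ->] Ly; rewrite /fsum mulr_suml big_seq.
apply: ga_sum => p /Ls Lp; rewrite -mulrA; apply: ga_scale.
move: Ly => /gaP[s' Ls' ->]; rewrite /fsum mulr_sumr big_seq.
apply: ga_sum => q /Ls' Lq; rewrite mulrCA -monomD; apply/ga_scale/ga_mono.
exact: sgD.
Qed.

Lemma ga_prod (L : M -> Prop) (I : Type) (r : seq I) (P : pred I) (G : I -> K) :
  is_subgroup L -> (forall i, P i -> ga L (G i)) -> ga L (\prod_(i <- r | P i) G i).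
Proof.
move=> sL H; elim/big_rec: _ => [|i x Pi Fx]; first exact: ga1.
by apply: ga_mul => //; exact: H.
Qed.

Lemma fsum_coef (s : seq (k * M)) : fsum iota z s = 0 ->
  forall v, \sum_(p <- s | p.2 == v) p.1 = 0.
Proof.
move=> s0 v; set r := undup (map snd s).
have [vr|vr] := boolP (v \in r); last first.
  rewrite big_seq_cond big_pred0 // => p; apply: contraNF vr => /andP[ps /eqP<-].
  by rewrite mem_undup map_f.
have := @monomial_free _ _ _ _ _ Hz (size r) (fun i => tnth (in_tuple r) i)
  (fun i => \sum_(p <- s | p.2 == tnth (in_tuple r) i) p.1).
have rE i : tnth (in_tuple r) i = nth v r i by apply: tnth_nth.
have inj : injective (fun i => tnth (in_tuple r) i).
  move=> i j; rewrite !rE => /eqP; rewrite nth_uniq ?undup_uniq //.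
  by move=> /eqP/val_inj.
move=> /(_ inj); have lt : (index v r < size r)%N by rewrite index_mem.
move=> /(_ _ (Ordinal lt)); rewrite rE nth_index //; apply.
rewrite -[RHS]s0 /fsum (group_sum snd iota s fst z) -/r.
by rewrite [RHS]big_tnth.
Qed.

(** The monomials are linearly independent, so a formal sum with value zero has
    value zero for any other choice of the values of the monomials. *)
Lemma fsum_transfer (K' : fieldType) (iota' : {rmorphism k -> K'}) (G : M -> K')
    (s : seq (k * M)) : fsum iota z s = 0 -> fsum iota' G s = 0.
Proof.
move=> /fsum_coef H; rewrite /fsum (group_sum snd iota' s fst G) big1 // => v _.
by rewrite H rmorph0 mul0r.
Qed.

Lemma fsum_transfer_eq (K' : fieldType) (iota' : {rmorphism k -> K'}) (G : M -> K')
    (s s' : seq (k * M)) : fsum iota z s = fsum iota z s' ->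
  fsum iota' G s = fsum iota' G s'.
Proof.
have opp (K1 : fieldType) (i1 : {rmorphism k -> K1}) G1 :
    fsum i1 G1 [seq (- p.1, p.2) | p <- s'] = - fsum i1 G1 s'.
  rewrite /fsum big_map -sumrN; apply: eq_bigr => p _.
  by rewrite rmorphN mulNr.
move=> E; apply/eqP; rewrite -subr_eq0 -opp -fsum_cat; apply/eqP/fsum_transfer.
by rewrite fsum_cat opp E subrr.
Qed.

Section Transfer.
Variables (K' : fieldType) (iota' : {rmorphism k -> K'}) (G : M -> K').

(** The [k]-linear map on the group algebra that sends the monomial [w] to
    [G w]; it is a morphism of algebras when [G] is multiplicative. *)
Definition transfer (x : K) : K' :=
  if pselect (exists s, x = fsum iota z s) is left e
  then fsum iota' G (projT1 (cid e)) else 0.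

Lemma transferE s : transfer (fsum iota z s) = fsum iota' G s.
Proof.
rewrite /transfer; case: pselect => [e|[]]; last by exists s.
by case: cid => s' /= /fsum_transfer_eq ->.
Qed.

Lemma ga_full x : ga (@full M) x -> exists s, x = fsum iota z s.
Proof. by move=> /gaP[s _ ->]; exists s. Qed.

Lemma transferD x y : ga (@full M) x -> ga (@full M) y ->
  transfer (x + y) = transfer x + transfer y.
Proof.
by move=> /ga_full[s ->] /ga_full[s' ->]; rewrite -fsum_cat !transferE fsum_cat.
Qed.

Lemma transferZ c x : ga (@full M) x -> transfer (iota c * x) = iota' c * transfer x.
Proof.
move=> /ga_full[s ->].
have E (K1 : fieldType) (i1 : {rmorphism k -> K1}) G1 :
    i1 c * fsum i1 G1 s = fsum i1 G1 [seq (c * p.1, p.2) | p <- s].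
  rewrite /fsum big_map mulr_sumr; apply: eq_bigr => p _.
  by rewrite rmorphM mulrA.
by rewrite E !transferE E.
Qed.

Lemma transfer_mono w : transfer (z w) = G w.
Proof.
have -> : z w = fsum iota z [:: (1, w)] by rewrite /fsum big_seq1 rmorph1 mul1r.
by rewrite transferE /fsum big_seq1 rmorph1 mul1r.
Qed.

Lemma transfer0 : transfer 0 = 0.
Proof.
have -> : 0 = fsum iota z [::] by rewrite /fsum big_nil.
by rewrite transferE /fsum big_nil.
Qed.

Lemma transfer_sum (I : eqType) (r : seq I) (x : I -> K) :
  (forall i, i \in r -> ga (@full M) (x i)) ->
  transfer (\sum_(i <- r) x i) = \sum_(i <- r) transfer (x i).
Proof.
elim: r => [|i r IH] H; first by rewrite !big_nil transfer0.
rewrite !big_cons transferD ?IH //.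
- by move=> j jr; apply: H; rewrite inE jr orbT.
- by apply: H; rewrite mem_head.
- by rewrite big_seq; apply: ga_sum => j jr; apply: H; rewrite inE jr orbT.
Qed.

Hypothesis G_add : forall a b, G (a + b) = G a * G b.

Lemma transferM x y : ga (@full M) x -> ga (@full M) y ->
  transfer (x * y) = transfer x * transfer y.
Proof.
have sf := sg_full M.
have mono w v : ga (@full M) v -> transfer (z w * v) = G w * transfer v.
  move=> /ga_full[s ->].
  have E : z w * fsum iota z s = fsum iota z [seq (p.1, w + p.2) | p <- s].
    by rewrite /fsum big_map mulr_sumr; apply: eq_bigr => p _; rewrite monomD mulrCA.
  rewrite E !transferE /fsum big_map mulr_sumr; apply: eq_bigr => p _.
  by rewrite G_add mulrCA.
move=> /ga_full[s ->] Hy; rewrite transferE /fsum !mulr_suml.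
rewrite transfer_sum => [|p _]; last first.
  by rewrite -mulrA; apply/ga_scale/ga_mul => //; exact: ga_mono.
apply: eq_bigr => p _; rewrite -mulrA transferZ ?mono ?mulrA //.
by apply: ga_mul => //; exact: ga_mono.
Qed.

End Transfer.
End GroupAlgebra.

Section TorusField.
Variables (k : closedFieldType) (K : fieldType) (iota : {rmorphism k -> K}).
Variables (M : zmodType) (z : M -> K).
Hypothesis Hz : is_torus_field iota z.
Local Notation ga := (group_algebra iota z).
Local Notation tf := (torus_field iota z).

Lemma sf_tf L : is_subfield (tf L). Proof. exact: sf_gen. Qed.

Lemma tf_iota L c : tf L (iota c).
Proof. by apply: sub_field_gen; left; exists c. Qed.

Lemma tf_mono (L : M -> Prop) w : L w -> tf L (z w).
Proof. by move=> Lw; apply: sub_field_gen; right; exists w. Qed.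

Lemma tf_ga (L : M -> Prop) x : ga L x -> tf L x.
Proof.
move=> /gaP[s Ls ->]; rewrite /fsum big_seq; apply: (sf_sum (sf_tf L)) => p /Ls Lp.
by apply: (sfM (sf_tf L)); [exact: tf_iota|exact: tf_mono].
Qed.

Lemma tf_sub (L E : M -> Prop) x : (forall y, L y -> E y) -> tf L x -> tf E x.
Proof.
move=> LE Hx; apply: (Hx (tf E)) => [|y [[c ->]|[w [Lw ->]]]]; first exact: sf_tf.
  exact: tf_iota.
by apply: tf_mono; exact: LE.
Qed.

Lemma tfP (L : M -> Prop) x : is_subgroup L -> tf L x <->
  exists a b, [/\ ga L a, ga L b, b != 0 & x = a / b].
Proof.
move=> sL; split; last first.
  by move=> [a [b [La Lb _ ->]]]; apply: (sf_div (sf_tf L)); exact: tf_ga.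
have g1 : ga L 1 by exact: (ga1 Hz).
move=> Hx; apply: (Hx (fun x => exists a b, [/\ ga L a, ga L b, b != 0 & x = a / b]))
  => [|y [[c ->]|[w [Lw ->]]]]; first split.
- by exists 1, 1; rewrite oner_eq0 divr1.
- move=> _ _ [a [b [La Lb b0 ->]]] [c [d [Lc Ld d0 ->]]].
  exists (a * d - c * b), (b * d); split.
  + by apply: ga_add; [|apply: ga_opp]; exact: (ga_mul Hz).
  + exact: (ga_mul Hz).
  + by rewrite mulf_neq0.
  + by field; rewrite ?b0 ?d0.
- move=> _ _ [a [b [La Lb b0 ->]]] [c [d [Lc Ld d0 ->]]].
  have [->|c0] := eqVneq c 0.
    by exists 0, 1; rewrite oner_eq0 !mul0r invr0 mulr0; split=> //; exact: ga0.
  exists (a * d), (b * c); split; try exact: (ga_mul Hz).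
    by rewrite mulf_neq0.
  by field; rewrite ?b0 ?c0 ?d0.
- by exists (iota c), 1; rewrite oner_eq0 divr1; split=> //; exact: (ga_iota Hz).
- by exists (z w), 1; rewrite oner_eq0 divr1; split=> //; exact: ga_mono.
Qed.

Lemma tf_full x : tf (@full M) x.
Proof. by apply/tfP => //; exact: (monomial_fractions Hz). Qed.

(** The group algebra is graded by [M / L]: after clearing denominators,
    [transfer] keeps the monomials in the coset of [c i0] only. *)
Lemma coset_indep (L : M -> Prop) (I : eqType) (r : seq I) (c : I -> M) (a : I -> K) :
  is_subgroup L -> uniq r ->
  (forall i j, i \in r -> j \in r -> L (c i - c j) -> i = j) ->
  (forall i, i \in r -> tf L (a i)) ->
  \sum_(i <- r) a i * z (c i) = 0 -> forall i, i \in r -> a i = 0.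
Proof.
move=> sL ur Hc Ha.
have /choice[pq Hpq] i : exists pq : K * K, i \in r ->
    [/\ ga L pq.1, ga L pq.2, pq.2 != 0 & a i = pq.1 / pq.2].
  have [/Ha/tfP[//|p [q H]]|_] := boolP (i \in r); last by exists (0, 0).
  by exists (p, q).
pose Q := \prod_(i <- r) (pq i).2.
have Q0 : Q != 0 by rewrite /Q prodf_seq_neq0; apply/allP => i /Hpq[].
have LQ : forall i, i \in r -> ga L (a i * Q).
  move=> i ir; have [p1 p2 p20 ->] := Hpq i ir.
  rewrite /Q (bigD1_seq i) //= mulrA divfK //; apply: (ga_mul Hz) => //.
  rewrite big_seq_cond; apply: (ga_prod Hz) => // j /andP[/Hpq[_ ? _ _] _] //.
move=> S0 i0 i0r; apply: (mulIf Q0); rewrite mul0r.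
have S1 : \sum_(i <- r) a i * Q * z (c i) = 0.
  transitivity ((\sum_(i <- r) a i * z (c i)) * Q); last by rewrite S0 mul0r.
  by rewrite mulr_suml; apply: eq_bigr => i _; rewrite mulrAC.
pose G w := if `[< L (w - c i0) >] then z w else 0.
have := congr1 (transfer iota z iota G) S1.
rewrite (transfer0 Hz) (transfer_sum Hz) => [|i ir]; last first.
  apply: (ga_mul Hz) => //; last exact: ga_mono.
  exact: ga_sub (LQ i ir).
rewrite (bigD1_seq i0) //= big_seq_cond big1 ?addr0 => [|i /andP[ir ne]].
  have /gaP[s Ls ->] := LQ i0 i0r.
  have -> : fsum iota z s * z (c i0) = fsum iota z [seq (p.1, p.2 + c i0) | p <- s].
    by rewrite /fsum big_map mulr_suml; apply: eq_bigr => p _; rewrite (monomD Hz) mulrA.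
  rewrite (transferE Hz) /fsum big_map (eq_big_seq (fun p => iota p.1 * z p.2 * z (c i0))).
    by rewrite -mulr_suml => /eqP; rewrite mulf_eq0 (negPf (monom_neq0 Hz _)) orbF => /eqP.
  move=> p ps; rewrite /G /= asboolT; first by rewrite (monomD Hz) mulrA.
  by rewrite addrK; exact: Ls.
have /gaP[s Ls ->] := LQ i ir.
have -> : fsum iota z s * z (c i) = fsum iota z [seq (p.1, p.2 + c i) | p <- s].
  by rewrite /fsum big_map mulr_suml; apply: eq_bigr => p _; rewrite (monomD Hz) mulrA.
rewrite (transferE Hz) /fsum big_map big_seq big1 // => p ps.
rewrite /G /= asboolF ?mulr0 // => H; case/eqP: ne; apply: Hc => //.
have -> : c i - c i0 = (p.2 + c i - c i0) - p.2 by rewrite [p.2 + _]addrC addrAC addrK.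
by apply: (sgB sL) => //; exact: Ls.
Qed.

Section Degree.
Variables (L E : M -> Prop) (d : nat) (c : 'I_d -> M).
Hypotheses (sL : is_subgroup L) (sE : is_subgroup E).
Hypothesis LE : forall x, L x -> E x.
Hypothesis Ec : forall i, E (c i).
Hypothesis cE : forall x, E x -> exists! i, L (x - c i).

Lemma ga_cosets x : ga E x -> exists a : 'I_d -> K,
  (forall i, ga L (a i)) /\ x = \sum_i a i * z (c i).
Proof.
move=> /gaP[s Es ->]; elim: s Es => [|p s IH] Es.
  exists (fun=> 0); split=> [i|]; first exact: ga0.
  by rewrite /fsum big_nil big1 // => i _; rewrite mul0r.
have [|a [La Ea]] := IH; first by move=> q qs; apply: Es; rewrite inE qs orbT.
have [i [Li _]] := cE (Es p (mem_head _ _)).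
exists (fun j => a j + (if j == i then iota p.1 * z (p.2 - c i) else 0)); split.
  move=> j; apply: ga_add => //; case: ifP => _; last exact: ga0.
  exact/ga_scale/ga_mono.
rewrite /fsum big_cons -/(fsum _ _ _) Ea; under [RHS]eq_bigr => j _ do rewrite mulrDl.
rewrite big_split /= addrC; congr (_ + _).
rewrite (bigD1 i) //= eqxx big1 ?addr0 => [|j /negPf->]; last by rewrite mul0r.
by rewrite -mulrA -(monomD Hz) subrK.
Qed.

Lemma c_sep i j : L (c i - c j) -> i = j.
Proof.
have [l [Ll Hl]] := cE (Ec i) => Lij; rewrite -(Hl j) //; apply/esym/Hl.
by rewrite subrr; exact: sg0.
Qed.

Lemma coset_indep_fin (a : 'I_d -> K) : (forall i, tf L (a i)) ->
  \sum_i a i * z (c i) = 0 -> forall i, a i = 0.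
Proof.
move=> La S0 i.
apply: (@coset_indep L 'I_d (index_enum 'I_d) c) => //.
- exact: index_enum_uniq.
- by move=> i1 j1 _ _; exact: c_sep.
- by rewrite mem_index_enum.
Qed.

(** The sums of the [z (c i)] with coefficients in [k(L)] form a ring of finite
    dimension over [k(L)], in which multiplication by [q] is injective, hence
    bijective; so denominators are not needed. *)
Lemma tf_cosets x : tf E x -> exists a : 'I_d -> K,
  (forall i, tf L (a i)) /\ x = \sum_i a i * z (c i).
Proof.
have [F0 [j Hj]] := subfield_embedding (sf_tf L).
have gaF y : ga E y -> exists a : 'rV[F0]_d, y = \sum_i j (a 0 i) * z (c i).
  move=> /ga_cosets[a [La ->]]; have /fin_all_exists[b Hb] i : exists b, a i = j b.
    by apply/Hj; apply: tf_ga; exact: La.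
  by exists (\row_i b i); apply: eq_bigr => i _; rewrite mxE Hb.
move=> /tfP[//|p [q [Ep Eq q0 ->]]].
have /fin_all_exists[B HB] i : exists B : 'rV[F0]_d, q * z (c i) = \sum_l j (B 0 l) * z (c l).
  by apply: gaF; apply: (ga_mul Hz) => //; exact: ga_mono.
(* the matrix of the multiplication by [q] over the subfield *)
pose Bm : 'M[F0]_d := \matrix_i B i.
have mulB (v : 'rV[F0]_d) : q * \sum_i j (v 0 i) * z (c i) = \sum_l j ((v *m Bm) 0 l) * z (c l).
  rewrite mulr_sumr; under eq_bigr => i _ do rewrite mulrCA HB mulr_sumr.
  rewrite exchange_big; apply: eq_bigr => l _ /=; rewrite mxE rmorph_sum mulr_suml.
  by apply: eq_bigr => i _; rewrite rmorphM mxE mulrA.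
have uB : Bm \in unitmx.
  rewrite -row_free_unit; apply: inj_row_free => v vB.
  have /eqP : q * \sum_i j (v 0 i) * z (c i) = 0.
    by rewrite mulB vB big1 // => l _; rewrite mxE rmorph0 mul0r.
  rewrite mulf_eq0 (negPf q0) => /eqP S0; apply/rowP => i; rewrite mxE.
  apply/eqP; rewrite -(fmorph_eq0 j); apply/eqP/(coset_indep_fin _ S0) => l.
  by apply/Hj; exists (v 0 l).
have [v Ev] := gaF p Ep.
exists (fun i => j ((v *m invmx Bm) 0 i)); split.
  by move=> i; apply/Hj; exists ((v *m invmx Bm) 0 i).
apply: (mulfI q0); rewrite mulB mulmxKV // -Ev.
by rewrite mulrC divfK.
Qed.

Lemma degree_cosets : ext_degree (tf L) (tf E) d.
Proof.
exists (fun i => z (c i)); split=> [i|x /tf_cosets[a [La Ea]]]; first exact: tf_mono.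
exists [ffun i => a i]; split.
  split=> [i|]; first by rewrite ffunE.
  by rewrite Ea; apply: eq_bigr => i _; rewrite ffunE.
move=> b [Lb Eb]; apply/ffunP => i; rewrite ffunE; apply/eqP; rewrite -subr_eq0; apply/eqP.
apply: (coset_indep_fin (a := fun i => a i - b i)) => [l|].
  exact: (sfB (sf_tf L)).
by under eq_bigr => l _ do rewrite mulrBl; rewrite sumrB -Ea -Eb subrr.
Qed.

Lemma finite_cosets : finite_torus_map iota z E L.
Proof.
exists d, (fun i => z (c i)); split=> [i|]; first exact: ga_mono.
exact: ga_cosets.
Qed.

End Degree.

(** The algebra of the fiber over [s] is [k[M/H]], which embeds in [K] by a
    splitting [rho] of [M -> M/H]; so the ideal is the kernel of a morphism to
    a field. *)
Lemma fibers_integral (H : M -> Prop) (rho : M -> M) : is_subgroup H ->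
  (forall a b, rho (a + b) = rho a + rho b) ->
  (forall w, H (w - rho w)) -> (forall h, H h -> rho h = 0) ->
  integral_fibers iota z H.
Proof.
move=> sH rhoD rhoH Hrho s [s0 sD].
pose G w := iota (s (w - rho w)) * z (rho w).
have GD a b : G (a + b) = G a * G b.
  by rewrite /G rhoD opprD addrACA (sD (a - rho a)) // rmorphM (monomD Hz) mulrACA.
have G0 : G 0 = 1.
  by rewrite /G Hrho ?subrr ?s0 ?rmorph1 ?mul1r ?(monom0 Hz) //; exact: sg0.
pose Phi := transfer iota z iota G.
have gaf x y : ga (@full M) x -> ga (@full M) y -> ga (@full M) (x * y).
  exact: (ga_mul Hz).
have gen_ga w : ga (@full M) (z w - iota (s w)).
  by apply: ga_add; [exact: ga_mono|apply: ga_opp; exact: (ga_iota Hz)].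
have iota_ga c : ga (@full M) (iota c) by exact: (ga_iota Hz).
have Phi1 : Phi 1 = 1.
  by rewrite -{1}(monom0 Hz) /Phi (transfer_mono Hz) G0.
have PhiC c : Phi (iota c) = iota c.
  rewrite -[X in Phi X]mulr1 /Phi (transferZ Hz); last exact: (ga1 Hz).
  by rewrite -/Phi Phi1 mulr1.
have kerP x : ga (@full M) x -> fiber_ideal iota z H s x <-> Phi x = 0.
  move=> gx; split.
    move=> [l [w [a [Hw ga_a ->]]]]; rewrite /Phi (transfer_sum Hz) => [|i _]; last first.
      exact: gaf.
    rewrite big1 // => i _; rewrite (transferM Hz) //.
    rewrite (transferD Hz); [|exact: ga_mono|by apply: ga_opp].
    rewrite (transfer_mono Hz) -rmorphN -/Phi PhiC /G Hrho // subr0 (monom0 Hz) mulr1.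
    by rewrite rmorphN subrr mulr0.
  move=> Px; have [S ES] := ga_full gx.
  exists (size S), (fun i => (tnth (in_tuple S) i).2 - rho (tnth (in_tuple S) i).2).
  exists (fun i => iota (tnth (in_tuple S) i).1 * z (rho (tnth (in_tuple S) i).2));
    split=> [i|i|] //.
    exact/ga_scale/ga_mono.
  have : x = x - Phi x by rewrite Px subr0.
  rewrite {2 3}ES /Phi (transferE Hz) /fsum -sumrB => ->.
  rewrite big_tnth; apply: eq_bigr => i _; set p := tnth _ _.
  rewrite /G -!mulrA -mulrBr; congr (_ * _).
  by rewrite mulrBr -(monomD Hz) [rho _ + _]addrC subrK mulrC [z _ * iota _]mulrC.
split=> [H1|x y gx gy].
  have := proj1 (kerP 1 (ga1 Hz (sg_full M))) H1.
  by rewrite Phi1 => /eqP; rewrite oner_eq0.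
move=> /(kerP _ (gaf _ _ gx gy)); rewrite /Phi (transferM Hz) // => /eqP.
by rewrite mulf_eq0 => /orP[] /eqP Pz; [left|right]; apply/kerP.
Qed.

End TorusField.

(** * Separability *)

Section Frobenius.
Variables (R : comNzRingType) (p : nat).
Hypothesis pR : p \in [pchar R].

Lemma frobD (x y : R) e : (x + y) ^+ (p ^ e) = x ^+ (p ^ e) + y ^+ (p ^ e).
Proof.
by apply: exprDn_pchar; rewrite pnatX (eq_pnat _ (pcharf_eq pR)) pnat_id ?(pcharf_prime pR)
  ?orbT.
Qed.

Lemma frob_sum (I : Type) (r : seq I) (F : I -> R) e :
  (\sum_(i <- r) F i) ^+ (p ^ e) = \sum_(i <- r) F i ^+ (p ^ e).
Proof.
apply: (big_morph (fun x => x ^+ (p ^ e)) (fun x y => frobD x y e)).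
by rewrite expr0n expn_eq0 eqn0Ngt (prime_gt0 (pcharf_prime pR)).
Qed.

Lemma frobB (x y : R) e : (x - y) ^+ (p ^ e) = x ^+ (p ^ e) - y ^+ (p ^ e).
Proof.
by apply/eqP; rewrite -subr_eq opprK -frobD subrK.
Qed.

End Frobenius.

Lemma frob_inj (K : fieldType) p e (x y : K) : p \in [pchar K] ->
  x ^+ (p ^ e) = y ^+ (p ^ e) -> x = y.
Proof.
move=> pK E; apply/eqP; rewrite -subr_eq0.
have : (x - y) ^+ (p ^ e) == 0 by rewrite (frobB pK) E subrr.
by rewrite expf_eq0 => /andP[_].
Qed.

(** The element is separable and purely inseparable: the gcd of its
    annihilating polynomials [q] and [X^(p^e) - x^(p^e)] is linear. *)
Lemma insep_sep (K : fieldType) (F F' : K -> Prop) p e x :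
  is_subfield F' -> (forall y, F y -> F' y) -> p \in [pchar K] ->
  separable_over F x -> F' (x ^+ (p ^ e)) -> F' x.
Proof.
move=> sF' FF' pK [q [[Fq qm qx _] sq]] F'x.
have [F0 [j Hj]] := subfield_embedding sF'.
have /choice[c Hc] i : exists c, q`_i = j c by apply/Hj/FF'/Fq.
pose q0 := \poly_(i < size q) c i.
have Eq : map_poly j q0 = q.
  apply/polyP => i; rewrite coef_map coef_poly; case: ltnP => [_|le]; first by rewrite Hc.
  by rewrite raddf0 nth_default.
have [a Ea] := proj1 (Hj _) F'x.
pose h0 : {poly F0} := 'X^(p ^ e) - a%:P.
have pKX : p \in [pchar {poly K}] by exact: (rmorph_pchar (polyC : {rmorphism K -> {poly K}})).
have Eh : map_poly j h0 = ('X - x%:P) ^+ (p ^ e).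
  by rewrite rmorphB /= map_polyXn map_polyC /= -Ea (frobB pKX) -polyC_exp.
pose g := map_poly j (gcdp q0 h0).
have gq : g %| q by rewrite /g gcdp_map Eq dvdp_gcdl.
have xg : 'X - x%:P %| g.
  rewrite /g gcdp_map Eq Eh dvdp_gcd dvdp_XsubCl qx /=.
  by rewrite dvdp_exp // expn_gt0 (prime_gt0 (pcharf_prime pK)).
have /dvdp_exp_XsubCP[m _ Eg] : g %| ('X - x%:P) ^+ (p ^ e).
  by rewrite /g gcdp_map Eh dvdp_gcdr.
have sX : size ('X - x%:P) != 1 by rewrite size_XsubC.
have m1 : (m <= 1)%N.
  rewrite leqNgt; apply/negP => m1.
  have := separable_nosquare sq m1 sX.
  by rewrite -(eqp_dvdl _ Eg) gq.
have m0 : m != 0%N.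
  apply: contraTneq xg => m0; rewrite (eqp_dvdr _ Eg) m0 expr0 dvdp1.
  by rewrite size_XsubC.
have {m0 m1}Em : m = 1%N by apply/eqP; rewrite eqn_leq m1 lt0n.
rewrite {}Em expr1 in Eg.
have sg : size g = 2 by rewrite (eqp_size Eg) size_XsubC.
have gx : root g x by rewrite (eqp_root Eg) root_XsubC.
have gF i : F' g`_i by apply/Hj; exists (gcdp q0 h0)`_i; rewrite coef_map.
have g1 : g`_1 != 0 by have := lead_coef_eq0 g; rewrite lead_coefE sg => ->;
  rewrite -size_poly_eq0 sg.
move/rootP: gx; rewrite horner_coef sg !big_ord_recl big_ord0 /= expr0 mulr1 expr1 addr0.
move=> /eqP; rewrite addrC addr_eq0 => /eqP E.
have -> : x = - g`_0 / g`_1 by rewrite -E mulrC mulKf.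
by apply: (sf_div sF') => //; apply: (sfN sF').
Qed.

Section TorusSeparable.
Variables (k : closedFieldType) (K : fieldType) (iota : {rmorphism k -> K}).
Variables (M : zmodType) (z : M -> K).
Hypothesis Hz : is_torus_field iota z.
Local Notation ga := (group_algebra iota z).
Local Notation tf := (torus_field iota z).
Local Notation char := (torus_point (k := k) (@full M)).

Lemma tf_frob (L E : M -> Prop) p e : is_subgroup L -> is_subgroup E ->
  p \in [pchar K] -> (forall w, E w -> L (w *+ p ^ e)) ->
  forall x, tf E x -> tf L (x ^+ (p ^ e)).
Proof.
move=> sL sE pK HE x /(tfP Hz)[//|a [b [Ea Eb _ ->]]].
have gaF y : ga E y -> ga L (y ^+ (p ^ e)).
  move=> /gaP[s Es ->]; rewrite /fsum (frob_sum pK) big_seq.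
  apply: ga_sum => q /Es/HE Lq; rewrite exprMn -rmorphXn -(monomMn Hz).
  by apply: ga_scale; exact: ga_mono.
rewrite expr_div_n; apply: (sf_div (sf_tf iota z L)); apply: tf_ga; exact: gaF.
Qed.

(** A point of the torus acts on the function field by translation. *)
Lemma torus_automorphism t : char t ->
  exists s : {rmorphism K -> K},
    (forall c, s (iota c) = iota c) /\ (forall w, s (z w) = iota (t w) * z w).
Proof.
move=> ct; pose G w := iota (t w) * z w.
have GD a b : G (a + b) = G a * G b.
  by rewrite /G charD // rmorphM (monomD Hz) mulrACA.
pose Phi := transfer iota z iota G.
have gaf x y : ga (@full M) x -> ga (@full M) y -> ga (@full M) (x * y).
  exact: (ga_mul Hz).
have PhiM x y : ga (@full M) x -> ga (@full M) y -> Phi (x * y) = Phi x * Phi y.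
  exact: (transferM Hz).
have PhiD x y : ga (@full M) x -> ga (@full M) y -> Phi (x + y) = Phi x + Phi y.
  exact: (transferD Hz).
have Phi1 : Phi 1 = 1.
  by rewrite -{1}(monom0 Hz) /Phi (transfer_mono Hz) /G char0 // rmorph1 mul1r (monom0 Hz).
have g1 : ga (@full M) 1 by exact: (ga1 Hz).
have PhiZ c x : ga (@full M) x -> Phi (iota c * x) = iota c * Phi x.
  exact: (transferZ Hz).
have Phi0 x : ga (@full M) x -> Phi x = 0 -> x = 0.
  move=> gx; have [s Es] := ga_full gx; rewrite Es /Phi (transferE Hz) => E.
  have {}E : fsum iota z [seq (p.1 * t p.2, p.2) | p <- s] = 0.
    rewrite -[RHS]E /fsum big_map; apply: eq_bigr => p _ /=.
    by rewrite rmorphM -mulrA.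
  have := fsum_transfer Hz iota (fun w => iota (t w)^-1 * z w) E.
  move=> H; rewrite -[RHS]H /fsum big_map; apply: eq_bigr => p _ /=.
  by rewrite mulrA -rmorphM mulfK ?char_neq0.
have /choice[ab Hab] x : exists ab : K * K,
    [/\ ga (@full M) ab.1, ga (@full M) ab.2, ab.2 != 0 & x = ab.1 / ab.2].
  by have [a [b H]] := monomial_fractions Hz x; exists (a, b).
pose s x := Phi (ab x).1 / Phi (ab x).2.
have nz b : ga (@full M) b -> b != 0 -> Phi b != 0.
  by move=> gb; apply: contraNneq => Pb; rewrite (Phi0 _ gb Pb).
have sE a b : ga (@full M) a -> ga (@full M) b -> b != 0 -> s (a / b) = Phi a / Phi b.
  move=> ga_a gb b0; rewrite /s; have := Hab (a / b); case: (ab _) => a' b' /= [ga' gb' b'0 E].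
  apply/eqP; rewrite eqr_div ?nz // -!PhiM //; apply/eqP; congr Phi.
  by apply/eqP; rewrite -eqr_div // E.
have s_add : zmod_morphism s.
  move=> x y; have [ga_a gb b0 Ex] := Hab x; have [ga' gb' b'0 Ey] := Hab y.
  have gn v : ga (@full M) v -> ga (@full M) (- v) by exact: ga_opp.
  have PhiN v : ga (@full M) v -> Phi (- v) = - Phi v.
    by move=> gv; rewrite -mulN1r -(rmorphN1 iota) PhiZ // rmorphN1 mulN1r.
  have -> : x - y = ((ab x).1 * (ab y).2 - (ab y).1 * (ab x).2) / ((ab x).2 * (ab y).2).
    by rewrite {1}Ex {1}Ey; field; rewrite b0 b'0.
  rewrite sE; [|by apply: ga_add; [|apply: gn]; exact: gaf|exact: gaf|by rewrite mulf_neq0].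
  rewrite PhiD ?PhiN ?PhiM //; try exact: gaf; last by apply: gn; exact: gaf.
  by rewrite /s; field; rewrite !nz.
have s_mul : monoid_morphism s.
  split.
    by rewrite -[X in s X](divr1 1) sE ?oner_eq0 // Phi1 divr1.
  move=> x y; have [ga_a gb b0 Ex] := Hab x; have [ga' gb' b'0 Ey] := Hab y.
  have -> : x * y = ((ab x).1 * (ab y).1) / ((ab x).2 * (ab y).2).
    by rewrite {1}Ex {1}Ey; field; rewrite b0 b'0.
  rewrite sE; [|exact: gaf|exact: gaf|by rewrite mulf_neq0].
  by rewrite !PhiM // /s; field; rewrite !nz.
pose m1 := GRing.isZmodMorphism.Build K K s s_add.
pose m2 := GRing.isMonoidMorphism.Build K K s s_mul.
pose s' : {rmorphism K -> K} := HB.pack s m1 m2.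
exists s'; split=> [c|w] /=.
  rewrite -[X in s X](divr1 (iota c)) sE ?oner_eq0 //; last exact: (ga_iota Hz).
  by rewrite Phi1 divr1 -[X in Phi X]mulr1 PhiZ // Phi1 mulr1.
rewrite -[X in s X](divr1 (z w)) sE ?oner_eq0 //; last exact: ga_mono.
by rewrite Phi1 divr1 /Phi (transfer_mono Hz).
Qed.

(** When characters separate [E / L], the extension is Galois with group the
    characters of [E] trivial on [L]; the minimal polynomial of [x] is the
    product over its finite orbit. *)
Lemma separable_cosets (L E : M -> Prop) (d e : nat) (c : 'I_d -> M) :
  is_subgroup L -> is_subgroup E -> (forall x, L x -> E x) ->
  (forall i, E (c i)) -> (forall x, E x -> exists! i, L (x - c i)) ->
  (0 < e)%N -> (forall w, E w -> L (w *+ e)) ->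
  (forall w, E w -> ~ L w -> exists t, [/\ char t, forall y, L y -> t y = 1 & t w != 1]) ->
  forall x, tf E x -> separable_over (tf L) x.
Proof.
move=> sL sE LE Ec cE e0 He sep x Ex.
pose Gam t := char t /\ forall y, L y -> t y = 1.
have /choice[s Hs] t : exists s : {rmorphism K -> K}, char t ->
    (forall c, s (iota c) = iota c) /\ (forall w, s (z w) = iota (t w) * z w).
  have [ct|nct] := EM (char t); last by exists (idfun : {rmorphism K -> K}).
  by have [s H] := torus_automorphism ct; exists s.
have sfix t y : Gam t -> tf L y -> s t y = y.
  move=> [ct tL] Ly; have [si sz] := Hs t ct; apply: (Ly (fun y => s t y = y)).
    split=> [|u v Eu Ev|u v Eu Ev]; first exact: rmorph1.
      by rewrite rmorphB Eu Ev.
    by rewrite fmorph_div Eu Ev.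
  by move=> _ [[b ->]|[w [Lw ->]]]; rewrite ?si // sz tL // rmorph1 mul1r.
have [a [La Ea]] := tf_cosets Hz sL sE Ec cE Ex.
have [r Er] := closed_field_poly_normal ('X^e - 1 : {poly k}).
have rP w : w ^+ e = 1 -> w \in r.
  move=> we; rewrite -root_prod_XsubC -(rootZ _ _ (a := lead_coef ('X^e - 1))) -?Er.
    by rewrite rootE !hornerE we subrr.
  by rewrite (monicP (monic_Xn_sub_1 k e0)) oner_neq0.
pose val (om : {ffun 'I_d -> seq_sub r}) := \sum_i a i * (iota (ssval (om i)) * z (c i)).
have st t : Gam t -> exists om, s t x = val om.
  move=> Gt; have [ct tL] := Gt; have [_ sz] := Hs t ct.
  have tr i : t (c i) \in r.
    by apply: rP; rewrite -charMn // tL //; exact: He.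
  exists [ffun i => SeqSub (tr i)]; rewrite Ea rmorph_sum; apply: eq_bigr => i _.
  by rewrite rmorphM (sfix _ _ Gt (La i)) sz ffunE.
(* A conjugate of [x] only depends on the values of the character at the
   [c i], which are roots of unity of order [e]; so there are finitely many. *)
pose orb := undup [seq y <- map val (enum {ffun 'I_d -> seq_sub r}) | `[< exists t, Gam t /\
  y = s t x >]].
have orbP y : y \in orb <-> exists t, Gam t /\ y = s t x.
  rewrite mem_undup mem_filter; split=> [/andP[/asboolP]//|H].
  apply/andP; split; first exact/asboolP.
  by have [t [/st[om Eo] ->]] := H; rewrite Eo; apply: map_f; rewrite mem_enum.
have uorb : uniq orb by exact: undup_uniq.
have G1 : Gam (fun=> 1) by split=> //; exact: char1.
have GM t t' : Gam t -> Gam t' -> Gam (fun w => t w * t' w).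
  move=> [ct tL] [ct' tL']; split; first exact: charM.
  by move=> y Ly; rewrite tL // tL' // mulr1.
have sx t : Gam t -> s t x = \sum_i a i * (iota (t (c i)) * z (c i)).
  move=> Gt; have [_ sz] := Hs t (proj1 Gt); rewrite Ea rmorph_sum.
  by apply: eq_bigr => i _; rewrite rmorphM (sfix _ _ Gt (La i)) sz.
have ss t t' : Gam t -> Gam t' -> s t (s t' x) = s (fun w => t w * t' w) x.
  move=> Gt Gt'; rewrite (sx _ Gt') (sx _ (GM _ _ Gt Gt')) rmorph_sum.
  have [si sz] := Hs t (proj1 Gt); apply: eq_bigr => i _.
  by rewrite !rmorphM (sfix _ _ Gt (La i)) sz si; ring.
pose q := \prod_(y <- orb) ('X - y%:P).
have xorb : x \in orb.
  by apply/orbP; exists (fun=> 1); split=> //; rewrite sx // Ea; apply: eq_bigr => i _;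
    rewrite rmorph1 mul1r.
have qfix t : Gam t -> map_poly (s t) q = q.
  move=> Gt; rewrite rmorph_prod /=.
  under eq_bigr => y _ do rewrite rmorphB /= map_polyX map_polyC /=.
  rewrite -(big_map (s t) xpredT (fun y => 'X - y%:P)) /=; apply: perm_big.
  have us : uniq (map (s t) orb) by rewrite map_inj_uniq //; exact: fmorph_inj.
  have sub : {subset map (s t) orb <= orb}.
    move=> _ /mapP[_ /orbP[t' [Gt' ->]] ->]; apply/orbP.
    by exists (fun w => t w * t' w); split; [exact: GM|exact: ss].
  have [|_ Ei] := uniq_min_size us sub; first by rewrite size_map.
  exact: uniq_perm.
have [F0 [j Hj]] := subfield_embedding (sf_tf iota z E).
have orbE y : y \in orb -> tf E y.
  move=> /orbP[t [Gt ->]]; rewrite sx //; apply: (sf_sum (sf_tf iota z E)) => i _.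
  apply: (sfM (sf_tf iota z E)); first exact: tf_sub (La i).
  by apply: (sfM (sf_tf iota z E)); [exact: tf_iota|exact: tf_mono].
have [q0 Eq] : exists q0, q = map_poly j q0.
  rewrite /q; elim: (orb) orbE => [|y o IH] oE.
    by exists 1; rewrite big_nil rmorph1.
  have [|q1 Eq1] := IH; first by move=> y' oy'; apply: oE; rewrite inE oy' orbT.
  have /Hj[y0 Ey] := oE y (mem_head _ _); exists (('X - y0%:P) * q1).
  by rewrite big_cons Eq1 rmorphM rmorphB /= map_polyX map_polyC /= Ey.
(* the fixed field: the coefficient at [c i] of a fixed element is zero unless
   [c i] is in [L], as some character moves [z (c i)] *)
have fixL v : tf E v -> (forall t, Gam t -> s t v = v) -> tf L v.
  move=> /(tf_cosets Hz sL sE Ec cE)[b [Lb Eb]] fv; rewrite Eb.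
  apply: (sf_sum (sf_tf iota z L)) => i _.
  have [Li|nLi] := EM (L (c i)); first by apply: (sfM (sf_tf iota z L)) => //; exact: tf_mono.
  have [t [ct tL ti]] := sep _ (Ec i) nLi; have Gt : Gam t by [].
  have S0 : \sum_l (b l * (iota (t (c l)) - 1)) * z (c l) = 0.
    transitivity (s t v - v); last by rewrite fv // subrr.
    rewrite {1}Eb rmorph_sum Eb -sumrB; apply: eq_bigr => l _.
    rewrite rmorphM (sfix _ _ Gt (Lb l)) (proj2 (Hs t ct)); ring.
  have := coset_indep_fin Hz sL Ec cE _ S0 i; rewrite -(rmorph1 iota) -rmorphB.
  move=> Hi; have /eqP : b i * iota (t (c i) - 1) = 0.
    apply: Hi => l; apply: (sfM (sf_tf iota z L)) => //.
    by rewrite -rmorphB; exact: tf_iota.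
  rewrite mulf_eq0 fmorph_eq0 subr_eq0 (negPf ti) orbF => /eqP->.
  by rewrite mul0r; exact: (sf0 (sf_tf iota z L)).
exists q; split; last by rewrite separable_prod_XsubC.
split=> [i|||q' Lq' q'x q'0].
- apply: fixL => [|t Gt]; first by apply/Hj; exists q0`_i; rewrite Eq coef_map.
  by rewrite -[in RHS](qfix t Gt) coef_map.
- exact: monic_prod_XsubC.
- by rewrite root_prod_XsubC.
rewrite size_prod_XsubC; apply: max_poly_roots => //.
apply/allP => _ /orbP[t [Gt ->]].
have <- : map_poly (s t) q' = q'.
  by apply/polyP => i; rewrite coef_map /= sfix.
by rewrite rootE horner_map (rootP q'x) rmorph0.
Qed.

End TorusSeparable.

Section LatticeFields.
Variables (k : closedFieldType) (K : fieldType) (iota : {rmorphism k -> K}).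
Variables (n : nat) (M : zmodType) (z : M -> K).
Hypothesis Hz : is_torus_field iota z.
Variables (co : {additive M -> 'rV[int]_n}) (co_bij : bijective co).
Variable D : 'I_n -> nat.
Local Notation tf := (torus_field iota z).
Local Notation L := (Lat co D).
Local Notation H := (Lat co (zero_or_one D)).

Lemma degree_Lat (E F r : 'I_n -> nat) :
  (forall i, F i = (E i * r i)%N) -> (forall i, (0 < r i)%N) ->
  (forall i, E i = 0%N -> r i = 1%N) ->
  ext_degree (tf (Lat co F)) (tf (Lat co E)) (\prod_i r i)%N.
Proof.
move=> FE r0 E0; have [c [Ec cE]] := index_Lat co_bij FE r0 E0.
by apply: (degree_cosets Hz (sg_Lat co F) (sg_Lat co E) Ec cE).
Qed.

Lemma separable_Lat (E F r : 'I_n -> nat) :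
  (forall i, F i = (E i * r i)%N) -> (forall i, (r i)%:R != 0 :> k) ->
  (forall i, E i = 0%N -> r i = 1%N) ->
  forall x, tf (Lat co E) x -> separable_over (tf (Lat co F)) x.
Proof.
move=> FE rk E0.
have r0 i : (0 < r i)%N by rewrite lt0n; apply: contraNneq (rk i) => ->.
have [c [Ec cE]] := index_Lat co_bij FE r0 E0.
have prod0 : (0 < \prod_i r i)%N by exact: prodn_gt0.
apply: (separable_cosets Hz (sg_Lat co F) (sg_Lat co E) _ Ec cE prod0).
- by move=> x; apply: Lat_sub => i; rewrite FE dvdn_mulr.
- move=> w Ew i; rewrite coMn (bigD1 i) //= FE !PoszM.
  by rewrite -mulrA [(r i)%:Z * _]mulrC; apply: dvdz_mul => //; exact/dvdz_mull/Ew.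
by move=> w; apply: (char_sep_Lat FE rk).
Qed.

Lemma finite_Lat : finite_torus_map iota z H L.
Proof.
have [c [Ec cE]] := index_Lat co_bij (zero_or_oneM D) (nonzero_factor_gt0 D)
  (@nonzero_factor1 n D).
exact: (finite_cosets Hz Ec cE).
Qed.

Lemma fibers_Lat : integral_fibers iota z H.
Proof.
have [e [He Ee]] := basis_vectors co_bij.
pose rho w := \sum_(i | D i == 0%N) e i *~ co w 0 i.
have rhoE w i : co (rho w) 0 i = if D i == 0%N then co w 0 i else 0.
  exact: (co_combination _ _ _ He).
apply: (fibers_integral Hz (rho := rho) (sg_Lat co _)).
- move=> a b; rewrite /rho -big_split; apply: eq_bigr => i _ /=.
  by rewrite raddfD mxE mulrzDr.
- move=> w; apply/Lat_zero_or_one => i Di.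
  by rewrite raddfB !mxE rhoE Di eqxx subrr.
- by move=> h /Lat_zero_or_one Hh; rewrite /rho big1 // => i /eqP/Hh->; rewrite mulr0z.
Qed.

Section Char_p.
Variable p : nat.
Hypothesis pk : p \in [pchar k].

Definition p_factor i := (if D i == 0 then 1 else (D i)`_p)%N.
Definition p'_factor i := (if D i == 0 then 1 else (D i)`_p^')%N.
(** The lattice between [L] and [H] with [L'/L] of order prime to [p] and
    [H/L'] a [p]-group. *)
Definition D_mid i := (if D i == 0 then 0 else (D i)`_p)%N.
Local Notation L' := (Lat co D_mid).

Lemma D_mid_p' i : D i = (D_mid i * p'_factor i)%N.
Proof. by rewrite /D_mid /p'_factor; case: eqP => [->//|/eqP Di]; rewrite partnC ?lt0n. Qed.

Lemma zero_or_one_p i : D_mid i = (zero_or_one D i * p_factor i)%N.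
Proof. by rewrite /D_mid /p_factor /zero_or_one; case: eqP => //; rewrite mul1n. Qed.

Lemma p'_factor_neq0 i : (p'_factor i)%:R != 0 :> k.
Proof.
rewrite -(dvdn_pcharf pk) /p'_factor; case: eqP => [_|_].
  by rewrite dvdn1 neq_ltn (prime_gt1 (pcharf_prime pk)) orbT.
rewrite -prime_coprime ?(pcharf_prime pk) //.
by rewrite (@pnat_coprime p) ?part_pnat // pnat_id ?(pcharf_prime pk).
Qed.

Lemma p_factor_gt0 i : (0 < p_factor i)%N.
Proof. by rewrite /p_factor; case: ifP => // _; exact: part_gt0. Qed.

Lemma p'_factor_gt0 i : (0 < p'_factor i)%N.
Proof. by rewrite /p'_factor; case: ifP => // _; exact: part_gt0. Qed.

(** By [separable_cosets] the field [k(L')] is separable over [k(L)];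
    conversely a power of Frobenius maps [k(H)] to [k(L')], so [insep_sep]
    applies. *)
Lemma sep_closure_Lat : sep_closure (tf L) (tf H) = tf L'.
Proof.
have pK : p \in [pchar K] by exact: (rmorph_pchar iota).
have LL' x : L x -> L' x.
  by apply: Lat_sub => i; rewrite D_mid_p' dvdn_mulr.
have L'H x : L' x -> H x.
  by apply: Lat_sub => i; rewrite zero_or_one_p dvdn_mulr.
apply/funext => x; apply/propext; split=> [[Hx sx]|L'x]; last first.
  split; first exact: tf_sub L'x.
  apply: (separable_Lat D_mid_p' p'_factor_neq0) L'x => i.
  by rewrite /D_mid /p'_factor; case: eqP => // _ /eqP; rewrite -leqn0 leqNgt part_gt0.
(* an exponent [p ^ e] that kills the p-group [H / L'] *)
pose e := (\sum_i logn p (D i))%N.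
apply: (insep_sep (sf_tf iota z L') _ pK sx (e := e)) => [y|]; first exact: tf_sub.
apply: (tf_frob Hz (sg_Lat co _) (sg_Lat co _) pK _ Hx) => w Hw i.
rewrite coMn /D_mid; case: eqP => [Di|_].
  by move/Lat_zero_or_one: Hw => /(_ i Di) ->; rewrite mulr0 dvdz0.
by rewrite p_part; apply: dvdz_mulr; rewrite dvdzE /= dvdn_exp2l // /e (bigD1 i) //= leq_addr.
Qed.

Lemma sep_degree_Lat : sep_degree (tf L) (tf H) (\prod_i p'_factor i)%N.
Proof.
rewrite /sep_degree sep_closure_Lat; apply: (degree_Lat D_mid_p' p'_factor_gt0) => i.
by rewrite /D_mid /p'_factor; case: eqP => // _ /eqP; rewrite -leqn0 leqNgt part_gt0.
Qed.

Lemma insep_degree_Lat : insep_degree (tf L) (tf H) (\prod_i p_factor i)%N.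
Proof.
rewrite /insep_degree sep_closure_Lat; apply: (degree_Lat zero_or_one_p p_factor_gt0) => i.
by rewrite /zero_or_one /p_factor; case: eqP.
Qed.

End Char_p.

(** * Separability of the extension of function fields *)

(** The basis monomials with divisor 0 form a transcendence basis, over which
    the other monomials are roots of order prime to the characteristic. *)
Lemma separable_ext_Lat_sufficient :
  (forall i, D i != 0%N -> (D i)%:R != 0 :> k) -> separable_ext (tf L).
Proof.
move=> Dk; have [e [He Ee]] := basis_vectors co_bij.
pose b (i : 'I_#|[pred i | D i == 0%N]|) := z (e (enum_val i)).
exists #|[pred i | D i == 0%N]|, b; split.
  move=> P LP; rewrite mevalE => P0; apply/eqP; rewrite -msupp_eq0.
  case E : (msupp P) => [//|m s]; have ms : m \in msupp P by rewrite E mem_head.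
  pose c (a : 'X_{1..#|[pred i | D i == 0%N]|}) := \sum_i e (enum_val i) *+ a i.
  have cE a l : co (c a) 0 (enum_val l) = (a l)%:Z.
    rewrite co_sum (bigD1 l) //= big1 ?addr0 => [|j jl]; rewrite coMn He mxE eqxx.
      by rewrite eqxx mulr1.
    by rewrite (inj_eq enum_val_inj) eq_sym (negPf jl) mulr0.
  have := @coset_indep _ _ _ _ _ Hz L _ (msupp P) c (fun a => P@_a) (sg_Lat co D) (msupp_uniq
    P).
  move=> Hi; suff : P@_m = 0 by move: ms; rewrite mcoeff_msupp => /eqP.
  apply: Hi ms => // [a a' _ _ Laa'|].
    apply/mnmP => l; have /eqP Dl := enum_valP l.
    have := Laa' (enum_val l); rewrite raddfB !mxE !cE.
    by have := enum_valP l; rewrite inE => /eqP->; rewrite dvd0z subr_eq0 eqz_nat => /eqP.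
  rewrite -[RHS]P0; apply: eq_bigr => a _; congr (_ * _); rewrite (monom_sum Hz).
  by apply: eq_bigr => i _; rewrite (monomMn Hz).
pose D0 := nonzero_factor D.
have -> : field_gen (fun y => tf L y \/ family_set b y) = tf (Lat co D0).
  have LD0 x : L x -> Lat co D0 x.
    by apply: Lat_sub => i; rewrite /D0 /nonzero_factor; case: eqP => // _; exact: dvd1n.
  apply/funext => x; apply/propext; split.
    apply=> [|y [Ly|[i ->]]]; first exact: sf_tf.
      exact: tf_sub Ly.
    apply: tf_mono => l; rewrite /D0 /nonzero_factor; case: eqP => [_|Dl]; first exact: dvd1z.
    rewrite He mxE eqxx; case: eqP => [E|_]; last by rewrite dvdz0.
    by have := enum_valP i; rewrite inE -E => /eqP.
  apply=> [|y [[c ->]|[w [Dw ->]]]]; first exact: sf_gen.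
    by apply: sub_field_gen; left; exact: tf_iota.
  have sF := sf_gen (fun y => tf L y \/ family_set b y).
  rewrite (Ee w) (monom_sum Hz) (bigID (fun i => D i == 0%N)) /=.
  apply: (sfM sF); last first.
    rewrite -(monom_sum Hz); apply: sub_field_gen; left; apply: tf_mono.
    apply: (sg_sum (sg_Lat co D)) => i Di l.
    rewrite coMz He mxE eqxx /=.
    case: eqP => [->|_]; last by rewrite mulr0 dvdz0.
    by rewrite mulr1; have := Dw i; rewrite /D0 /nonzero_factor (negPf Di).
  apply: (sf_prod sF) => i Di; rewrite (monomMz Hz); apply: (sfXz sF).
  apply: sub_field_gen; right.
  have iD : i \in [pred i | D i == 0%N] by [].
  by exists (enum_rank_in iD i); rewrite /b enum_rankK_in.
move=> x; have : tf (Lat co (fun=> 1%N)) x.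
  by apply: tf_sub (tf_full Hz x) => y _ i; rewrite dvd1z.
apply: (@separable_Lat (fun=> 1%N) D0 D0) => // i; first by rewrite mul1n.
by rewrite /D0 /nonzero_factor; case: (eqVneq (D i) 0%N) => [_|Di];
  [rewrite oner_eq0|exact: Dk].
Qed.

(** If [p] divides an elementary divisor, some monomial outside [L] has its
    [p]-th power in [L]. If the extension was separable, that monomial would be
    in the field generated by a transcendence basis, by [insep_sep], hence a
    fraction of polynomials in that basis; comparing leading coefficients, it
    would even lie in [k(L)], against [coset_indep]. *)
Lemma separable_ext_Lat_necessary :
  separable_ext (tf L) -> forall i, D i != 0%N -> (D i)%:R != 0 :> k.
Proof.
move=> [m [b [ind sep]]] i Di; apply/negP => Dk.
have [e [He Ee]] := basis_vectors co_bij.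
have [p pk] : exists p, p \in [pchar k] by apply: natf0_pchar Dk; rewrite lt0n.
have pK : p \in [pchar K] by exact: (rmorph_pchar iota).
have pD : (p %| D i)%N by rewrite (dvdn_pcharf pk).
have p0 := prime_gt0 (pcharf_prime pk).
pose w := e i *+ (D i %/ p).
have Lpw : L (w *+ p).
  by rewrite /w -mulrnA divnK //; exact: Lat_basis.
have nLw : ~ L w.
  move=> /(_ i); rewrite /w coMn He mxE !eqxx mulr1 dvdzE /=.
  move=> /dvdn_leq; rewrite divn_gt0 // dvdn_leq ?lt0n // => /(_ isT).
  by rewrite leqNgt ltn_Pdiv ?lt0n // prime_gt1 // (pcharf_prime pk).
have nLz : ~ tf L (z w).
  move=> Lz; pose c (x : bool) := if x then w else 0.
  pose a (x : bool) := if x then -1 else z w.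
  have := @coset_indep _ _ _ _ _ Hz L _ [:: true; false] c a (sg_Lat co D) isT.
  have sF := sf_tf iota z L.
  move=> H0; have /eqP : a true = 0.
    apply: H0 => //.
    - move=> [] [] _ _ //=; rewrite /c ?subr0 ?sub0r // => Lw; case: nLw => //.
      by rewrite -[w]opprK; exact: (sgN (sg_Lat co D)).
    - by move=> [] _; rewrite /a //; apply: (sfN sF); exact: (sf1 sF).
    - by rewrite big_cons big_seq1 /a /c (monom0 Hz) mulr1 mulN1r addNr.
  by rewrite oppr_eq0 oner_eq0.
have [F0 [j Hj]] := subfield_embedding (sf_tf iota z L).
set F1 := field_gen _ in sep.
have sF1 : is_subfield F1 by exact: sf_gen.
have LF1 x : tf L x -> F1 x by move=> Lx; apply: sub_field_gen; left.
have Lzp : tf L (z w ^+ p) by rewrite -(monomMn Hz); exact: tf_mono.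
have F1y : F1 (z w).
  by apply: (insep_sep sF1 _ pK (sep (z w)) (e := 1%N)) => //; rewrite expn1; exact: LF1.
pose evb (P : {mpoly F0[m]}) := (map_mpoly j P).@[b].
have [P [Q [Q0 Ey]]] : exists P Q, evb Q != 0 /\ z w = evb P / evb Q.
  apply: (F1y (fun y => exists P Q, evb Q != 0 /\ y = evb P / evb Q)) => [|y].
    have e1 : evb 1 = 1 by rewrite /evb !rmorph1.
    have eM A B : evb (A * B) = evb A * evb B by rewrite /evb !rmorphM.
    have eB A B : evb (A - B) = evb A - evb B by rewrite /evb !rmorphB.
    have e0 : evb 0 = 0 by rewrite /evb !rmorph0.
    split.
    - by exists 1, 1; rewrite e1 oner_eq0 divr1.
    - move=> _ _ [A [B [B0 ->]]] [A' [B' [B'0 ->]]].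
      exists (A * B' - A' * B), (B * B'); rewrite eB !eM mulf_neq0 //; split=> //.
      by field; rewrite B0 B'0.
    - move=> _ _ [A [B [B0 ->]]] [A' [B' [B'0 ->]]].
      have [A'0|A'0] := eqVneq (evb A') 0.
        by exists 0, 1; rewrite e1 e0 oner_eq0 A'0 !mul0r invr0 mulr0.
      exists (A * B'), (B * A'); rewrite !eM mulf_neq0 //; split=> //.
      by field; rewrite B0 B'0 A'0.
  move=> [/Hj[c ->]|[l ->]].
    by exists c%:MP, 1; rewrite /evb !rmorph1 oner_eq0 divr1 map_mpolyC mevalC.
  by exists 'X_l, 1; rewrite /evb !rmorph1 oner_eq0 divr1 map_mpolyX mevalXU.
have [a Ea] := proj1 (Hj _) Lzp.
have zw0 : z w != 0 by exact: (monom_neq0 Hz).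
(* by the algebraic independence of the transcendence basis *)
have PQ : P ^+ p = a *: Q ^+ p.
  have mapinj (A : {mpoly F0[m]}) : map_mpoly j A = 0 -> A = 0.
    move=> A0; apply/mpolyP => c; apply: (fmorph_inj j).
    by rewrite -mcoeff_map_mpoly A0 !mcoeff0 rmorph0.
  apply/eqP; rewrite -subr_eq0; apply/eqP/mapinj/ind => [c|].
    by rewrite mcoeff_map_mpoly; apply/Hj; eexists.
  have -> : (map_mpoly j (P ^+ p - a *: Q ^+ p)).@[b] = evb P ^+ p - j a * evb Q ^+ p.
    by rewrite -mul_mpolyC !(rmorphB, rmorphM, rmorphXn) /= map_mpolyC /= mevalC.
  by rewrite -Ea Ey expr_div_n divfK ?subrr // expf_neq0.
have a0 : a != 0 by apply: contraNneq zw0 => E; move: Ea; rewrite E rmorph0 => /eqP;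
  rewrite expf_eq0 => /andP[].
have Qn0 : Q != 0 by apply: contraNneq Q0 => ->; rewrite /evb !rmorph0.
have Pn0 : P != 0.
  by apply: contraNneq zw0 => E; rewrite Ey E /evb !rmorph0 mul0r.
have El : mleadc P ^+ p = a * mleadc Q ^+ p.
  have Em : (mlead P *+ p = mlead Q *+ p)%MM.
    by rewrite -!mleadX // PQ mleadZ.
  by rewrite -!mleadcX Em PQ mcoeffZ.
apply: nLz; apply/Hj; exists (mleadc P / mleadc Q).
apply: (frob_inj (e := 1%N) pK); rewrite expn1 Ea -rmorphXn; congr (j _).
by rewrite expr_div_n El mulfK // expf_neq0 // mleadc_eq0.
Qed.

End LatticeFields.

(** * The function field of the toric variety *)

Section FunctionField.
Variables (k : closedFieldType) (n N : nat) (M : zmodType).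
Variables (co : {additive M -> 'rV[int]_n}) (co_bij : bijective co).
Variables (u : 'I_N.+1 -> M).
Hypothesis Aff_A : forall x : M, Aff (family_set u) x.
Variables (K : fieldType) (iota : {rmorphism k -> K}) (xi : 'rV[K]_N.+1).
Local Notation char := (torus_point (k := k) (@full M)).
Local Notation X := (toric_variety (k := k) u).
Local Notation pidx := (plucker_index n N).
Local Notation L := (diff_group (Bset k co u)).
Local Notation bs j := (vertex_sum u (enum_val (j : 'I_#|pidx|))).
Local Notation cj j := (pcoef k co u (enum_val (j : 'I_#|pidx|))).
Hypothesis Hxi : is_function_field iota X xi.

Lemma ev_map (P : {mpoly k[N.+1]}) :
  ev (map_mpoly iota P) xi = \sum_(a <- msupp P) iota P@_a * mon xi a.
Proof.
rewrite {1}[P]mpolyE raddf_sum /ev raddf_sum /=; apply: eq_bigr => a _.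
by rewrite -mul_mpolyC rmorphM /= map_mpolyC /= map_mpolyX mevalM mevalC mevalX.
Qed.

Lemma ev_map_mon a : ev (map_mpoly iota 'X_[a]) xi = mon xi a.
Proof. by rewrite map_mpolyX evX. Qed.

Lemma generic_toric_eq a b : meq u a b -> mon xi a = mon xi b.
Proof.
move=> [ed ew]; apply/eqP; rewrite -subr_eq0 -!ev_map_mon -evB -rmorphB.
apply/eqP/(generic_ideal Hxi (homog_binom k ed)).
apply: (toric_vanish co_bij) => nu t nu0 ct.
by rewrite evB !evX !mon_cone // ed ew subrr.
Qed.

Lemma generic_neq0 d (P : {mpoly k[N.+1]}) x : P \is d.-homog -> X x ->
  ev P x != 0 -> ev (map_mpoly iota P) xi != 0.
Proof.
move=> hP Xx; apply: contra => /eqP E; apply/eqP.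
by have /(_ x Xx) := proj2 (generic_ideal Hxi hP) E.
Qed.

Lemma xi_neq0 j : xi 0 j != 0.
Proof.
rewrite -(monU xi j) -ev_map_mon; apply: (generic_neq0 (d := 1%N) (x := phi u (fun=> 1))).
- by rewrite dhomogX /= mdeg1.
- exact/toric_phi/char1.
by rewrite evX monU mxE oner_eq0.
Qed.

Lemma generic_relation (la : 'I_N.+1 -> int) :
  \sum_j la j = 0 -> \sum_j u j *~ la j = 0 -> \prod_j xi 0 j ^ la j = 1.
Proof.
move=> s0 w0; have [a [b [ab E]]] := relation_split s0 w0.
have m0 : mon xi b != 0.
  by rewrite mon_eq0; apply/existsP => -[i]; rewrite (negPf (xi_neq0 i)).
under eq_bigr => j _ do rewrite E expfzDr ?xi_neq0 // -invr_expz -!exprnP.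
by rewrite big_split prodfV /= -/(mon xi a) -/(mon xi b) (generic_toric_eq ab) divff.
Qed.

(** Since [A] generates [M], integer combinations of the logarithms of the
    coordinates of the generic point define the character [z];
    [generic_relation] shows that the choices do not matter. *)
Lemma generic_point : exists kap z, [/\ kap != 0, z 0 = 1,
  forall a b, z (a + b) = z a * z b & forall j, xi 0 j = kap * z (u j)].
Proof.
have /choice[s Hs] x : exists s : 'I_N.+1 -> int, \sum_j s j = 0 /\ x = \sum_j u j *~ s j.
  by have [s ? ?] := gen_family Aff_A 0 x; exists s.
have [c c1 c0] := gen_family Aff_A 1 0.
exists (\prod_j xi 0 j ^ c j), (fun x => \prod_j xi 0 j ^ s x j).
have xi0 := xi_neq0; split.
- by apply/prodf_neq0 => j _; exact: expfz_neq0.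
- by apply: generic_relation; [exact: (proj1 (Hs 0))|rewrite -(proj2 (Hs 0))].
- move=> a b; have /= := generic_relation (la := fun j => s (a + b) j - s a j - s b j).
  rewrite !sumrB !(proj1 (Hs _)) !subr0 => /(_ erefl).
  under eq_bigr => j _ do rewrite !mulrzBr.
  rewrite !sumrB -!(proj2 (Hs _)) addrAC addrK subrr => /(_ erefl).
  under eq_bigr => j _ do rewrite !expfzDr // -!invr_expz.
  rewrite !big_split !prodfV /= => H.
  have nz v : \prod_j xi 0 j ^ s v j != 0 by apply/prodf_neq0 => j _; exact: expfz_neq0.
  move/(canRL (mulfVK (nz b)))/(canRL (mulfVK (nz a))): H => ->.
  by rewrite mul1r mulrC.
move=> j; have /= := generic_relation (la := fun l => (l == j)%:Z - c l - s (u j) l).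
rewrite !sumrB c1 !(proj1 (Hs _)) (bigD1 j) //= eqxx big1 ?addr0; last by move=> l /negPf->.
move=> /(_ erefl); under eq_bigr => l _ do rewrite !mulrzBr.
rewrite !sumrB -c0 -(proj2 (Hs _)) (bigD1 j) //= eqxx mulr1z big1 ?addr0; last first.
  by move=> l /negPf->.
rewrite subr0 subrr => /(_ erefl); under eq_bigr => l _ do rewrite !expfzDr // -!invr_expz.
rewrite !big_split !prodfV /= => H.
have nz (v : 'I_N.+1 -> int) : \prod_j xi 0 j ^ v j != 0 by apply/prodf_neq0 => l _;
  exact: expfz_neq0.
move/(canRL (mulfVK (nz _)))/(canRL (mulfVK (nz _))): H.
rewrite mul1r (bigD1 j) //= eqxx expr1z big1 ?mulr1 => [->|l /negPf->]; last by rewrite expr0z.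
by rewrite mulrC.
Qed.

Section Generic.
Variables (kap : K) (z : M -> K).
Hypotheses (kap0 : kap != 0) (z00 : z 0 = 1).
Hypothesis zadd : forall a b, z (a + b) = z a * z b.
Hypothesis Exi : forall j, xi 0 j = kap * z (u j).

Lemma mon_xi a : mon xi a = kap ^+ mdeg a * z (wt u a).
Proof.
have zMn' x d : z (x *+ d) = z x ^+ d.
  by elim: d => [|d IH]; rewrite ?mulr0n ?z00 // mulrS zadd IH exprS.
rewrite mdegEo -prodrXr /wt (big_morph z zadd z00) -big_split.
by apply: eq_bigr => j _; rewrite Exi exprMn zMn'.
Qed.

(** A relation between monomials becomes, after multiplication by a monomial, a
    form that vanishes at the generic point, hence on the torus. *)
Lemma generic_torus_field : is_torus_field iota z.
Proof.
split=> //.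
- move=> l w c winj S0 i.
  have /fin_all_exists[s Hs] i' : exists s : 'I_N.+1 -> int, \sum_j s j = 0 /\ w i' = \sum_j
    u j *~ s j.
    by have [s ? ?] := gen_family Aff_A 0 (w i'); exists s.
  have [T leT] := shift_nonneg s.
  pose m i' : 'X_{1..N.+1} := [multinom `|(s i' j + T%:Z)%R|%N | j < N.+1].
  have mE i' j : (m i' j)%:Z = s i' j + T%:Z by rewrite mnmE gez0_abs.
  have dm i' : mdeg (m i') = (N.+1 * T)%N.
    apply/eqP; rewrite -eqz_nat mdegEo (big_morph _ PoszD (erefl _)).
    under eq_bigr => j _ do rewrite mE.
    rewrite big_split /= (proj1 (Hs i')) add0r sumr_const card_ord.
    by rewrite -mulr_natl natz PoszM.
  have wm i' : wt u (m i') = w i' + (\sum_j u j) *+ T.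
    rewrite (proj2 (Hs i')) -sumrMnl -big_split; apply: eq_bigr => j _ /=.
    by rewrite !pmulrn mE mulrzDr.
  pose P : {mpoly k[N.+1]} := \sum_i c i *: 'X_[m i].
  have hP : P \is (N.+1 * T).-homog.
    by apply: rpred_sum => i' _; apply: dhomogZ; rewrite dhomogX /= dm.
  have z_neq0' a : z a != 0.
    apply/eqP => E; have := zadd a (- a); rewrite subrr z00 E mul0r => /eqP.
    by rewrite oner_eq0.
  have /(generic_ideal Hxi hP) VP : ev (map_mpoly iota P) xi = 0.
    rewrite /P raddf_sum /ev raddf_sum /=.
    transitivity ((\sum_i iota (c i) * z (w i)) * (kap ^+ (N.+1 * T) * z ((\sum_j u j) *+ T))).
      rewrite mulr_suml; apply: eq_bigr => i' _.
      rewrite -mul_mpolyC rmorphM /= map_mpolyC /= map_mpolyX mevalM mevalC.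
      rewrite -/(ev _ _) evX mon_xi dm wm zadd; ring.
    by rewrite S0 mul0r.
  have H : forall v, \sum_(a <- enum 'I_l | (0%N, w a) == v) c a = 0.
    apply: (cone_group co_bij) => nu t nu0 ct; rewrite big_enum /=.
    have := VP _ (toric_phi u ct); rewrite /P /ev raddf_sum /= => E.
    apply: (mulIf (char_neq0 ((\sum_j u j) *+ T) ct)); rewrite mul0r -[RHS]E mulr_suml.
    apply: eq_bigr => i' _; rewrite mevalZ -/(ev _ _) evX mon_phi // wm charD //; ring.
  have := H (0%N, w i); rewrite big_mkcond (bigD1_seq i) ?mem_enum ?enum_uniq //= eqxx.
  rewrite big1 ?addr0 // => i' ne; case: eqP => // -[/winj E].
  by rewrite E eqxx in ne.
- move=> x; have [d [P [Q [hP hQ Q0 ->]]]] := generic_fractions Hxi x.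
  pose f (R : {mpoly k[N.+1]}) := fsum iota z [seq (R@_a, wt u a) | a <- msupp R].
  have fE R : R \is d.-homog -> ev (map_mpoly iota R) xi = kap ^+ d * f R.
    move=> /dhomogP hR; rewrite ev_map /f /fsum (big_map (fun a => (R@_a, wt u a))) mulr_sumr.
    by apply: eq_big_seq => a /hR <-; rewrite mon_xi mulrCA.
  exists (f P), (f Q); split; try by apply/gaP; eexists.
    by move: Q0; rewrite fE // mulf_eq0 negb_or => /andP[].
  by rewrite !fE // -mulf_div divff ?mul1r // expf_neq0.
Qed.

(** All representatives of the Gauss map are proportional at the generic point
    to the canonical one, whose coordinates are the monomials [z^b] up to
    constants; their ratios generate [k(L)]. *)
Lemma image_field_gauss (f : 'I_#|pidx| -> {mpoly k[N.+1]}) :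
  represents X (gauss n X) f -> image_field iota f xi = torus_field iota z L.
Proof.
have Hz := generic_torus_field.
move=> [[d hf] [dQ [Q [hQ [xQ [XxQ QxQ]] HQ]]]].
pose y j := ev (map_mpoly iota (f j)) xi.
pose gK j := ev (map_mpoly iota (gpoly k co u j)) xi.
have Qxi := generic_neq0 hQ XxQ QxQ.
have gKE j : gK j = iota (cj j) * (kap ^+ n.+1 * z (bs j)).
  rewrite /gK /gpoly -mul_mpolyC rmorphM /= map_mpolyC /= map_mpolyX /ev mevalM mevalC.
  by rewrite -/(ev _ _) evX mon_xi mdeg_fmon wt_fmon.
(* The two representatives are proportional at every point with invertible
   coordinates outside [Q = 0]. *)
have prop i j : y i * gK j = y j * gK i.
  pose R := f i * gpoly k co u j - f j * gpoly k co u i.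
  have hR : R \is (d + n.+1).-homog.
    by apply: rpredB; apply: dhomogM; rewrite ?hf ?gpoly_homog.
  have hF : 'X_[full_mon N] * Q * R \is (mdeg (full_mon N) + dQ + (d + n.+1)).-homog.
    by apply: dhomogM => //; apply: dhomogM => //; rewrite dhomogX /=.
  have VF : vanishes X ('X_[full_mon N] * Q * R).
    move=> x Xx; rewrite !evM evX.
    have [->|] := eqVneq (mon x (full_mon N)) 0; first by rewrite !mul0r.
    rewrite mon_full_mon => /forallP x0.
    have [->|Qx] := eqVneq (ev Q x) 0; first by rewrite mulr0 mul0r.
    have /(toricP co_bij)[_ Hx] := Xx.
    have /(gauss_unit co_bij Aff_A _ x0 Hx)[mu _ /rowP E] := HQ x Xx Qx.
    have Ef l : ev (f l) x = mu * ev (gpoly k co u l) x.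
      by have := E l; rewrite -ev_gpoly !mxE.
    by rewrite /R evB !evM !Ef; ring.
  have := proj1 (generic_ideal Hxi hF) VF.
  rewrite !rmorphM /= /ev !mevalM -!/(ev _ _) => /eqP; rewrite !mulf_eq0 (negPf Qxi) orbF.
  have -> : (ev (map_mpoly iota 'X_[full_mon N]) xi == 0) = false.
    apply/negbTE; rewrite ev_map_mon mon_eq0; apply/existsP => -[l].
    by rewrite (negPf (xi_neq0 l)).
  rewrite /R rmorphB !rmorphM /= /ev mevalB !mevalM subr_eq0 => /eqP; exact.
(* otherwise all Pluecker coordinates would vanish at [xQ] *)
have [j1 yj1] : exists j, y j != 0.
  apply: contrapT => H.
  have Vf j : vanishes X (f j).
    apply/(generic_ideal Hxi (hf j)); apply: contrapT => /eqP nz; apply: H.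
    by exists j.
  have [_ [W [fW _ EW]]] := HQ xQ XxQ QxQ.
  have [g dg] := row_free_minor fW; case/negP: dg; apply/eqP.
  have := congr1 (fun v : 'rV[k]_#|pidx| => v 0 (enum_rank g)) EW.
  by rewrite !mxE enum_rankK Vf.
have [j0 cj0] := exists_spanning k co_bij Aff_A.
have zn0 a : z a != 0 by exact: (monom_neq0 Hz).
have gK_neq0 j : (gK j != 0) = (cj j != 0).
  by rewrite gKE mulf_eq0 fmorph_eq0 negb_or mulf_neq0 ?andbT // expf_neq0.
have gj1 : gK j1 != 0.
  have : y j1 * gK j0 != 0 by rewrite mulf_neq0 // gK_neq0.
  by rewrite prop mulf_eq0 negb_or => /andP[].
pose la := y j1 / gK j1.
have la0 : la != 0 by rewrite mulf_neq0 // invr_eq0.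
have Ey j : y j = la * gK j.
  by apply: (mulIf gj1); rewrite -prop /la; field.
have ratio i j : cj j != 0 -> y i / y j = iota (cj i / cj j) * z (bs i - bs j).
  move=> c0; have A0 : kap ^+ n.+1 != 0 by rewrite expf_neq0.
  have ic0 : iota (cj j) != 0 by rewrite fmorph_eq0.
  rewrite !Ey !gKE fmorph_div (monomD Hz) (monomN Hz).
  move: (kap ^+ n.+1) (iota (cj j)) A0 ic0 (zn0 (bs j)) => A c A0 ic0 zj0.
  by field; rewrite la0 A0 ic0 zj0.
have rowE (j : 'I_#|pidx|) : ev_tuple (fun j => map_mpoly iota (f j)) xi 0 j = y j.
  by rewrite mxE.
have y_neq0 j : (y j != 0) = (cj j != 0) by rewrite Ey mulf_eq0 (negPf la0) gK_neq0.
apply/funext => x; apply/propext; split=> Hx.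
  apply: (Hx (torus_field iota z L)) => [|_ [[c ->]|[i [j [yj ->]]]]]; first exact: sf_tf.
    exact: tf_iota.
  rewrite !rowE y_neq0 in yj *; rewrite ratio //.
  have [->|ci] := eqVneq (cj i) 0.
    by rewrite mul0r rmorph0 mul0r; exact: (sf0 (sf_tf iota z L)).
  apply: (sfM (sf_tf iota z L)); first exact: tf_iota.
  by apply: tf_mono; apply: diff_in_L.
have sF : is_subfield (image_field iota f xi) by exact: sf_gen.
apply: (Hx (image_field iota f xi)) => // _ [[c ->]|[a [La ->]]].
  by apply: sub_field_gen; left; exists c.
move: La; apply: (@gen_sub _ _ (fun a => image_field iota f xi (z a))).
  split; first by rewrite (monom0 Hz); exact: (sf1 sF).
  by move=> a1 a2 F1 F2; rewrite (monomD Hz) (monomN Hz); exact: (sf_div sF).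
move=> _ [b [b' [/BsetP[i ci ->] /BsetP[j cj' ->] ->]]].
have -> : z (bs i - bs j) = iota (cj j / cj i) * (y i / y j).
  rewrite ratio // mulrA -rmorphM (_ : cj j / cj i * (cj i / cj j) = 1).
    by rewrite rmorph1 mul1r.
  by field; rewrite ci cj'.
apply: (sfM sF); first by apply: sub_field_gen; left; exists (cj j / cj i).
by apply: sub_field_gen; right; exists i, j; rewrite !rowE y_neq0.
Qed.

End Generic.
End FunctionField.

(** * The theorem *)

Section Assembly.
Variables (k : closedFieldType) (n N : nat) (M : zmodType).
Variables (co : {additive M -> 'rV[int]_n}) (co_bij : bijective co).
Variables (u : 'I_N.+1 -> M).
Hypothesis Aff_A : forall x : M, Aff (family_set u) x.
Local Notation pidx := (plucker_index n N).
Local Notation L := (diff_group (Bset k co u)).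
Local Notation bs j := (vertex_sum u (enum_val (j : 'I_#|pidx|))).
Local Notation cj j := (pcoef k co u (enum_val (j : 'I_#|pidx|))).
Variable j0 : 'I_#|pidx|.
Hypothesis cj0 : cj j0 != 0.

(** Generators of [<B - B>]; the indices of the Pluecker coordinates that
    vanish get the value 0, so that the family is indexed by a fixed type. *)
Definition gen_L (j : 'I_#|pidx|) : M := if cj j != 0 then bs j - bs j0 else 0.

Lemma gen_L_in j : L (gen_L j).
Proof.
rewrite /gen_L; case: ifP => [c0|_]; last exact: (sg0 (sg_gen _)).
exact: diff_in_L.
Qed.

Lemma L_sub (G : M -> Prop) : is_subgroup G -> (forall j, G (gen_L j)) ->
  forall x, L x -> G x.
Proof.
move=> sG HG x; apply: (gen_sub sG) => _ [b [b' [/BsetP[i ci ->] /BsetP[j cj' ->] ->]]].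
have -> : bs i - bs j = gen_L i - gen_L j.
  by rewrite /gen_L ci cj' opprB addrA subrK.
exact: sgB.
Qed.

Lemma L_combinations x : L x <-> exists a : 'I_#|pidx| -> int, x = \sum_j gen_L j *~ a j.
Proof.
split=> [|[a ->]]; last first.
  by apply: (sg_sum (sg_gen _)) => j _; apply: (sgMz (sg_gen _)); exact: gen_L_in.
apply: (@L_sub (fun x => exists a : 'I_#|pidx| -> int, x = \sum_j gen_L j *~ a j)).
  split; first by exists (fun=> 0); rewrite big1.
  move=> _ _ [a ->] [b ->]; exists (fun j => a j - b j).
  by rewrite -sumrB; apply: eq_bigr => j _; rewrite mulrzBr.
move=> j; exists (fun i => (i == j)%:Z).
by rewrite (bigD1 j) //= eqxx mulr1z big1 ?addr0 // => i /negPf->.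
Qed.

Lemma baseB (F : pzRingType) x y : base F co (x - y) = base F co x - base F co y.
Proof. by rewrite /base raddfB map_mxB. Qed.

Lemma rank_Bdiff (co' : {additive M -> 'rV[int]_n}) (R : 'M[int]_n) D :
  bijective co' -> R \in unitmx -> (forall x, co x = co' x *m R) ->
  (forall x, L x <-> Lat co' D x) ->
  \rank (Bdiff k co u j0) = #|[pred i | (D i)%:R != 0 :> k]|.
Proof.
move=> co'_bij uR coR LD.
have rowB j : row j (Bdiff k co u j0) = base k co (gen_L j).
  rewrite rowK /gen_L; case: ifP => _; first by rewrite baseB.
  by rewrite /base raddf0 map_mx0.
apply: (rank_Lat_over co'_bij uR coR LD) => [x|j]; last first.
  by exists (gen_L j); [exact: gen_L_in|exact: rowB].
apply: (@L_sub (fun x => is_true (base k co x <= Bdiff k co u j0)%MS)) => [|j]; last first.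
  by rewrite -rowB row_sub.
split; first by rewrite /base raddf0 map_mx0 sub0mx.
by move=> y z Hy Hz; rewrite baseB addmx_sub ?eqmx_opp.
Qed.

End Assembly.

Section Arithmetic.
Variables (n : nat) (D : 'I_n -> nat) (p : nat).
Hypothesis p_prime : prime p.

Lemma nonzero_factor_p i :
  nonzero_factor D i = (p_factor D p i * p'_factor D p i)%N.
Proof.
by rewrite /nonzero_factor /p_factor /p'_factor; case: eqP => // /eqP Di; rewrite partnC ?lt0n.
Qed.

Lemma prod_p_factor : (\prod_i p_factor D p i = p ^ (\sum_i logn p (nonzero_factor D i)))%N.
Proof.
rewrite expn_sum; apply: eq_bigr => i _; rewrite /p_factor /nonzero_factor.
by case: eqP => _; rewrite ?logn1 // p_part.
Qed.

Lemma coprime_p'_factor : coprime (\prod_i p'_factor D p i)%N p.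
Proof.
elim/big_ind: _ => [|x y cx cy|i _]; rewrite ?coprime1n ?coprimeMl ?cx //.
rewrite /p'_factor; case: eqP => _; first exact: coprime1n.
by rewrite coprime_sym (@pnat_coprime p) ?part_pnat // pnat_id.
Qed.

Lemma max_p_power s : (p ^ s %| \prod_i nonzero_factor D i)%N ->
  (forall s', (p ^ s' %| \prod_i nonzero_factor D i)%N -> (s' <= s)%N) ->
  (p ^ s = \prod_i p_factor D p i)%N /\
  (\prod_i nonzero_factor D i %/ p ^ s = \prod_i p'_factor D p i)%N.
Proof.
have E : (\prod_i nonzero_factor D i = (\prod_i p_factor D p i) * \prod_i p'_factor D p i)%N.
  by rewrite -big_split; apply: eq_bigr => i _; exact: nonzero_factor_p.
rewrite E; move=> ps smax.
have es := smax _ (_ : p ^ (\sum_i logn p (nonzero_factor D i)) %| _)%N.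
rewrite -prod_p_factor dvdn_mulr // in es; have {}es := es isT.
have se : (s <= \sum_i logn p (nonzero_factor D i))%N.
  rewrite Gauss_dvdl ?coprimeXl 1?coprime_sym ?coprime_p'_factor // in ps.
  by rewrite prod_p_factor dvdn_Pexp2l ?prime_gt1 in ps.
have {es se}-> : s = (\sum_i logn p (nonzero_factor D i))%N by apply/eqP; rewrite eqn_leq se es.
rewrite -prod_p_factor; split=> //; rewrite mulKn // prod_p_factor expn_gt0.
by rewrite prime_gt0.
Qed.

End Arithmetic.

Theorem corollary3p5 (k : closedFieldType) (R : realType) (n N : nat)
    (M : zmodType) (co : {additive M -> 'rV[int]_n}) (co_bij : bijective co)
    (u : 'I_N.+1 -> M) (u_inj : injective u)
    (Aff_A : forall x : M, Aff (family_set u) x) :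
  let X := toric_variety (k := k) u in
  let gamma := gauss n X in
  let B := Bset k co u in
  let L := diff_group B in
  let H := real_span_cap R co L in
  (* the decomposition T_M -> T_H -> T_L of gamma on T_M *)
  [/\ gauss_on_torus k co u,
      forall (K : fieldType) (iota : {rmorphism k -> K}) (z : M -> K),
        is_torus_field iota z ->
        integral_fibers iota z H /\ finite_torus_map iota z H L,
  (* (1) *)
      exists r s : nat,
        [/\ aff_dim (Aff_over (F := k) co B) r,
            rk_Aff B s,
            rational_map_rank X gamma r
          & forall (K : fieldType) (iota : {rmorphism k -> K})
              (xi : 'rV[K]_N.+1),
            is_function_field iota X xi ->
            (separable_rational_map iota X gamma xi <-> r = s)]
  (* (2) *)
    & forall p : nat, p \in [pchar k] ->
      exists d : nat,
        [/\ group_index H L d,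
            forall (K : fieldType) (iota : {rmorphism k -> K}) (z : M -> K),
              is_torus_field iota z ->
              ext_degree (torus_field iota z L) (torus_field iota z H) d
          & forall s : nat,
            (p ^ s %| d)%N -> (forall s', (p ^ s' %| d)%N -> (s' <= s)%N) ->
            [/\ forall (K : fieldType) (iota : {rmorphism k -> K}) (z : M -> K),
                  is_torus_field iota z ->
                  sep_degree (torus_field iota z L) (torus_field iota z H)
                    (d %/ p ^ s) /\
                  insep_degree (torus_field iota z L) (torus_field iota z H)
                    (p ^ s),
                general_fiber_component_count gamma (d %/ p ^ s)
              & coprime (d %/ p ^ s) p]]].
Proof.
move=> X gamma B L H.
have [j0 cj0] := exists_spanning k co_bij Aff_A.
have [co' [D [Q [co'_bij uQ coQ HL]]]] := adapted_coords co_bij (gen_L k co u j0).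
have LD x : L x <-> Lat co' D x by rewrite HL; exact: L_combinations.
have EL : L = Lat co' D by apply/funext => x; exact/propext.
have EH : H = Lat co' (zero_or_one D).
  by apply/funext => x; apply/propext; exact: (real_span_Lat co'_bij R uQ coQ LD).
split.
- exact: gauss_on_torusP.
- by move=> K iota z Hz; rewrite EL EH; split; [exact: fibers_Lat|exact: finite_Lat].
- exists (\rank (Bdiff k co u j0)), #|[pred i | D i != 0%N]|; split.
  + exact: aff_dim_B.
  + by rewrite /rk_Aff -/L EL; exact: rank_Lat.
  + exact: gauss_rank.
  move=> K iota xi Hxi.
  have [kap [z [kap0 z0 zadd Exi]]] := generic_point co_bij Aff_A Hxi.
  have Hz := generic_torus_field co_bij Aff_A Hxi kap0 z0 zadd Exi.
  have imE := image_field_gauss co_bij Aff_A Hxi kap0 z0 zadd Exi.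
  rewrite (rank_Bdiff cj0 co'_bij uQ coQ LD).
  have sub : [pred i | (D i)%:R != 0 :> k] \subset [pred i | D i != 0%N].
    by apply/subsetP => i; rewrite !inE; apply: contraNneq => ->.
  split=> [[f [rf]]|E].
    rewrite imE // -/B -/L EL => /(separable_ext_Lat_necessary Hz co'_bij) Dk.
    by apply: eq_card => i; rewrite !inE; apply/idP/idP => [|/Dk//]; apply: contraNneq => ->.
  exists (gpoly k co u); split; first exact: represents_gpoly.
  rewrite imE; last exact: represents_gpoly.
  rewrite -/B -/L EL; apply: (separable_ext_Lat_sufficient Hz co'_bij) => i Di.
  have := subset_cardP E sub i; rewrite !inE => ->.
  exact: Di.
move=> p pk; have pp := pcharf_prime pk.
exists (\prod_i nonzero_factor D i)%N; split.
- by rewrite EL EH; exact: index_Lat (zero_or_oneM D) (nonzero_factor_gt0 D)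
    (@nonzero_factor1 n D).
- by move=> K iota z Hz; rewrite EL EH;
    apply: (degree_Lat Hz co'_bij (zero_or_oneM D) (nonzero_factor_gt0 D) (@nonzero_factor1 n
      D)).
move=> s ps smax; have [-> ->] := max_p_power pp ps smax; split.
- move=> K iota z Hz; rewrite EL EH; split; first exact: sep_degree_Lat.
  exact: insep_degree_Lat.
- apply: (general_fiber_count co_bij Aff_A co'_bij LD) => [i||i|i x Di].
  + by rewrite /p'_factor => ->.
  + by move=> i; rewrite [X in (_ %| X)%N](D_mid_p' D p) dvdn_mull.
  + exact: p'_factor_neq0.
  rewrite {1}(D_mid_p' D p i) /D_mid (negPf Di) p_part mulnC exprM => E.
  by apply: (frob_inj pk (e := logn p (D i))); rewrite E expr1n.
- exact: coprime_p'_factor.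
Qed.
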